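(* Let $X\neq\{0\}$ be a complex Banach space with open unit ball $\mathbb{B}$ and let $\frac12\le\lambda\le 1$. Let $F$ be a locally biholomorphic mapping on $\mathbb{B}$ such that, for each $k=1,2,3$, there is a complex-valued homogeneous polynomial $H_{F,k}:X\to\mathbb{C}$ of degree $k$ with $$\frac{D^{k+1}F(0)(x^{k+1})}{(k+1)!}=H_{F,k}(x)\,x\qquad\text{for all }x\in X .$$ If $F\in\widehat{\mathcal{F}}_{\lambda}(\mathbb{B})$, then for every $x_0\in X$ with $\|x_0\|=1$ (and every $T_{x_0}\in T(x_0)$), $$|T_3(1)(F)|\le\frac{(4+3\lambda+2\lambda^2)(7+6\lambda+8\lambda^2)}{18}$$ and $$|T_3(2)(F)|\le\frac{1}{864}(1+2\lambda)^3(9+5\lambda+2\lambda^2)(25+17\lambda+10\lambda^2).$$ The inequalities are sharp: for every $\lambda\in[\frac12,1]$ and for each of the two inequalities there exist such an $F$, $x_0$ and $T_{x_0}$ for which equality holds.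
   Context: $X$ is a complex Banach space with norm $\|\cdot\|$ and $\mathbb{B}=\{x\in X:\|x\|<1\}$. For $x\in X\setminus\{0\}$, $T(x)$ is the set of bounded linear functionals $T_x:X\to\mathbb{C}$ with $T_x(x)=\|x\|$ and $\|T_x\|=1$. $D^nF(x)$ denotes the $n$th Fréchet derivative of $F$ at $x$ (a bounded symmetric $n$-linear map $X^n\to X$), and $D^nF(0)(x^n)=D^nF(0)(x,\ldots,x)$. A holomorphic map $F:\mathbb{B}\to X$ is normalized if $F(0)=0$ and $DF(0)=I$; it is locally biholomorphic if $DF(x)$ is invertible with bounded inverse for every $x\in\mathbb{B}$. For $\frac12\le\lambda\le1$, $\widehat{\mathcal{F}}_{\lambda}(\mathbb{B})$ is the class of normalized locally biholomorphic maps $F:\mathbb{B}\to X$ such that $$\operatorname{Re}\left\{T_x\left(\frac{(DF(x))^{-1}\bigl(D^2F(x)(x,x)+DF(x)x\bigr)}{\|x\|}\right)\right\}\ge\frac12-\lambda$$ for every $x\in\mathbb{B}\setminus\{0\}$ and every $T_x\in T(x)$. For $\|x_0\|=1$ and $T_{x_0}\in T(x_0)$, put $A_n=\frac{1}{n!}T_{x_0}\bigl(D^nF(0)(x_0,\ldots,x_0)\bigr)$ for $n=2,3,4$, and define the Toeplitz determinants $$T_3(1)(F)=\begin{vmatrix} 1 & A_2 & A_3 \\ {A_2} & 1 & A_2 \\ {A_3} & A_2 & 1 \end{vmatrix},\qquad T_3(2)(F)=\begin{vmatrix} A_2 & A_3 & A_4 \\ {A_3} & A_2 & A_3 \\ {A_4}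 & A_3 & A_2 \end{vmatrix}.$$ *)

(* Defs.v *)
(* Written over the Stdlib reals with Coquelicot; a complex normed space is a
   [NormedModule C_AbsRing]. *)
From Stdlib Require Import Reals Lra Factorial ClassicalEpsilon.
From Stdlib Require Import FunctionalExtensionality ProofIrrelevance.
From Coquelicot Require Import Coquelicot.
Open Scope R_scope.

Lemma norm_scal_C (U : NormedModule C_AbsRing) (k : C) (x : U) :
  norm (scal k x) = Cmod k * norm x.
Proof.
apply Rle_antisym; [exact (norm_scal k x)|].
destruct (Ceq_dec k 0) as [-> | Hk].
- rewrite Cmod_0, Rmult_0_l; apply norm_ge_0.
- assert (Hp : 0 < Cmod k) by now apply Cmod_gt_0.
  assert (E : x = scal (/ k)%C (scal k x)).
  { rewrite scal_assoc.
    change (@mult C_Ring (/ k)%C k) with (/ k * k)%C.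
    rewrite (Cinv_l k Hk); symmetry; exact (scal_one x). }
  rewrite E at 1.
  apply Rle_trans with (Cmod k * (Cmod (/ k) * norm (scal k x))).
  + apply Rmult_le_compat_l; [lra|].
    exact (norm_scal (/ k)%C (scal k x)).
  + rewrite <- Rmult_assoc, <- Cmod_mult, (Cinv_r k Hk), Cmod_1; lra.
Qed.

Section BoundedLinearMaps.

Variables U V : NormedModule C_AbsRing.

(* [is_linear] includes boundedness. *)
Record lin := Lin { lin_fun :> U -> V; lin_linear : is_linear lin_fun }.

Lemma lin_ext (f g : lin) : (forall x, f x = g x) -> f = g.
Proof.
destruct f as [f Hf], g as [g Hg]; simpl; intros H.
assert (E : f = g) by now apply functional_extensionality.
subst g; f_equal; apply proof_irrelevance.
Qed.

Lemma is_linear_sum (f g : lin) : is_linear (fun x => plus (f x) (g x)).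
Proof.
apply (is_linear_comp (fun x => (f x, g x)) (fun t : V * V => plus (fst t) (snd t))).
- apply is_linear_prod; apply lin_linear.
- apply is_linear_plus.
Qed.

Lemma is_linear_neg (f : lin) : is_linear (fun x => opp (f x)).
Proof.
exact (is_linear_comp f opp (lin_linear f) is_linear_opp).
Qed.

Lemma is_linear_mul (k : C_AbsRing) (f : lin) : is_linear (fun x => scal k (f x)).
Proof.
apply (is_linear_comp f (fun y => scal k y) (lin_linear f)).
apply is_linear_scal_r; exact Cmult_comm.
Qed.

Definition lin_plus (f g : lin) : lin := Lin _ (is_linear_sum f g).
Definition lin_opp (f : lin) : lin := Lin _ (is_linear_neg f).
Definition lin_zero : lin := Lin (fun _ => zero) is_linear_zero.
Definition lin_scal (k : C_AbsRing) (f : lin) : lin := Lin _ (is_linear_mul k f).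

Lemma lin_plus_comm f g : lin_plus f g = lin_plus g f.
Proof. apply lin_ext; intros x; apply plus_comm. Qed.

Lemma lin_plus_assoc f g h : lin_plus f (lin_plus g h) = lin_plus (lin_plus f g) h.
Proof. apply lin_ext; intros x; apply plus_assoc. Qed.

Lemma lin_plus_zero f : lin_plus f lin_zero = f.
Proof. apply lin_ext; intros x; apply plus_zero_r. Qed.

Lemma lin_plus_opp f : lin_plus f (lin_opp f) = lin_zero.
Proof. apply lin_ext; intros x; exact (plus_opp_r (f x)). Qed.

Lemma lin_scal_assoc (k l : C_AbsRing) f :
  lin_scal k (lin_scal l f) = lin_scal (mult k l) f.
Proof. apply lin_ext; intros x; exact (scal_assoc k l (f x)). Qed.

Lemma lin_scal_one f : lin_scal one f = f.
Proof. apply lin_ext; intros x; apply (scal_one (f x)). Qed.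

Lemma lin_scal_distr_l (k : C_AbsRing) f g :
  lin_scal k (lin_plus f g) = lin_plus (lin_scal k f) (lin_scal k g).
Proof. apply lin_ext; intros x; apply (scal_distr_l k (f x) (g x)). Qed.

Lemma lin_scal_distr_r (k l : C_AbsRing) f :
  lin_scal (plus k l) f = lin_plus (lin_scal k f) (lin_scal l f).
Proof. apply lin_ext; intros x; apply (scal_distr_r k l (f x)). Qed.

Definition lin_AbelianMonoid_mixin :=
  AbelianMonoid.Mixin lin lin_plus lin_zero
    lin_plus_comm lin_plus_assoc lin_plus_zero.

Canonical lin_AbelianMonoid :=
  AbelianMonoid.Pack lin lin_AbelianMonoid_mixin lin.

Definition lin_AbelianGroup_mixin :=
  AbelianGroup.Mixin lin_AbelianMonoid lin_opp lin_plus_opp.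

Canonical lin_AbelianGroup :=
  AbelianGroup.Pack lin
    (AbelianGroup.Class _ lin_AbelianMonoid_mixin lin_AbelianGroup_mixin) lin.

Definition lin_ModuleSpace_mixin :=
  ModuleSpace.Mixin C_AbsRing lin_AbelianGroup lin_scal
    lin_scal_assoc lin_scal_one lin_scal_distr_l lin_scal_distr_r.

Canonical lin_ModuleSpace :=
  ModuleSpace.Pack C_AbsRing lin
    (ModuleSpace.Class _ _ (AbelianGroup.class lin_AbelianGroup)
       lin_ModuleSpace_mixin) lin.

Definition op_norm (f : U -> V) : R :=
  real (Lub_Rbar (fun r => exists x : U, norm x <= 1 /\ r = norm (f x))).

Lemma op_norm_lub (f : lin) :
  is_lub_Rbar (fun r => exists x : U, norm x <= 1 /\ r = norm (f x))
    (Finite (op_norm f)).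
Proof.
unfold op_norm.
destruct (linear_norm _ (lin_linear f)) as [M [HM Hf]].
pose proof (Lub_Rbar_correct
  (fun r => exists x : U, norm x <= 1 /\ r = norm (f x))) as [H1 H2].
destruct (Lub_Rbar (fun r => exists x : U, norm x <= 1 /\ r = norm (f x)))
  as [l | |]; simpl.
- split; assumption.
- exfalso; apply (H2 (Finite M)).
  intros r [x [Hx ->]]; simpl.
  apply Rle_trans with (1 := Hf x).
  rewrite <- (Rmult_1_r M) at 2; apply Rmult_le_compat_l; lra.
- exfalso; apply (H1 (norm (f zero))).
  exists zero; split; [rewrite norm_zero; lra | reflexivity].
Qed.

Lemma op_norm_ub (f : lin) x : norm x <= 1 -> norm (f x) <= op_norm f.
Proof.
intros Hx; apply (proj1 (op_norm_lub f) (norm (f x))).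
now exists x.
Qed.

Lemma op_norm_le (f : lin) M :
  (forall x : U, norm x <= 1 -> norm (f x) <= M) -> op_norm f <= M.
Proof.
intros H; apply (proj2 (op_norm_lub f) (Finite M)).
intros r [x [Hx ->]]; exact (H x Hx).
Qed.

Lemma op_norm_ge_0 (f : lin) : 0 <= op_norm f.
Proof.
apply Rle_trans with (norm (f zero)); [apply norm_ge_0|].
apply op_norm_ub; rewrite norm_zero; lra.
Qed.

Lemma op_norm_apply (f : lin) (x : U) : norm (f x) <= op_norm f * norm x.
Proof.
destruct (Rle_lt_or_eq_dec _ _ (norm_ge_0 x)) as [Hx | Hx].
- assert (Hy : norm (scal (RtoC (/ norm x)) x) <= 1).
  { rewrite norm_scal_C, Cmod_R, Rabs_pos_eq.
    - rewrite Rinv_l; lra.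
    - apply Rlt_le, Rinv_0_lt_compat, Hx. }
  apply op_norm_ub with (f := f) in Hy.
  rewrite (linear_scal _ (lin_linear f)), norm_scal_C, Cmod_R, Rabs_pos_eq in Hy
    by (apply Rlt_le, Rinv_0_lt_compat, Hx).
  apply Rmult_le_reg_l with (/ norm x); [now apply Rinv_0_lt_compat|].
  apply Rle_trans with (1 := Hy); right; field; lra.
- rewrite <- Hx, Rmult_0_r.
  rewrite (norm_eq_zero x (eq_sym Hx)), (linear_zero _ (lin_linear f)), norm_zero.
  lra.
Qed.

Lemma op_norm_triangle (f g : lin) : op_norm (plus f g) <= op_norm f + op_norm g.
Proof.
apply op_norm_le; intros x Hx.
apply Rle_trans with (1 := norm_triangle (f x) (g x)).
apply Rplus_le_compat; now apply op_norm_ub.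
Qed.

Lemma op_norm_scal (k : C_AbsRing) (f : lin) :
  op_norm (scal k f) <= abs k * op_norm f.
Proof.
apply op_norm_le; intros x Hx.
apply Rle_trans with (1 := norm_scal k (f x)).
apply Rmult_le_compat_l; [apply abs_ge_0 | now apply op_norm_ub].
Qed.

Lemma op_norm_eq_zero (f : lin) : op_norm f = 0 -> f = zero.
Proof.
intros H; apply lin_ext; intros x; apply norm_eq_zero.
apply Rle_antisym; [|apply norm_ge_0].
apply Rle_trans with (1 := op_norm_apply f x); rewrite H; lra.
Qed.

Lemma op_norm_opp (f : lin) : op_norm (opp f) = op_norm f.
Proof.
assert (H : forall g : lin, op_norm (opp g) <= op_norm g).
{ intros g; apply op_norm_le; intros x Hx.
  change (norm (opp (g x)) <= op_norm g).
  rewrite norm_opp; now apply op_norm_ub. }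
apply Rle_antisym; [apply H|].
rewrite <- (opp_opp f) at 1; apply H.
Qed.

Definition lin_ball (f : lin) (e : R) (g : lin) : Prop := op_norm (minus g f) < e.

Lemma lin_ball_center (f : lin) (e : posreal) : lin_ball f e f.
Proof.
unfold lin_ball; rewrite minus_eq_zero.
apply Rle_lt_trans with 0; [|apply cond_pos].
apply op_norm_le; intros x _; right; exact norm_zero.
Qed.

Lemma lin_ball_sym (f g : lin) (e : R) : lin_ball f e g -> lin_ball g e f.
Proof.
unfold lin_ball; intros H.
now rewrite <- (opp_minus g f), op_norm_opp.
Qed.

Lemma lin_ball_triangle (f g h : lin) (e1 e2 : R) :
  lin_ball f e1 g -> lin_ball g e2 h -> lin_ball f (e1 + e2) h.
Proof.
unfold lin_ball; intros H1 H2.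
rewrite (minus_trans g h f).
apply Rle_lt_trans with (1 := op_norm_triangle _ _); lra.
Qed.

Definition lin_UniformSpace_mixin :=
  UniformSpace.Mixin lin lin_zero lin_ball
    lin_ball_center lin_ball_sym lin_ball_triangle.

Canonical lin_UniformSpace :=
  UniformSpace.Pack lin lin_UniformSpace_mixin lin.

Canonical lin_NormedModuleAux :=
  NormedModuleAux.Pack C_AbsRing lin
    (NormedModuleAux.Class _ _ (ModuleSpace.class _ lin_ModuleSpace)
       lin_UniformSpace_mixin) lin.

Lemma lin_norm_compat1 (f g : lin) (e : R) : op_norm (minus g f) < e -> ball f e g.
Proof. exact (fun H => H). Qed.

Lemma lin_norm_compat2 (f g : lin) (e : posreal) :
  ball f e g -> op_norm (minus g f) < 1 * e.
Proof. rewrite Rmult_1_l; exact (fun H => H). Qed.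

Definition lin_NormedModule_mixin :=
  NormedModule.Mixin C_AbsRing lin_NormedModuleAux op_norm 1
    op_norm_triangle op_norm_scal lin_norm_compat1 lin_norm_compat2
    op_norm_eq_zero.

Canonical lin_NormedModule :=
  NormedModule.Pack C_AbsRing lin
    (NormedModule.Class _ _ (NormedModuleAux.class _ lin_NormedModuleAux)
       lin_NormedModule_mixin) lin.

End BoundedLinearMaps.

Arguments op_norm {U V} f.
Arguments lin_fun {U V} _ _.
Arguments lin_linear {U V} _.

(* Total: an arbitrary bounded linear map where [f] is not differentiable. *)
Definition frechet {U V : NormedModule C_AbsRing} (f : U -> V) (x : U) : lin U V :=
  epsilon (inhabits (lin_zero U V)) (fun l => filterdiff f (locally x) l).

(* Bounded [n]-linear maps from [U^n] to [V], in curried form. *)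
Fixpoint multilin (n : nat) (U V : NormedModule C_AbsRing) : NormedModule C_AbsRing :=
  match n with
  | O => V
  | S m => lin_NormedModule U (multilin m U V)
  end.

Fixpoint diag {U V : NormedModule C_AbsRing} (n : nat) (x : U) :
    multilin n U V -> V :=
  match n with
  | O => fun A => A
  | S m => fun A => diag m x (lin_fun A x)
  end.

Fixpoint frechet_n {U V : NormedModule C_AbsRing} (n : nat) (F : U -> V) :
    U -> multilin n U V :=
  match n with
  | O => F
  | S m => frechet (frechet_n m F)
  end.

Definition D {X : NormedModule C_AbsRing} (F : X -> X) (x : X) : lin X X :=
  frechet_n 1 F x.

(* [Dn_diag n F x h] is D^n F(x)(h, ..., h). *)
Definition Dn_diag {X : NormedModule C_AbsRing} (n : nat) (F : X -> X) (x h : X) : X :=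
  diag n h (frechet_n n F x).

Definition homogeneous_polynomial {X : NormedModule C_AbsRing} (k : nat)
    (H : X -> C) : Prop :=
  exists A : multilin k X C_NormedModule, forall x, H x = diag k x A.

(* Maps of the open unit ball are represented by functions on the whole space;
   nothing below depends on their values outside the ball. *)

Definition holomorphic_on_ball {X : NormedModule C_AbsRing} (F : X -> X) : Prop :=
  forall x : X, norm x < 1 -> ex_filterdiff F (locally x).

Definition normalized {X : NormedModule C_AbsRing} (F : X -> X) : Prop :=
  F zero = zero /\ forall v : X, D F zero v = v.

Definition is_inverse {X : NormedModule C_AbsRing} (A B : lin X X) : Prop :=
  (forall v, A (B v) = v) /\ (forall v, B (A v) = v).

Definition inverse {X : NormedModule C_AbsRing} (A : lin X X) : lin X X :=
  epsilon (inhabits (lin_zero X X)) (is_inverse A).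

Definition locally_biholomorphic {X : NormedModule C_AbsRing} (F : X -> X) : Prop :=
  holomorphic_on_ball F /\
  forall x : X, norm x < 1 -> exists B : lin X X, is_inverse (D F x) B.

Definition support_functional {X : NormedModule C_AbsRing} (x : X)
    (T : lin X C_NormedModule) : Prop :=
  T x = RtoC (norm x) /\ op_norm T = 1.

Definition class_F {X : NormedModule C_AbsRing} (lambda : R) (F : X -> X) : Prop :=
  normalized F /\ locally_biholomorphic F /\
  forall x : X, x <> zero -> norm x < 1 ->
  forall T : lin X C_NormedModule, support_functional x T ->
    Re (T (scal (RtoC (/ norm x))
             (inverse (D F x) (plus (Dn_diag 2 F x x) (D F x x)))))
    >= 1 / 2 - lambda.

(* D^{k+1}F(0)(x^{k+1}) / (k+1)! = H_k(x) x for k = 1, 2, 3. *)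
Definition scalar_type_coefficients {X : NormedModule C_AbsRing} (F : X -> X) : Prop :=
  forall k : nat, (1 <= k <= 3)%nat ->
  exists H : X -> C, homogeneous_polynomial k H /\
    forall x : X,
      scal (RtoC (/ INR (fact (k + 1)))) (Dn_diag (k + 1) F zero x) = scal (H x) x.

Definition coeff {X : NormedModule C_AbsRing} (F : X -> X) (x0 : X)
    (T : lin X C_NormedModule) (n : nat) : C :=
  (RtoC (/ INR (fact n)) * T (Dn_diag n F zero x0))%C.

Definition det3 (a11 a12 a13 a21 a22 a23 a31 a32 a33 : C) : C :=
  (a11 * (a22 * a33 - a23 * a32)
   - a12 * (a21 * a33 - a23 * a31)
   + a13 * (a21 * a32 - a22 * a31))%C.

Definition toeplitz3_1 {X : NormedModule C_AbsRing} (F : X -> X) (x0 : X)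
    (T : lin X C_NormedModule) : C :=
  let A := coeff F x0 T in
  det3 (RtoC 1) (A 2%nat) (A 3%nat)
       (A 2%nat) (RtoC 1) (A 2%nat)
       (A 3%nat) (A 2%nat) (RtoC 1).

Definition toeplitz3_2 {X : NormedModule C_AbsRing} (F : X -> X) (x0 : X)
    (T : lin X C_NormedModule) : C :=
  let A := coeff F x0 T in
  det3 (A 2%nat) (A 3%nat) (A 4%nat)
       (A 3%nat) (A 2%nat) (A 3%nat)
       (A 4%nat) (A 3%nat) (A 2%nat).

(* Main.v *)
From Stdlib Require Import Reals Lra Lia List Factorial.
From Stdlib Require Import ClassicalEpsilon FunctionalExtensionality.
From Coquelicot Require Import Coquelicot.
From mathcomp Require classical_sets.
Require Import Defs.
Open Scope R_scope.

(** Put [c = 1/2 + lambda]. On the complex line through [x_0] the scalar form of the low order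
    coefficients gives [DF(z x_0) x_0 = s(z) x_0 + o(z^3)], so that
    [p(z) = T (DF(z x_0)^{-1} (z D^2F(z x_0)(x_0, x_0) + DF(z x_0) x_0))] has, up to [o(z^3)], the
    expansion of [(z s' + s) / s]. As [Re p >= 1/2 - lambda], the function
    [(p - (1/2 - lambda)) / c = 1 + c_1 z + c_2 z^2 + c_3 z^3 + o(z^3)] is a Caratheodory function,
    hence [|c_n| <= 2] and [|c_n - c_1 c_{n-1}| <= 2]; the determinants factor as
    [(1 - A_3) (1 + A_3 - 2 A_2^2)] and [(A_2 - A_4) (A_2^2 - (2 A_3^2 - A_2 A_4))], and each factor
    is bounded by the triangle inequality after writing it in [c_1], [c_2 - c_1^2], [c_3 - c_1 c_2].
    Equality holds for [F(x) = g(i T x) x] with [(z g(z))' = (1 - z)^{-2c}].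

    Differentiability of the higher derivatives of [F] comes from Goursat's theorem on squares for
    [T o F] on complex lines: it gives Cauchy estimates, hence a quadratic Taylor estimate which is
    uniform and passes to the limit in the difference quotients of [F]. *)

(** * Linear identities in complex modules, by reflection *)

(** The coefficient hypotheses constrain [F] only to low order at the origin, so [DF(z x_0)^{-1}]
    never becomes a scalar on the line. The scalar expansion of [p] survives because the inverses
    stay bounded near [0] and carry an [o(z^3)] error to an [o(z^3)] error.

    The bounds [|c_n| <= 2] alone are too weak: in [A_3 - 2 A_2^2] and [2 A_3^2 - A_2 A_4] the
    monomials in the [c_n] have coefficients of both signs, and the differences [c_n - c_1 c_{n-1}]
    absorb the negative ones. Every estimate then becomes an equality for [c_n = 2 i^n], the
    coefficients of [(1 + i z) / (1 - i z)]. This is the origin of the factor [i] in the extremal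
    map: it makes [1] and [-A_3], and likewise [A_2] and [-A_4], add up instead of cancelling. The
    polynomials in [lambda] are the products of the bounds of the factors, rewritten from [c]. *)

Inductive mexp :=
| MVar (n : nat) | MZero | MPlus (a b : mexp) | MOpp (a : mexp) | MScal (c : C) (a : mexp).

Section ModuleReflection.

Variable V : ModuleSpace C_Ring.

Fixpoint meval (env : list V) (e : mexp) : V :=
  match e with
  | MVar n => nth n env zero
  | MZero => zero
  | MPlus a b => plus (meval env a) (meval env b)
  | MOpp a => opp (meval env a)
  | MScal c a => scal c (meval env a)
  end.

Fixpoint mcoef (e : mexp) (i : nat) : C :=
  match e with
  | MVar n => if Nat.eqb n i then RtoC 1 else RtoC 0
  | MZero => RtoC 0
  | MPlus a b => (mcoef a i + mcoef b i)%C
  | MOpp a => (- mcoef a i)%C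
  | MScal c a => (c * mcoef a i)%C
  end.

Fixpoint lincomb (f : nat -> C) (env : list V) : V :=
  match env with
  | nil => zero
  | v :: l => plus (scal (f O) v) (lincomb (fun i => f (S i)) l)
  end.

Lemma scal_C0 (v : V) : scal (RtoC 0 : C) v = zero.
Proof. exact (scal_zero_l v). Qed.

Lemma lincomb_ext f g env :
  (forall i, (i < length env)%nat -> f i = g i) -> lincomb f env = lincomb g env.
Proof.
revert f g; induction env as [|v l IH]; intros f g H; simpl; [reflexivity|].
rewrite (H O) by (simpl; lia); f_equal.
apply IH; intros i Hi; apply H; simpl; lia.
Qed.

Lemma lincomb_zero env : lincomb (fun _ => RtoC 0) env = zero.
Proof.
induction env as [|v l IH]; simpl; [reflexivity|].
now rewrite IH, scal_C0, plus_zero_l.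
Qed.

Lemma lincomb_var n env :
  lincomb (fun i => if Nat.eqb n i then RtoC 1 else RtoC 0) env = nth n env zero.
Proof.
revert n; induction env as [|v l IH]; intros [|n]; simpl; try reflexivity.
- rewrite lincomb_zero, plus_zero_r; exact (scal_one v).
- rewrite scal_C0, plus_zero_l; apply IH.
Qed.

Lemma lincomb_plus f g env :
  lincomb (fun i => (f i + g i)%C) env = plus (lincomb f env) (lincomb g env).
Proof.
revert f g; induction env as [|v l IH]; intros f g; simpl.
- now rewrite plus_zero_l.
- rewrite (IH (fun i => f (S i)) (fun i => g (S i))).
  rewrite (scal_distr_r (f O) (g O) v : scal (f O + g O)%C v = _).
  rewrite <- !plus_assoc; f_equal; rewrite !plus_assoc; f_equal; apply plus_comm.
Qed.

Lemma lincomb_scal c f env :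
  lincomb (fun i => (c * f i)%C) env = scal c (lincomb f env).
Proof.
revert f; induction env as [|v l IH]; intros f; simpl.
- now rewrite scal_zero_r.
- rewrite (IH (fun i => f (S i))), (scal_distr_l c); f_equal.
  symmetry; exact (scal_assoc c (f O) v).
Qed.

Lemma meval_lincomb env e : meval env e = lincomb (mcoef e) env.
Proof.
induction e as [n| |a IHa b IHb|a IHa|c a IHa]; cbn [meval].
- now rewrite <- lincomb_var.
- now rewrite <- (lincomb_zero env).
- now rewrite IHa, IHb, <- lincomb_plus.
- rewrite IHa.
  rewrite (lincomb_ext (mcoef (MOpp a)) (fun i => (- (1) * mcoef a i)%C))
    by (intros; simpl; ring).
  rewrite lincomb_scal; symmetry.
  change (- (1))%C with (@opp C_Ring one); apply scal_opp_one.
- now rewrite IHa, <- lincomb_scal.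
Qed.

(** A bounded quantifier that computes to a conjunction, one scalar identity for each atom. *)
Fixpoint all_below (n : nat) (P : nat -> Prop) : Prop :=
  match n with
  | O => True
  | S m => P O /\ all_below m (fun i => P (S i))
  end.

Lemma all_below_spec n P : all_below n P -> forall i, (i < n)%nat -> P i.
Proof.
revert P; induction n as [|n IH]; intros P; simpl; [intros; lia|].
intros [H0 H] [|i] Hi; [exact H0|].
apply (IH (fun i => P (S i)) H); lia.
Qed.

(** Two expressions with the same coefficient on every atom agree whatever linear relations the
    atoms satisfy; the coefficients are compared in the field [C]. *)
Lemma meval_eq env a b :
  all_below (length env) (fun i => mcoef a i = mcoef b i) ->
  meval env a = meval env b.
Proof.
intros H; rewrite !meval_lincomb; apply lincomb_ext.
now apply all_below_spec.
Qed.

End ModuleReflection.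

Ltac mem_index x l :=
  lazymatch l with
  | nil => constr:(@None nat)
  | ?y :: ?t =>
      let r := match goal with
               (* Atoms are identified up to conversion, so one vector seen through different
                  canonical structures is a single atom. *)
               | _ => let _ := constr:(eq_refl : x = y) in constr:(Some O)
               | _ => constr:(@None nat)
               end in
      lazymatch r with
      | Some _ => r
      | None => lazymatch mem_index x t with
                | Some ?n => constr:(Some (S n))
                | None => constr:(@None nat)
                end
      end
  end.

Ltac madd x l :=
  lazymatch mem_index x l with
  | Some _ => l
  | None => constr:(x :: l)
  end.

Ltac matoms V l e :=
  lazymatch e with
  | plus ?a ?b => let l1 := matoms V l a in matoms V l1 b
  | minus ?a ?b => let l1 := matoms V l a in matoms V l1 b
  | opp ?a => matoms V l a
  | scal _ ?a => matoms V l a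
  | zero => l
  | _ => madd (e : ModuleSpace.sort C_Ring V) l
  end.

Ltac mreify V l e :=
  lazymatch e with
  | plus ?a ?b =>
      let x := mreify V l a in let y := mreify V l b in constr:(MPlus x y)
  | minus ?a ?b =>
      let x := mreify V l a in let y := mreify V l b in constr:(MPlus x (MOpp y))
  | opp ?a => let x := mreify V l a in constr:(MOpp x)
  | scal ?c ?a => let x := mreify V l a in constr:(MScal c x)
  | zero => constr:(MZero)
  | _ => lazymatch mem_index (e : ModuleSpace.sort C_Ring V) l with
         | Some ?n => constr:(MVar n)
         end
  end.

Ltac module_prepare :=
  cbv beta;
  lazymatch goal with
  | |- @eq ?T ?a ?b =>
      (* Elaborating a dummy [scal] reveals the module structure [W] carried by the type of the
         equation. *)
      let h := constr:(fun (x : T) => scal (RtoC 1 : C_Ring) x) in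
      lazymatch h with
      | fun _ => @scal _ ?W _ _ =>
        let l := constr:(@nil (ModuleSpace.sort C_Ring W)) in
        let l := matoms W l a in
        let l := matoms W l b in
        let x := mreify W l a in
        let y := mreify W l b in
        refine (meval_eq W l x y _)
      end
  end.
Ltac module_ring :=
  module_prepare; cbn [length all_below mcoef Nat.eqb];
  repeat split; try (now ring).
Ltac module_field :=
  module_prepare; cbn [length all_below mcoef Nat.eqb]; 
  repeat split; try (now ring); field.

(** * Differentiation calculus over the complex field *)

Notation CMod := (NormedModule C_AbsRing).

Lemma norm_plus_le (V : CMod) (a b : V) : norm (plus a b) <= norm a + norm b.
Proof. exact (norm_triangle a b). Qed.

Lemma norm_sum_le (V : CMod) (c a b : V) : c = plus a b -> norm c <= norm a + norm b.
Proof. intros ->; exact (norm_triangle a b). Qed.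

Lemma norm_minus_sym (V : CMod) (a b : V) : norm (minus a b) = norm (minus b a).
Proof. rewrite <- (norm_opp (minus a b)), opp_minus; reflexivity. Qed.

Lemma norm_minus_le (V : CMod) (a b : V) : norm (minus a b) <= norm a + norm b.
Proof.
apply Rle_trans with (1 := norm_triangle a (opp b)); rewrite norm_opp; lra.
Qed.

Lemma norm_le_minus (V : CMod) (a b : V) : norm a <= norm (minus a b) + norm b.
Proof.
replace a with (plus (minus a b) b) at 1 by module_ring.
apply norm_plus_le.
Qed.

Lemma norm_minus_triangle (V : CMod) (a b c : V) :
  norm (minus a c) <= norm (minus a b) + norm (minus b c).
Proof.
replace (minus a c) with (plus (minus a b) (minus b c)) by module_ring.
apply norm_plus_le.
Qed.

Lemma norm_minus_self (V : CMod) (a : V) : norm (minus a a) = 0.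
Proof. replace (minus a a) with (zero : V) by module_ring; exact norm_zero. Qed.

Lemma norm_minus_zero (V : CMod) (a : V) : norm (minus a zero) = norm a.
Proof. f_equal; module_ring. Qed.

Lemma norm_plus_minus (V : CMod) (a b : V) : norm (minus (plus a b) a) = norm b.
Proof. f_equal; module_ring. Qed.

Lemma is_linear_opp_apply (U V : CMod) (l : U -> V) x : is_linear l -> l (opp x) = opp (l x).
Proof.
intros H; replace (opp x) with (scal (- (1) : C)%C x) by module_ring.
rewrite (linear_scal _ H); module_ring.
Qed.

Lemma is_linear_minus (U V : CMod) (l : U -> V) x y :
  is_linear l -> l (minus x y) = minus (l x) (l y).
Proof.
intros H; unfold minus; rewrite (linear_plus _ H), is_linear_opp_apply; easy.
Qed.

Lemma is_linear_scal_const (V : CMod) (d : V) :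
  is_linear (fun s : C_NormedModule => scal (s : C) d).
Proof.
split.
- intros x y; exact (scal_distr_r (x : C) y d).
- intros k x; symmetry; exact (scal_assoc (k : C) x d).
- exists (norm d + 1); split; [pose proof (norm_ge_0 d); lra|].
  intros x; rewrite norm_scal_C; change (norm x) with (Cmod x).
  pose proof (Cmod_ge_0 x); nra.
Qed.

(** The epsilon-delta form of [filterdiff] at [locally x]; [fder_filterdiff] proves the
    equivalence. *)
Definition fder {U V : CMod} (f : U -> V) (x : U) (l : U -> V) : Prop :=
  is_linear l /\
  forall e, 0 < e -> exists d, 0 < d /\ forall y : U, norm (minus y x) < d ->
    norm (minus (minus (f y) (f x)) (l (minus y x))) <= e * norm (minus y x).

Definition vder {V : CMod} (f : C -> V) (z : C) (d : V) : Prop :=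
  @fder C_NormedModule V f z (fun s => scal (s : C) d).

Lemma fder_filterdiff (U V : CMod) (f : U -> V) x l :
  filterdiff f (locally x) l <-> fder f x l.
Proof.
split.
- intros [Hl H]; split; [exact Hl|].
  intros e He.
  specialize (H x (fun P HP => HP) (mkposreal e He)).
  apply locally_norm_le_locally in H; destruct H as [d Hd].
  exists d; split; [apply cond_pos|exact Hd].
- intros [Hl H]; split; [exact Hl|].
  intros y Hy; apply is_filter_lim_locally_unique in Hy; subst y.
  intros e; destruct (H e (cond_pos e)) as [d [Hd H']].
  apply locally_le_locally_norm; exists (mkposreal d Hd); exact H'.
Qed.

Lemma fder_ext (U V : CMod) (f g : U -> V) x l m :
  (forall y, f y = g y) -> (forall h, l h = m h) -> fder f x l -> fder g x m.
Proof.
intros H H'; replace g with f by now apply functional_extensionality.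
now replace m with l by now apply functional_extensionality.
Qed.

Lemma fder_ext_loc (U V : CMod) (f g : U -> V) x l r :
  0 < r -> (forall y, norm (minus y x) < r -> f y = g y) -> fder f x l -> fder g x l.
Proof.
intros Hr E [Hl H]; split; [exact Hl|]; intros e He.
destruct (H e He) as [d [Hd H']].
exists (Rmin d r); split; [now apply Rmin_pos|]; intros y Hy.
rewrite <- (E x), <- (E y).
- apply H'; apply Rlt_le_trans with (1 := Hy), Rmin_l.
- apply Rlt_le_trans with (1 := Hy), Rmin_r.
- rewrite norm_minus_self; exact Hr.
Qed.

Lemma fder_linear (U V : CMod) (l : U -> V) x : is_linear l -> fder l x l.
Proof.
intros H; split; [exact H|]; intros e He; exists 1; split; [lra|]; intros y _.
rewrite (is_linear_minus U V l y x H), norm_minus_self.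
apply Rmult_le_pos; [lra|apply norm_ge_0].
Qed.

Lemma fder_const (U V : CMod) (c : V) (x : U) : fder (fun _ => c) x (fun _ => zero).
Proof.
split; [apply is_linear_zero|]; intros e He; exists 1; split; [lra|]; intros y _.
match goal with |- norm ?u <= _ => replace u with (zero : V) by module_ring end.
match goal with |- norm ?u <= _ => replace (norm u) with 0 by (symmetry; exact (@norm_zero _ V)) end.
apply Rmult_le_pos; [lra|apply norm_ge_0].
Qed.

Lemma fder_plus (U V : CMod) (f g : U -> V) x l m :
  fder f x l -> fder g x m ->
  fder (fun y => plus (f y) (g y)) x (fun h => plus (l h) (m h)).
Proof.
intros [Hl H] [Hm K]; split.
- exact (lin_linear (lin_plus U V (Lin U V l Hl) (Lin U V m Hm))).
- intros e He.
  destruct (H (e / 2)) as [d1 [P1 H1]]; [lra|].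
  destruct (K (e / 2)) as [d2 [P2 H2]]; [lra|].
  exists (Rmin d1 d2); split; [now apply Rmin_pos|]; intros y Hy.
  specialize (H1 y (Rlt_le_trans _ _ _ Hy (Rmin_l _ _))).
  specialize (H2 y (Rlt_le_trans _ _ _ Hy (Rmin_r _ _))).
  replace (minus (minus (plus (f y) (g y)) (plus (f x) (g x)))
             (plus (l (minus y x)) (m (minus y x))))
    with (plus (minus (minus (f y) (f x)) (l (minus y x)))
               (minus (minus (g y) (g x)) (m (minus y x)))) by module_ring.
  apply Rle_trans with (1 := norm_plus_le _ _ _); lra.
Qed.

Lemma linear_bound (U V : CMod) (l : U -> V) :
  is_linear l -> exists M, 0 < M /\ forall x, norm (l x) <= M * norm x.
Proof. intros H; exact (linear_norm _ H). Qed.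

Lemma fder_lipschitz (U V : CMod) (f : U -> V) x l :
  fder f x l -> exists M d, 0 < M /\ 0 < d /\ forall y : U, norm (minus y x) < d ->
    norm (minus (f y) (f x)) <= M * norm (minus y x).
Proof.
intros [Hl H]; destruct (linear_bound _ _ _ Hl) as [M [HM B]].
destruct (H 1) as [d [Hd K]]; [lra|].
exists (M + 1), d; split; [lra|]; split; [exact Hd|]; intros y Hy.
specialize (K y Hy); specialize (B (minus y x)).
pose proof (norm_le_minus V (minus (f y) (f x)) (l (minus y x))); lra.
Qed.

Lemma fder_continuous (U V : CMod) (f : U -> V) x l e :
  fder f x l -> 0 < e -> exists d, 0 < d /\ forall y : U, norm (minus y x) < d ->
    norm (minus (f y) (f x)) < e.
Proof.
intros H He; destruct (fder_lipschitz _ _ _ _ _ H) as [M [d [HM [Hd K]]]].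
exists (Rmin d (e / M)); split; [apply Rmin_pos; [lra|now apply Rdiv_lt_0_compat]|].
intros y Hy.
apply Rle_lt_trans with (1 := K y (Rlt_le_trans _ _ _ Hy (Rmin_l _ _))).
pose proof (Rlt_le_trans _ _ _ Hy (Rmin_r _ _)) as Hy'.
apply Rmult_lt_compat_l with (r := M) in Hy'; [|exact HM].
replace (M * (e / M)) with e in Hy' by (field; lra); exact Hy'.
Qed.

Ltac below_min H :=
  apply Rlt_le_trans with (1 := H); unfold Rmin; repeat destruct Rle_dec; lra.

Lemma fder_comp (U V W : CMod) (f : U -> V) (g : V -> W) x l m :
  fder f x l -> fder g (f x) m -> fder (fun y => g (f y)) x (fun h => m (l h)).
Proof.
intros Hf [Hm K].
destruct (fder_lipschitz _ _ _ _ _ Hf) as [M [d [HM [Hd L]]]].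
destruct (linear_bound _ _ _ Hm) as [N [HN B]].
pose proof Hf as [Hl H].
split; [exact (is_linear_comp l m Hl Hm)|]; intros e He.
destruct (K (e / (2 * M))) as [d1 [P1 H1]]; [apply Rdiv_lt_0_compat; lra|].
destruct (H (e / (2 * N))) as [d2 [P2 H2]]; [apply Rdiv_lt_0_compat; lra|].
destruct (fder_continuous _ _ _ _ _ d1 Hf P1) as [d3 [P3 H3]].
exists (Rmin d (Rmin d2 d3)); split; [repeat apply Rmin_pos; lra|]; intros y Hy.
assert (Y1 : norm (minus y x) < d) by (apply Rlt_le_trans with (1 := Hy), Rmin_l).
assert (Y2 : norm (minus y x) < d2) by below_min Hy.
assert (Y3 : norm (minus y x) < d3) by below_min Hy.
specialize (L y Y1); specialize (H2 y Y2); specialize (H1 (f y) (H3 y Y3)).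
assert (E : minus (minus (g (f y)) (g (f x))) (m (l (minus y x))) =
  plus (minus (minus (g (f y)) (g (f x))) (m (minus (f y) (f x))))
       (m (minus (minus (f y) (f x)) (l (minus y x))))).
{ rewrite (is_linear_minus _ _ m (minus (f y) (f x))) by exact Hm; module_ring. }
rewrite E; clear E.
apply Rle_trans with (1 := norm_plus_le _ _ _).
specialize (B (minus (minus (f y) (f x)) (l (minus y x)))).
assert (e / (2 * M) * norm (minus (f y) (f x)) <= e / 2 * norm (minus y x)).
{ apply Rle_trans with (e / (2 * M) * (M * norm (minus y x))).
  - apply Rmult_le_compat_l; [|exact L]. apply Rlt_le, Rdiv_lt_0_compat; lra.
  - right; field; lra. }
assert (N * norm (minus (minus (f y) (f x)) (l (minus y x))) <= e / 2 * norm (minus y x)).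
{ apply Rle_trans with (N * (e / (2 * N) * norm (minus y x))).
  - apply Rmult_le_compat_l; [lra|exact H2].
  - right; field; lra. }
lra.
Qed.

Record bilinear {A B W : CMod} (b : A -> B -> W) : Prop := Bilinear {
  bilinear_l : forall v, is_linear (fun u => b u v);
  bilinear_r : forall u, is_linear (b u);
  bilinear_bound : exists M, 0 < M /\ forall u v, norm (b u v) <= M * norm u * norm v }.

Lemma fder_bilinear (U A B W : CMod) (b : A -> B -> W) (f : U -> A) (g : U -> B) x l m :
  bilinear b -> fder f x l -> fder g x m ->
  fder (fun y => b (f y) (g y)) x (fun h => plus (b (l h) (g x)) (b (f x) (m h))).
Proof.
intros [Hbl Hbr [N [HN Bd]]] Hf Hg.
assert (F1 : is_linear l) by apply Hf; assert (G1 : is_linear m) by apply Hg.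
split.
{ pose proof (is_linear_comp l (fun u => b u (g x)) F1 (Hbl (g x))) as I1.
  pose proof (is_linear_comp m (b (f x)) G1 (Hbr (f x))) as I2.
  exact (lin_linear (lin_plus U W (Lin _ _ _ I1) (Lin _ _ _ I2))). }
destruct (fder_lipschitz _ _ _ _ _ Hg) as [M [d [HM [Hd L]]]].
destruct (linear_bound _ _ _ F1) as [K [HK BK]].
intros e He.
pose proof (norm_ge_0 (f x)); pose proof (norm_ge_0 (g x)).
assert (Q1 : 0 < N * (norm (g x) + 1)) by (apply Rmult_lt_0_compat; lra).
assert (Q2 : 0 < N * (norm (f x) + 1)) by (apply Rmult_lt_0_compat; lra).
(* Each of the three error terms below receives [e / 3]; the [+ 1] keeps the denominators positive
   when [f x] or [g x] vanishes. *)
destruct (proj2 Hf (e / (3 * (N * (norm (g x) + 1))))) as [d1 [P1 H1]];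
  [apply Rdiv_lt_0_compat; lra|].
destruct (proj2 Hg (e / (3 * (N * (norm (f x) + 1))))) as [d2 [P2 H2]];
  [apply Rdiv_lt_0_compat; lra|].
destruct (fder_continuous _ _ _ _ _ 1 Hg) as [d3 [P3 H3]]; [lra|].
destruct (fder_continuous _ _ _ _ _ (e / (3 * (N * K))) Hg) as [d4 [P4 H4]];
  [apply Rdiv_lt_0_compat; [lra|]; apply Rmult_lt_0_compat; [lra|]; now apply Rmult_lt_0_compat|].
exists (Rmin (Rmin d1 d2) (Rmin d3 d4)); split; [repeat apply Rmin_pos; lra|].
intros y Hy.
assert (Y1 : norm (minus y x) < d1) by below_min Hy.
assert (Y2 : norm (minus y x) < d2) by below_min Hy.
assert (Y3 : norm (minus y x) < d3) by below_min Hy.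
assert (Y4 : norm (minus y x) < d4) by below_min Hy.
specialize (H1 y Y1); specialize (H2 y Y2); specialize (H3 y Y3); specialize (H4 y Y4).
set (h := minus y x) in *.
assert (E : minus (minus (b (f y) (g y)) (b (f x) (g x)))
                  (plus (b (l h) (g x)) (b (f x) (m h))) =
  plus (b (minus (minus (f y) (f x)) (l h)) (g y))
   (plus (b (l h) (minus (g y) (g x)))
         (b (f x) (minus (minus (g y) (g x)) (m h))))).
{ pose proof (fun u u' v => is_linear_minus _ _ (fun u => b u v) u u' (Hbl v)) as Sl.
  pose proof (fun u v v' => is_linear_minus _ _ (b u) v v' (Hbr u)) as Sr.
  cbv beta in Sl; rewrite !Sl, !Sr; module_ring. }
rewrite E; clear E.
apply Rle_trans with (1 := norm_plus_le _ _ _).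
pose proof (norm_plus_le _ (b (l h) (minus (g y) (g x)))
         (b (f x) (minus (minus (g y) (g x)) (m h)))) as T.
pose proof (Bd (minus (minus (f y) (f x)) (l h)) (g y)) as B1.
pose proof (Bd (l h) (minus (g y) (g x))) as B2.
pose proof (Bd (f x) (minus (minus (g y) (g x)) (m h))) as B3.
pose proof (norm_le_minus _ (g y) (g x)) as Gy.
pose proof (norm_ge_0 h) as Hh.
assert (C1 : N * norm (minus (minus (f y) (f x)) (l h)) * norm (g y) <= e / 3 * norm h).
{ apply Rle_trans with (N * (e / (3 * (N * (norm (g x) + 1))) * norm h) * (norm (g x) + 1)).
  - apply Rmult_le_compat; try apply norm_ge_0; try lra.
    + apply Rmult_le_pos; [lra|apply norm_ge_0].
    + apply Rmult_le_compat_l; [lra|exact H1].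
  - right; field; lra. }
assert (C2 : N * norm (l h) * norm (minus (g y) (g x)) <= e / 3 * norm h).
{ apply Rle_trans with (N * (K * norm h) * (e / (3 * (N * K)))).
  - apply Rmult_le_compat; try apply norm_ge_0; try lra.
    + apply Rmult_le_pos; [lra|apply norm_ge_0].
    + apply Rmult_le_compat_l; [lra|apply BK].
  - right; field; lra. }
assert (C3 : N * norm (f x) * norm (minus (minus (g y) (g x)) (m h)) <= e / 3 * norm h).
{ apply Rle_trans with (N * (norm (f x) + 1) * (e / (3 * (N * (norm (f x) + 1))) * norm h)).
  - apply Rmult_le_compat; try apply norm_ge_0; try lra.
    apply Rmult_le_pos; lra.
  - right; field; lra. }
lra.
Qed.

(* The increments [y - x] approach every direction [t h], so the derivative is determined by [f]. *)
Lemma fder_unique (U V : CMod) (f : U -> V) x l m :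
  fder f x l -> fder f x m -> forall h, l h = m h.
Proof.
intros [Hl H] [Hm K] h.
destruct (Req_dec (norm (minus (l h) (m h))) 0) as [E|E].
{ apply norm_eq_zero in E.
  replace (l h) with (plus (minus (l h) (m h)) (m h)) by module_ring.
  rewrite E; module_ring. }
exfalso.
pose proof (norm_ge_0 (minus (l h) (m h))) as P.
set (q := norm (minus (l h) (m h))) in *.
pose proof (norm_ge_0 h) as Nh.
destruct (H (q / (4 * (norm h + 1)))) as [d1 [D1 H1]]; [apply Rdiv_lt_0_compat; lra|].
destruct (K (q / (4 * (norm h + 1)))) as [d2 [D2 H2]]; [apply Rdiv_lt_0_compat; lra|].
set (t := Rmin d1 d2 / (2 * (norm h + 1))).
assert (Dm : 0 < Rmin d1 d2) by now apply Rmin_pos.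
assert (Ht : 0 < t) by (apply Rdiv_lt_0_compat; lra).
set (y := plus x (scal (RtoC t : C) h)).
assert (Ey : minus y x = scal (RtoC t : C) h) by (unfold y; module_ring).
assert (Ny : norm (minus y x) = t * norm h).
{ rewrite Ey, norm_scal_C, Cmod_R, Rabs_pos_eq; lra. }
assert (Hy : norm (minus y x) < Rmin d1 d2).
{ rewrite Ny; unfold t.
  apply Rle_lt_trans with (Rmin d1 d2 / (2 * (norm h + 1)) * (norm h + 1)).
  - fold t; apply Rmult_le_compat_l; lra.
  - replace (Rmin d1 d2 / (2 * (norm h + 1)) * (norm h + 1)) with (Rmin d1 d2 / 2)
      by (field; lra); lra. }
specialize (H1 y (Rlt_le_trans _ _ _ Hy (Rmin_l _ _))).
specialize (H2 y (Rlt_le_trans _ _ _ Hy (Rmin_r _ _))).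
rewrite Ny in H1, H2; rewrite Ey, (linear_scal _ Hl) in H1.
rewrite Ey, (linear_scal _ Hm) in H2.
pose proof (norm_minus_le _ (minus (minus (f y) (f x)) (scal (RtoC t : C) (m h)))
  (minus (minus (f y) (f x)) (scal (RtoC t : C) (l h)))) as T.
replace (minus (minus (minus (f y) (f x)) (scal (RtoC t : C) (m h)))
  (minus (minus (f y) (f x)) (scal (RtoC t : C) (l h)))) with
  (scal (RtoC t : C) (minus (l h) (m h))) in T by module_ring.
rewrite norm_scal_C, Cmod_R, Rabs_pos_eq in T by lra; fold q in T.
assert (q / (4 * (norm h + 1)) * (t * norm h) <= q / 4 * t).
{ apply Rle_trans with (q / (4 * (norm h + 1)) * (t * (norm h + 1))).
  - apply Rmult_le_compat_l; [apply Rlt_le, Rdiv_lt_0_compat; lra|].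
    apply Rmult_le_compat_l; lra.
  - right; field; lra. }
assert (0 < t * q) by (apply Rmult_lt_0_compat; lra).
pose proof (Rle_trans _ _ _ T (Rplus_le_compat _ _ _ _ H2 H1)); lra.
Qed.

Lemma bilinear_scal (V : CMod) :
  bilinear (fun (c : C_NormedModule) (v : V) => scal (c : C) v).
Proof.
split.
- intros v; apply is_linear_scal_const.
- intros c; apply (is_linear_scal_r c); exact Cmult_comm.
- exists 1; split; [lra|]; intros u v.
  rewrite norm_scal_C; change (norm u) with (Cmod u); lra.
Qed.

Lemma is_linear_apply (U V : CMod) (v : U) : is_linear (fun A : lin U V => A v).
Proof.
split; try reflexivity.
exists (norm v + 1); split; [pose proof (norm_ge_0 v); lra|].
intros A; apply Rle_trans with (1 := op_norm_apply U V A v).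
change (norm A) with (op_norm A).
pose proof (op_norm_ge_0 U V A); pose proof (norm_ge_0 v); nra.
Qed.

Lemma vder_ext (V : CMod) (f g : C -> V) z d d' :
  (forall y, f y = g y) -> d = d' -> vder f z d -> vder g z d'.
Proof.
intros H -> K; exact (fder_ext C_NormedModule V f g z _ _ H (fun _ => eq_refl) K).
Qed.

Lemma vder_const (V : CMod) (c : V) z : vder (fun _ => c) z zero.
Proof.
eapply (fder_ext C_NormedModule V); [reflexivity| |apply fder_const].
intros h; module_ring.
Qed.

Lemma vder_id z : vder (fun w : C => w : C_NormedModule) z (RtoC 1).
Proof.
eapply (fder_ext C_NormedModule C_NormedModule); [reflexivity| |].
2: apply (fder_linear C_NormedModule C_NormedModule (fun w => w)), is_linear_id.
intros h; symmetry; exact (mult_one_r (h : C)).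
Qed.

Lemma vder_plus (V : CMod) (f g : C -> V) z a b :
  vder f z a -> vder g z b -> vder (fun w => plus (f w) (g w)) z (plus a b).
Proof.
intros H K; pose proof (fder_plus C_NormedModule V f g z _ _ H K) as L.
revert L; apply (fder_ext C_NormedModule V); [reflexivity|].
intros h; module_ring.
Qed.

Lemma vder_linear (U V : CMod) (f : C -> U) (l : U -> V) z a :
  is_linear l -> vder f z a -> vder (fun w => l (f w)) z (l a).
Proof.
intros Hl H.
pose proof (fder_comp C_NormedModule U V f l z _ _ H (fder_linear _ _ l (f z) Hl)) as L.
revert L; apply (fder_ext C_NormedModule V); [reflexivity|].
intros h; exact (linear_scal _ Hl _ _).
Qed.

Lemma vder_scal_r (V : CMod) (f : C -> V) z a (c : C) :
  vder f z a -> vder (fun w => scal c (f w)) z (scal c a).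
Proof.
apply (vder_linear V V f (fun v => scal c v)).
apply (is_linear_scal_r c); exact Cmult_comm.
Qed.

Lemma vder_opp (V : CMod) (f : C -> V) z a :
  vder f z a -> vder (fun w => opp (f w)) z (opp a).
Proof. apply (vder_linear V V f opp), is_linear_opp. Qed.

Lemma vder_minus (V : CMod) (f g : C -> V) z a b :
  vder f z a -> vder g z b -> vder (fun w => minus (f w) (g w)) z (minus a b).
Proof. intros H K; apply vder_plus; [exact H|now apply vder_opp]. Qed.

Lemma vder_bilinear (A B W : CMod) (b : A -> B -> W) f g z a c :
  bilinear b -> vder f z a -> vder g z c ->
  vder (fun w => b (f w) (g w)) z (plus (b a (g z)) (b (f z) c)).
Proof.
intros Hb H K; pose proof (fder_bilinear C_NormedModule A B W b f g z _ _ Hb H K) as L.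
revert L; apply (fder_ext C_NormedModule W); [reflexivity|].
intros h; rewrite (linear_scal _ (bilinear_l _ Hb (g z))), (linear_scal _ (bilinear_r _ Hb (f z))).
module_ring.
Qed.

Lemma vder_scal (V : CMod) (f : C -> C) (g : C -> V) z (a : C) c :
  @vder C_NormedModule f z a -> vder g z c ->
  vder (fun w => scal (f w) (g w)) z (plus (scal a (g z)) (scal (f z) c)).
Proof.
exact (vder_bilinear C_NormedModule V V _ f g z a c (bilinear_scal V)).
Qed.

Lemma vder_fder_comp (U V : CMod) (f : C -> U) (g : U -> V) z a l :
  vder f z a -> fder g (f z) l -> vder (fun w => g (f w)) z (l a).
Proof.
intros H K; pose proof (fder_comp C_NormedModule U V f g z _ _ H K) as L.
revert L; apply (fder_ext C_NormedModule V); [reflexivity|].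
intros h; exact (linear_scal _ (proj1 K) _ _).
Qed.

Lemma vder_comp (V : CMod) (f : C -> C) (g : C -> V) z (a : C) d :
  @vder C_NormedModule f z a -> vder g (f z) d -> vder (fun w => g (f w)) z (scal a d).
Proof.
exact (vder_fder_comp C_NormedModule V f g z a _).
Qed.

Lemma vder_affine (U : CMod) (x k : U) z : vder (fun s => plus x (scal s k)) z k.
Proof.
eapply vder_ext; [reflexivity| |apply vder_plus; [apply vder_const|]].
2: apply (vder_scal U (fun s => s)); [apply vder_id|apply vder_const].
module_ring.
Qed.

Lemma vder_unique (V : CMod) (f : C -> V) z a b : vder f z a -> vder f z b -> a = b.
Proof.
intros H K; pose proof (fder_unique C_NormedModule V f z _ _ H K (RtoC 1)) as L.
simpl in L.
transitivity (scal (RtoC 1 : C) a); [module_ring|rewrite L; module_ring].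
Qed.

Lemma vder_Cmult (f g : C -> C) z (a b : C) :
  @vder C_NormedModule f z a -> @vder C_NormedModule g z b ->
  @vder C_NormedModule (fun w => f w * g w)%C z (a * g z + f z * b)%C.
Proof. exact (vder_scal C_NormedModule f g z a b). Qed.

Lemma vder_bound (V : CMod) (f : C -> V) z a :
  vder f z a -> forall e, 0 < e -> exists d, 0 < d /\ forall w, Cmod (w - z) < d ->
    norm (minus (minus (f w) (f z)) (scal (w - z)%C a)) <= e * Cmod (w - z).
Proof. intros [_ H]; exact H. Qed.

Lemma vder_intro (V : CMod) (f : C -> V) z a :
  (forall e, 0 < e -> exists d, 0 < d /\ forall w, Cmod (w - z) < d ->
    norm (minus (minus (f w) (f z)) (scal (w - z)%C a)) <= e * Cmod (w - z)) ->
  vder f z a.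
Proof. intros H; split; [apply is_linear_scal_const|exact H]. Qed.

(** * The theorem of Goursat on a square *)

Definition holo (f : C -> C) (z : C) : Prop := exists d, @vder C_NormedModule f z d.

Lemma holo_bound (f : C -> C) z d :
  @vder C_NormedModule f z d ->
  forall e, 0 < e -> exists r, 0 < r /\ forall w, Cmod (w - z) < r ->
    Cmod (f w - f z - (w - z) * d) <= e * Cmod (w - z).
Proof. intros H; exact (vder_bound _ _ _ _ H). Qed.

Lemma holo_intro (f : C -> C) z d :
  (forall e, 0 < e -> exists r, 0 < r /\ forall w, Cmod (w - z) < r ->
    Cmod (f w - f z - (w - z) * d) <= e * Cmod (w - z)) ->
  @vder C_NormedModule f z d.
Proof. intros H; exact (vder_intro C_NormedModule _ _ _ H). Qed.

Lemma holo_continuous (f : C -> C) z :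
  holo f z -> forall e, 0 < e -> exists r, 0 < r /\ forall w, Cmod (w - z) < r ->
    Cmod (f w - f z) < e.
Proof. intros [d H] e He; exact (fder_continuous _ _ _ _ _ _ H He). Qed.

Lemma holo_const c z : holo (fun _ => c) z.
Proof. exists zero; apply (vder_const C_NormedModule). Qed.

Lemma holo_id z : holo (fun w => w) z.
Proof. exists (RtoC 1); apply vder_id. Qed.

Lemma holo_plus f g z : holo f z -> holo g z -> holo (fun w => (f w + g w)%C) z.
Proof. intros [a H] [b K]; exists (a + b)%C; exact (vder_plus C_NormedModule f g z a b H K). Qed.

Lemma holo_opp f z : holo f z -> holo (fun w => (- f w)%C) z.
Proof. intros [a H]; exists (- a)%C; exact (vder_opp C_NormedModule f z a H). Qed.

Lemma holo_minus f g z : holo f z -> holo g z -> holo (fun w => (f w - g w)%C) z.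
Proof. intros H K; apply holo_plus; [exact H|now apply holo_opp]. Qed.

Lemma holo_mult f g z : holo f z -> holo g z -> holo (fun w => (f w * g w)%C) z.
Proof. intros [a H] [b K]; eexists; exact (vder_Cmult f g z a b H K). Qed.

Lemma holo_comp f g z : holo f z -> holo g (f z) -> holo (fun w => g (f w)) z.
Proof. intros [a H] [b K]; eexists; exact (vder_comp C_NormedModule f g z a b H K). Qed.

Lemma holo_pow f n z : holo f z -> holo (fun w => (f w ^ n)%C) z.
Proof.
intros H; induction n as [|n IH]; simpl; [apply holo_const|now apply holo_mult].
Qed.

Lemma Cmod_minus_sym a b : Cmod (a - b) = Cmod (b - a).
Proof. replace (b - a)%C with (- (a - b))%C by ring; now rewrite Cmod_opp. Qed.

Lemma Cmod_minus_le a b : Cmod (a - b) <= Cmod a + Cmod b.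
Proof. unfold Cminus; rewrite <- (Cmod_opp b); apply Cmod_triangle. Qed.

Lemma vder_Cinv (z : C) : z <> 0 -> @vder C_NormedModule (fun w => / w)%C z (- / (z * z))%C.
Proof.
intros Hz; apply holo_intro; intros e He.
assert (P : 0 < Cmod z) by now apply Cmod_gt_0.
assert (P2 : 0 < e * (Cmod z * Cmod z * Cmod z) / 2).
{ apply Rdiv_lt_0_compat; [|lra]; repeat apply Rmult_lt_0_compat; assumption. }
exists (Rmin (Cmod z / 2) (e * (Cmod z * Cmod z * Cmod z) / 2)); split.
{ apply Rmin_pos; lra. }
intros w Hw.
assert (W1 : Cmod (w - z) < Cmod z / 2) by (apply Rlt_le_trans with (1 := Hw), Rmin_l).
assert (W2 : Cmod (w - z) < e * (Cmod z * Cmod z * Cmod z) / 2)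
  by (apply Rlt_le_trans with (1 := Hw), Rmin_r).
assert (W3 : Cmod z / 2 < Cmod w).
{ pose proof (Cmod_triangle w (z - w)) as T.
  replace (w + (z - w))%C with z in T by ring.
  rewrite (Cmod_minus_sym z w) in T; lra. }
assert (Hw0 : w <> 0) by (apply Cmod_gt_0; lra).
replace (/ w - / z - (w - z) * - / (z * z))%C with ((w - z) * (w - z) * / (w * (z * z)))%C
  by (field; split; assumption).
assert (Hz2 : (w * (z * z))%C <> 0) by (repeat apply Cmult_neq_0; assumption).
rewrite !Cmod_mult, (Cmod_inv _ Hz2), !Cmod_mult.
pose proof (Cmod_ge_0 (w - z)) as Q.
assert (D : 0 < Cmod w * (Cmod z * Cmod z)) by (repeat apply Rmult_lt_0_compat; lra).
apply Rmult_le_reg_r with (1 := D).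
rewrite Rmult_assoc, Rinv_l, Rmult_1_r by lra.
rewrite (Rmult_assoc e), (Rmult_comm e), !Rmult_assoc.
apply Rmult_le_compat_l; [exact Q|].
assert (0 < Cmod z * Cmod z) by (apply Rmult_lt_0_compat; lra).
assert (Cmod z / 2 * (Cmod z * Cmod z * e) <= Cmod w * (Cmod z * Cmod z * e)).
{ apply Rmult_le_compat_r; [|lra]; apply Rmult_le_pos; lra. }
lra.
Qed.

Lemma holo_inv (f : C -> C) z : holo f z -> f z <> 0 -> holo (fun w => (/ f w)%C) z.
Proof.
intros H K; apply (holo_comp f (fun w => (/ w)%C)); [exact H|].
eexists; now apply vder_Cinv.
Qed.

Lemma holo_div (f g : C -> C) z : holo f z -> holo g z -> g z <> 0 -> holo (fun w => (f w / g w)%C) z.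
Proof. intros H K L; apply holo_mult; [exact H|now apply holo_inv]. Qed.

Ltac holo_tac :=
  cbv beta;
  lazymatch goal with
  | |- holo (fun w => w) _ => apply holo_id
  | |- holo (fun _ => ?c) _ => apply (holo_const c)
  | |- holo (fun w => Cplus (@?f w) (@?g w)) _ => apply (holo_plus f g); holo_tac
  | |- holo (fun w => Cminus (@?f w) (@?g w)) _ => apply (holo_minus f g); holo_tac
  | |- holo (fun w => Copp (@?f w)) _ => apply (holo_opp f); holo_tac
  | |- holo (fun w => Cmult (@?f w) (@?g w)) _ => apply (holo_mult f g); holo_tac
  | |- holo (fun w => Cdiv (@?f w) (@?g w)) _ => apply (holo_div f g); holo_tac
  | |- holo (fun w => Cinv (@?f w)) _ => apply (holo_inv f); holo_tac
  | |- holo (fun w => Cpow (@?f w) ?n) _ => apply (holo_pow f n); holo_tac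
  | |- _ => try assumption
  end.

Lemma continuous_Re_along (f : C -> C) (g : R -> C) s :
  holo f (g s) -> (forall t, Cmod (g t - g s) <= Rabs (t - s)) ->
  continuous (fun t => Re (f (g t))) s.
Proof.
intros H G; apply continuity_pt_filterlim; intros e He.
destruct (holo_continuous _ _ H e He) as [r [Hr K]].
exists r; split; [exact Hr|]; intros t [_ Ht].
change (Rabs (t - s) < r) in Ht.
change (Rabs (Re (f (g t)) - Re (f (g s))) < e).
replace (Re (f (g t)) - Re (f (g s))) with (Re (f (g t) - f (g s)))
  by reflexivity.
apply Rle_lt_trans with (1 := re_le_Cmod _).
apply K; apply Rle_lt_trans with (1 := G t), Ht.
Qed.

Section Goursat.

Variable f : C -> C.

(* The four sides of the square with corner [(a, b)] and side [h], paired into one real integrand. *)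
Definition side_sum (a b h s : R) : R :=
  Re (f ((a + s)%R, b)) - Re (f ((a + s)%R, (b + h)%R))
  + (Re (Ci * f ((a + h)%R, (b + s)%R)) - Re (Ci * f (a, (b + s)%R))).

Definition square_int (a b h : R) : R := RInt (side_sum a b h) 0 h.

Variables A B H : R.
Hypothesis HH : 0 < H.
Hypothesis Hf : forall x y, A <= x <= A + H -> B <= y <= B + H -> holo f (x, y).

Definition inside a b h : Prop := A <= a /\ a + h <= A + H /\ B <= b /\ b + h <= B + H.

Lemma Cmod_horizontal a b s t : Cmod (((a + t)%R, b) - ((a + s)%R, b)) <= Rabs (t - s).
Proof.
replace (((a + t)%R, b) - ((a + s)%R, b))%C with (RtoC (t - s)).
- rewrite Cmod_R; lra.
- apply injective_projections; simpl; ring.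
Qed.

Lemma Cmod_vertical a b s t : Cmod ((a, (b + t)%R) - (a, (b + s)%R)) <= Rabs (t - s).
Proof.
replace ((a, (b + t)%R) - (a, (b + s)%R))%C with (Ci * RtoC (t - s))%C.
- rewrite Cmod_mult, Cmod_Ci, Cmod_R; lra.
- apply injective_projections; simpl; ring.
Qed.

Lemma continuous_side_sum a b h s :
  inside a b h -> 0 <= s <= h -> continuous (side_sum a b h) s.
Proof.
intros [I1 [I2 [I3 I4]]] Hs; unfold side_sum.
assert (K : forall z, holo f z -> holo (fun w => Ci * f w)%C z).
{ intros z Hz; apply holo_mult; [apply holo_const|exact Hz]. }
apply (continuous_plus (fun s => Re (f ((a + s)%R, b)) - Re (f ((a + s)%R, (b + h)%R)))).
- apply (continuous_minus (fun s => Re (f ((a + s)%R, b)))).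
  + apply (continuous_Re_along f (fun s => ((a + s)%R, b))).
    * apply Hf; lra.
    * intros t; apply Cmod_horizontal.
  + apply (continuous_Re_along f (fun s => ((a + s)%R, (b + h)%R))).
    * apply Hf; lra.
    * intros t; apply Cmod_horizontal.
- apply (continuous_minus (fun s => Re (Ci * f ((a + h)%R, (b + s)%R)))).
  + apply (continuous_Re_along (fun w => Ci * f w)%C (fun s => ((a + h)%R, (b + s)%R))).
    * apply K, Hf; lra.
    * intros t; apply Cmod_vertical.
  + apply (continuous_Re_along (fun w => Ci * f w)%C (fun s => (a, (b + s)%R))).
    * apply K, Hf; lra.
    * intros t; apply Cmod_vertical.
Qed.

Lemma ex_RInt_side_sum a b h u v :
  inside a b h -> 0 <= u -> u <= v -> v <= h -> ex_RInt (side_sum a b h) u v.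
Proof.
intros I Hu Huv Hv; apply (@ex_RInt_continuous R_CompleteNormedModule).
intros s Hs; rewrite Rmin_left, Rmax_right in Hs by lra.
apply continuous_side_sum; [exact I|lra].
Qed.

(** A side shared by two quarters is traversed in opposite directions, so the inner contributions
    cancel. *)
Lemma square_int_split a b k :
  inside a b (2 * k) -> 0 < k ->
  square_int a b (2 * k) = square_int a b k + square_int (a + k) b k
    + square_int a (b + k) k + square_int (a + k) (b + k) k.
Proof.
intros I Hk; unfold square_int.
assert (I1 : inside a b k) by (unfold inside in *; lra).
assert (I2 : inside (a + k) b k) by (unfold inside in *; lra).
assert (I3 : inside a (b + k) k) by (unfold inside in *; lra).
assert (I4 : inside (a + k) (b + k) k) by (unfold inside in *; lra).
pose proof (ex_RInt_side_sum _ _ _ 0 k I ltac:(lra) ltac:(lra) ltac:(lra)) as E0.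
pose proof (ex_RInt_side_sum _ _ _ k (2 * k) I ltac:(lra) ltac:(lra) ltac:(lra)) as E0'.
pose proof (ex_RInt_side_sum _ _ _ 0 k I1 ltac:(lra) ltac:(lra) ltac:(lra)) as E1.
pose proof (ex_RInt_side_sum _ _ _ 0 k I2 ltac:(lra) ltac:(lra) ltac:(lra)) as E2.
pose proof (ex_RInt_side_sum _ _ _ 0 k I3 ltac:(lra) ltac:(lra) ltac:(lra)) as E3.
pose proof (ex_RInt_side_sum _ _ _ 0 k I4 ltac:(lra) ltac:(lra) ltac:(lra)) as E4.
rewrite <- (RInt_Chasles (side_sum a b (2 * k)) 0 k (2 * k) E0 E0').
(* Translating the second half of the sides to [[0, k]] turns the claim into a pointwise identity of
   integrands. *)
replace (RInt (side_sum a b (2 * k)) k (2 * k))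
  with (RInt (fun s => side_sum a b (2 * k) (s + k)) 0 k).
2:{ pose proof (RInt_comp_lin (side_sum a b (2 * k)) 1 k 0 k) as L.
    replace (1 * 0 + k) with k in L by ring.
    replace (1 * k + k) with (2 * k) in L by ring.
    rewrite <- (L E0'); apply RInt_ext; intros s _.
    change (side_sum a b (2 * k) (s + k) = 1 * side_sum a b (2 * k) (1 * s + k)).
    now rewrite !Rmult_1_l. }
assert (E5 : ex_RInt (fun s => side_sum a b (2 * k) (s + k)) 0 k).
{ apply (@ex_RInt_continuous R_CompleteNormedModule).
  intros s Hs; rewrite Rmin_left, Rmax_right in Hs by lra.
  apply (continuous_comp (fun s => s + k) (side_sum a b (2 * k))).
  - apply (continuous_plus (fun s : R => s)); [apply continuous_id|apply continuous_const].
  - apply continuous_side_sum; [exact I|lra]. }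
assert (RP : forall u v, ex_RInt u 0 k -> ex_RInt v 0 k ->
  ex_RInt (fun s => u s + v s) 0 k /\
  RInt u 0 k + RInt v 0 k = RInt (fun s => u s + v s) 0 k).
{ intros u v U V; split; [exact (@ex_RInt_plus R_NormedModule u v 0 k U V)|].
  symmetry; exact (@RInt_plus R_CompleteNormedModule u v 0 k U V). }
destruct (RP _ _ E1 E2) as [E12 R12]; rewrite R12.
destruct (RP _ _ E12 E3) as [E123 R123]; rewrite R123.
destruct (RP _ _ E123 E4) as [_ R1234]; rewrite R1234.
etransitivity; [exact (proj2 (RP _ _ E0 E5))|].
apply RInt_ext; intros s _; unfold side_sum.
replace (b + k + k) with (b + 2 * k) by ring.
replace (a + k + k) with (a + 2 * k) by ring.
replace (a + k + s) with (a + (s + k)) by ring.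
replace (b + k + s) with (b + (s + k)) by ring.
match goal with |- @eq _ ?x ?y => change (@eq R x y) end; ring.
Qed.

(* For an affine function the integrand [side_sum] vanishes identically. *)
Lemma side_sum_affine_error z0 d e a b h s :
  (forall w, Cmod (w - z0) <= 2 * h -> Cmod (f w - f z0 - (w - z0) * d) <= e * Cmod (w - z0)) ->
  0 <= e -> a <= fst z0 <= a + h -> b <= snd z0 <= b + h -> 0 <= s <= h ->
  Rabs (side_sum a b h s) <= 8 * e * h.
Proof.
intros K He Ha Hb Hs.
set (E := fun w => (f w - f z0 - (w - z0) * d)%C).
assert (N : forall x y, a <= x <= a + h -> b <= y <= b + h ->
            Cmod (E (x, y)) <= 2 * e * h).
{ intros x y Hx Hy.
  assert (M : Cmod ((x, y) - z0) <= 2 * h).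
  { destruct z0 as [x0 y0]; simpl in Ha, Hb.
    replace ((x, y) - (x0, y0))%C with (RtoC (x - x0) + Ci * RtoC (y - y0))%C
      by (apply injective_projections; simpl; ring).
    apply Rle_trans with (1 := Cmod_triangle _ _).
    rewrite Cmod_mult, Cmod_Ci, !Cmod_R.
    assert (Rabs (x - x0) <= h) by (apply Rabs_le; lra).
    assert (Rabs (y - y0) <= h) by (apply Rabs_le; lra).
    lra. }
  apply Rle_trans with (1 := K _ M).
  replace (2 * e * h) with (e * (2 * h)) by ring; now apply Rmult_le_compat_l. }
replace (side_sum a b h s) with
  (Re (E ((a + s)%R, b) - E ((a + s)%R, (b + h)%R) + (Ci * E ((a + h)%R, (b + s)%R) - Ci * E (a, (b + s)%R)))).
- apply Rle_trans with (1 := re_le_Cmod _).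
  pose proof (Cmod_triangle (E ((a + s)%R, b) - E ((a + s)%R, (b + h)%R)) (Ci * E ((a + h)%R, (b + s)%R) - Ci * E (a, (b + s)%R))).
  pose proof (Cmod_minus_le (E ((a + s)%R, b)) (E ((a + s)%R, (b + h)%R))).
  pose proof (Cmod_minus_le (Ci * E ((a + h)%R, (b + s)%R)) (Ci * E (a, (b + s)%R))) as Q.
  rewrite !Cmod_mult, Cmod_Ci in Q.
  pose proof (N (a + s) b ltac:(lra) ltac:(lra)).
  pose proof (N (a + s) (b + h) ltac:(lra) ltac:(lra)).
  pose proof (N (a + h) (b + s) ltac:(lra) ltac:(lra)).
  pose proof (N a (b + s) ltac:(lra) ltac:(lra)).
  lra.
- unfold side_sum, E; destruct z0 as [x0 y0], d as [p q]; unfold Cminus, Cplus, Copp, Cmult, Re, Ci; simpl; ring.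
Qed.

Lemma square_int_local x0 y0 e :
  A <= x0 <= A + H -> B <= y0 <= B + H -> 0 < e ->
  exists r, 0 < r /\ forall a b h, inside a b h -> a <= x0 <= a + h -> b <= y0 <= b + h ->
    0 < h < r -> Rabs (square_int a b h) <= e * (h * h).
Proof.
intros Hx Hy He.
destruct (Hf _ _ Hx Hy) as [d Hd].
(* The [8] is the loss in [side_sum_affine_error]; below, [h < r / 2] because points of the square
   can be at distance [2 h] in that estimate. *)
destruct (holo_bound _ _ _ Hd (e / 8)) as [r [Hr K]]; [lra|].
exists (r / 2); split; [lra|]; intros a b h I Ha Hb Hh.
unfold square_int.
apply Rle_trans with ((h - 0) * (e * h)); [|lra].
apply (@norm_RInt_le_const R_NormedModule (side_sum a b h) 0 h); [lra| |].
- intros s Hs.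
  replace (e * h) with (8 * (e / 8) * h) by field.
  apply (side_sum_affine_error (x0, y0) d); simpl; try lra.
  intros w Hw; apply K; lra.
- apply (@RInt_correct R_CompleteNormedModule), ex_RInt_side_sum; [exact I|lra|lra|lra].
Qed.

Definition bad e (a b h : R) : Prop := inside a b h /\ e * (h * h) < Rabs (square_int a b h).

(** The threshold is proportional to the area: if no quarter exceeded [e (h / 2)^2], the four
    integrals would add up to at most [e h^2]. *)
Lemma bad_split e a b h : 0 < h -> bad e a b h ->
  exists p : R * R, bad e (fst p) (snd p) (h / 2) /\ a <= fst p <= a + h / 2
    /\ b <= snd p <= b + h / 2.
Proof.
intros Hh [I Bd].
set (k := h / 2); assert (Ek : h = 2 * k) by (unfold k; field).
rewrite Ek in I, Bd; rewrite (square_int_split _ _ _ I) in Bd by lra.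
destruct (Rlt_dec (e * (k * k)) (Rabs (square_int a b k))) as [H1|H1].
{ exists (a, b); simpl; unfold bad, inside in *; repeat split; lra. }
destruct (Rlt_dec (e * (k * k)) (Rabs (square_int (a + k) b k))) as [H2|H2].
{ exists (a + k, b); simpl; unfold bad, inside in *; repeat split; lra. }
destruct (Rlt_dec (e * (k * k)) (Rabs (square_int a (b + k) k))) as [H3|H3].
{ exists (a, b + k); simpl; unfold bad, inside in *; repeat split; lra. }
destruct (Rlt_dec (e * (k * k)) (Rabs (square_int (a + k) (b + k) k))) as [H4|H4].
{ exists (a + k, b + k); simpl; unfold bad, inside in *; repeat split; lra. }
exfalso.
pose proof (Rabs_triang (square_int a b k + square_int (a + k) b k
    + square_int a (b + k) k) (square_int (a + k) (b + k) k)).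
pose proof (Rabs_triang (square_int a b k + square_int (a + k) b k) (square_int a (b + k) k)).
pose proof (Rabs_triang (square_int a b k) (square_int (a + k) b k)).
lra.
Qed.

Definition side (n : nat) : R := H * (/ 2) ^ n.

(** The next quarter is picked by [epsilon], so the sequence is total; its properties come from
    [bad_split] once the initial square is bad. *)
Fixpoint bad_seq e (n : nat) : R * R :=
  match n with
  | O => (A, B)
  | S m => let p := bad_seq e m in
      epsilon (inhabits (0, 0)) (fun q => bad e (fst q) (snd q) (side m / 2)
        /\ fst p <= fst q <= fst p + side m / 2 /\ snd p <= snd q <= snd p + side m / 2)
  end.

Lemma side_pos n : 0 < side n.
Proof. apply Rmult_lt_0_compat; [exact HH|apply pow_lt; lra]. Qed.

Lemma side_S n : side (S n) = side n / 2.
Proof. unfold side; simpl; field. Qed.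

Lemma bad_seq_spec e : bad e A B H -> forall n,
  bad e (fst (bad_seq e n)) (snd (bad_seq e n)) (side n) /\
  fst (bad_seq e n) <= fst (bad_seq e (S n)) /\
  fst (bad_seq e (S n)) + side (S n) <= fst (bad_seq e n) + side n /\
  snd (bad_seq e n) <= snd (bad_seq e (S n)) /\
  snd (bad_seq e (S n)) + side (S n) <= snd (bad_seq e n) + side n.
Proof.
intros Hb.
assert (K : forall n, bad e (fst (bad_seq e n)) (snd (bad_seq e n)) (side n) ->
  bad e (fst (bad_seq e (S n))) (snd (bad_seq e (S n))) (side n / 2)
  /\ fst (bad_seq e n) <= fst (bad_seq e (S n)) <= fst (bad_seq e n) + side n / 2
  /\ snd (bad_seq e n) <= snd (bad_seq e (S n)) <= snd (bad_seq e n) + side n / 2).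
{ intros n Hn; simpl.
  apply (epsilon_spec (inhabits (0, 0)) (fun q => bad e (fst q) (snd q) (side n / 2)
        /\ fst (bad_seq e n) <= fst q <= fst (bad_seq e n) + side n / 2
        /\ snd (bad_seq e n) <= snd q <= snd (bad_seq e n) + side n / 2)).
  apply bad_split; [apply side_pos|exact Hn]. }
assert (L : forall n, bad e (fst (bad_seq e n)) (snd (bad_seq e n)) (side n)).
{ induction n as [|n IH].
  - unfold side; simpl; now rewrite Rmult_1_r.
  - rewrite side_S; apply K, IH. }
intros n; split; [apply L|].
rewrite side_S; destruct (K n (L n)) as [_ [K1 K2]]; lra.
Qed.

(** The supremum of the left endpoints works, since each right endpoint is an upper bound of all of
    them. *)
Lemma nested_point (u h : nat -> R) :
  (forall n, 0 < h n) -> (forall n, u n <= u (S n)) ->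
  (forall n, u (S n) + h (S n) <= u n + h n) ->
  exists x, forall n, u n <= x <= u n + h n.
Proof.
intros Hh Hu Hv.
assert (U : forall n k, u n <= u (n + k)%nat).
{ intros n k; induction k as [|k IH]; [rewrite Nat.add_0_r; lra|].
  rewrite Nat.add_succ_r; pose proof (Hu (n + k)%nat); lra. }
assert (V : forall n k, u (n + k)%nat + h (n + k)%nat <= u n + h n).
{ intros n k; induction k as [|k IH]; [rewrite Nat.add_0_r; lra|].
  rewrite Nat.add_succ_r; pose proof (Hv (n + k)%nat); lra. }
assert (W : forall n m, u m <= u n + h n).
{ intros n m; destruct (Nat.le_ge_cases n m) as [L|L].
  - replace m with (n + (m - n))%nat by lia.
    pose proof (V n (m - n)%nat); pose proof (Hh (n + (m - n))%nat); lra.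
  - replace n with (m + (n - m))%nat by lia.
    pose proof (U m (n - m)%nat); pose proof (Hh (m + (n - m))%nat); lra. }
destruct (completeness (fun x => exists n, x = u n)) as [x [X1 X2]].
- exists (u O + h O); intros y [n ->]; apply W.
- exists (u O); now exists O.
- exists x; intros n; split.
  + apply X1; now exists n.
  + apply X2; intros y [m ->]; apply W.
Qed.

Lemma goursat_square : square_int A B H = 0.
Proof.
assert (K : forall e, 0 < e -> Rabs (square_int A B H) <= e * (H * H)).
{ intros e He; apply Rnot_lt_le; intros C.
  assert (Hb : bad e A B H) by (split; [unfold inside; lra|exact C]).
  pose proof (bad_seq_spec e Hb) as S.
  destruct (nested_point (fun n => fst (bad_seq e n)) side side_pos) as [x Hx];
    [intros n; apply (S n)|intros n; apply (S n)|].
  destruct (nested_point (fun n => snd (bad_seq e n)) side side_pos) as [y Hy];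
    [intros n; apply (S n)|intros n; apply (S n)|].
  simpl in Hx, Hy.
  assert (X0 : A <= x <= A + H)
    by (specialize (Hx O); unfold side in Hx; simpl in Hx; lra).
  assert (Y0 : B <= y <= B + H)
    by (specialize (Hy O); unfold side in Hy; simpl in Hy; lra).
  (* Differentiability at the common point bounds the integral over every small square around it by
     [e] times the area, which contradicts badness. *)
  destruct (square_int_local x y e X0 Y0 He) as [r [Hr L]].
  destruct (pow_lt_1_zero (/ 2) ltac:(rewrite Rabs_pos_eq; lra) (r / H)) as [n Hn];
    [now apply Rdiv_lt_0_compat|].
  specialize (Hn n (Nat.le_refl n)).
  assert (P2 : 0 < (/ 2) ^ n) by (apply pow_lt; lra).
  rewrite Rabs_pos_eq in Hn by lra.
  assert (Sn : side n < r).
  { unfold side; apply Rmult_lt_compat_l with (r := H) in Hn; [|exact HH].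
    replace (H * (r / H)) with r in Hn by (field; lra); exact Hn. }
  destruct (proj1 (S n)) as [In Bn].
  pose proof (side_pos n).
  pose proof (L _ _ _ In (Hx n) (Hy n) (conj (side_pos n) Sn)); lra. }
assert (Q : 0 < H * H) by now apply Rmult_lt_0_compat.
apply Rabs_eq_0, Rle_antisym; [|apply Rabs_pos].
apply Rnot_lt_le; intros L.
specialize (K (Rabs (square_int A B H) / (2 * (H * H)))).
replace (Rabs (square_int A B H) / (2 * (H * H)) * (H * H))
  with (Rabs (square_int A B H) / 2) in K by (field; lra).
assert (0 < Rabs (square_int A B H) / (2 * (H * H))) by (apply Rdiv_lt_0_compat; lra).
specialize (K ltac:(assumption)); lra.
Qed.

End Goursat.

(** * Means over circles *)

Lemma is_derive_bound (f : R -> R) x l : is_derive f x l ->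
  forall e, 0 < e -> exists d, 0 < d /\ forall y, Rabs (y - x) < d ->
    Rabs (f y - f x - l * (y - x)) <= e * Rabs (y - x).
Proof.
intros H e He; apply is_derive_Reals in H.
destruct (H e He) as [d Hd]; exists d; split; [apply cond_pos|]; intros y Hy.
destruct (Req_dec (y - x) 0) as [E|E].
- replace y with x by lra.
  replace (f x - f x - l * (x - x)) with 0 by ring.
  rewrite Rabs_R0; apply Rmult_le_pos; [lra|apply Rabs_pos].
- specialize (Hd (y - x) E Hy).
  replace (x + (y - x)) with y in Hd by ring.
  replace (f y - f x - l * (y - x)) with (((f y - f x) / (y - x) - l) * (y - x))
    by (field; exact E).
  rewrite Rabs_mult; apply Rmult_le_compat_r; [apply Rabs_pos|lra].
Qed.

(** * Polar coordinates and the complex exponential *)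

Definition polar (r t : R) : C := (r * cos t, r * sin t).

Definition cexp (z : C) : C := polar (exp (Re z)) (Im z).

Lemma polar_mult r s t u : (polar r t * polar s u)%C = polar (r * s) (t + u).
Proof.
unfold polar; apply injective_projections; simpl; rewrite ?cos_plus, ?sin_plus; ring.
Qed.

Lemma Cmod_polar r t : 0 <= r -> Cmod (polar r t) = r.
Proof.
intros Hr; unfold polar, Cmod; simpl.
replace (r * cos t * (r * cos t * 1) + r * sin t * (r * sin t * 1))
  with (Rsqr r * (Rsqr (sin t) + Rsqr (cos t))) by (unfold Rsqr; ring).
rewrite sin2_cos2, Rmult_1_r; now apply sqrt_Rsqr.
Qed.

Lemma cexp_plus z w : cexp (z + w) = (cexp z * cexp w)%C.
Proof.
unfold cexp; rewrite polar_mult; destruct z, w; simpl; now rewrite exp_plus.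
Qed.

Lemma Cmod_cexp z : Cmod (cexp z) = exp (Re z).
Proof. apply Cmod_polar, Rlt_le, exp_pos. Qed.

Lemma im_le_Cmod z : Rabs (Im z) <= Cmod z.
Proof. apply Rle_trans with (2 := Rmax_Cmod z), Rmax_r. Qed.

Lemma Cmod_le_Re_Im z : Cmod z <= Rabs (Re z) + Rabs (Im z).
Proof.
replace z with (RtoC (Re z) + Ci * RtoC (Im z))%C at 1
  by (destruct z; apply injective_projections; simpl; ring).
apply Rle_trans with (1 := Cmod_triangle _ _).
rewrite Cmod_mult, Cmod_Ci, !Cmod_R; lra.
Qed.

Lemma cexp_near_0 e : 0 < e -> exists r, 0 < r /\ forall h, Cmod h < r ->
  Cmod (cexp h - 1 - h) <= e * Cmod h.
Proof.
intros He.
assert (De : is_derive exp 0 1) by (auto_derive; [easy|rewrite exp_0; ring]).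
assert (Dc : is_derive cos 0 0) by (auto_derive; [easy|rewrite sin_0; ring]).
assert (Ds : is_derive sin 0 1) by (auto_derive; [easy|rewrite cos_0; ring]).
destruct (is_derive_bound _ _ _ De (e / 8)) as [d1 [P1 H1]]; [lra|].
destruct (is_derive_bound _ _ _ Dc (e / 8)) as [d2 [P2 H2]]; [lra|].
destruct (is_derive_bound _ _ _ Ds (e / 8)) as [d3 [P3 H3]]; [lra|].
exists (Rmin (Rmin d1 d2) (Rmin d3 (Rmin 1 (e / 8)))); split.
{ repeat apply Rmin_pos; lra. }
intros [x y] Hh.
pose proof (re_le_Cmod (x, y)) as Hx; pose proof (im_le_Cmod (x, y)) as Hy.
simpl in Hx, Hy.
pose proof (Rmin_l (Rmin d1 d2) (Rmin d3 (Rmin 1 (e / 8)))).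
pose proof (Rmin_r (Rmin d1 d2) (Rmin d3 (Rmin 1 (e / 8)))).
pose proof (Rmin_l d1 d2); pose proof (Rmin_r d1 d2).
pose proof (Rmin_l d3 (Rmin 1 (e / 8))); pose proof (Rmin_r d3 (Rmin 1 (e / 8))).
pose proof (Rmin_l 1 (e / 8)); pose proof (Rmin_r 1 (e / 8)).
specialize (H1 x); specialize (H2 y); specialize (H3 y).
rewrite exp_0, Rminus_0_r in H1; rewrite cos_0, Rminus_0_r in H2.
rewrite sin_0, !Rminus_0_r in H3.
specialize (H1 ltac:(lra)); specialize (H2 ltac:(lra)); specialize (H3 ltac:(lra)).
(* With [h = x + i y] the error is [(e^x - 1 - x) e^{iy} + (1 + x) (e^{iy} - 1 - i y) + i x y]. The
   real derivatives at [0] control the first two terms and the last is of second order. *)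
replace (cexp (x, y) - 1 - (x, y))%C with
  (RtoC (exp x - 1 - 1 * x) * polar 1 y
   + RtoC (1 + x) * (cos y - 1 - 0 * y, sin y - 1 * y)%R + Ci * RtoC (x * y))%C
  by (unfold cexp, polar; apply injective_projections; simpl; ring).
eapply Rle_trans; [apply Cmod_triangle|].
eapply Rle_trans; [apply Rplus_le_compat_r, Cmod_triangle|].
rewrite !Cmod_mult, Cmod_Ci, !Cmod_R, Cmod_polar, Rabs_mult by lra.
pose proof (Cmod_le_Re_Im (cos y - 1 - 0 * y, sin y - 1 * y)%R) as Q; simpl in Q.
pose proof (Rabs_triang 1 x) as T; rewrite Rabs_R1 in T.
pose proof (Cmod_ge_0 (x, y)); pose proof (Rabs_pos x); pose proof (Rabs_pos y).
set (m := Cmod (x, y)) in *.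
assert (Rabs (1 + x) * Cmod (cos y - 1 - 0 * y, sin y - 1 * y)%R <= 2 * (2 * (e / 8 * m))).
{ apply Rmult_le_compat; try apply Rabs_pos; try apply Cmod_ge_0; try lra.
  assert (e / 8 * Rabs y <= e / 8 * m) by (apply Rmult_le_compat_l; lra).
  lra. }
assert (e / 8 * Rabs x <= e / 8 * m) by (apply Rmult_le_compat_l; lra).
assert (Rabs x * Rabs y <= e / 8 * m) by (apply Rmult_le_compat; lra).
assert (0 <= e * m) by (apply Rmult_le_pos; lra).
lra.
Qed.

Lemma vder_cexp z : @vder C_NormedModule cexp z (cexp z).
Proof.
apply holo_intro; intros e He.
assert (P : 0 < Cmod (cexp z)) by (rewrite Cmod_cexp; apply exp_pos).
destruct (cexp_near_0 (e / Cmod (cexp z))) as [r [Hr K]]; [now apply Rdiv_lt_0_compat|].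
exists r; split; [exact Hr|]; intros w Hw.
replace (cexp w) with (cexp z * cexp (w - z))%C
  by (rewrite <- cexp_plus; f_equal; ring).
replace (cexp z * cexp (w - z) - cexp z - (w - z) * cexp z)%C
  with (cexp z * (cexp (w - z) - 1 - (w - z)))%C by ring.
rewrite Cmod_mult; specialize (K _ Hw).
apply Rmult_le_compat_l with (r := Cmod (cexp z)) in K; [|lra].
replace (Cmod (cexp z) * (e / Cmod (cexp z) * Cmod (w - z)))
  with (e * Cmod (w - z)) in K by (field; lra); exact K.
Qed.

Definition lim0 (f : C -> C) (b : C) : Prop :=
  forall e, 0 < e -> exists r, 0 < r /\ forall z, 0 < Cmod z < r -> Cmod (f z - b) < e.

Section CircleMean.

Variables (g : C -> C) (b : C) (rho : R).
Hypothesis Hrho : 0 < rho.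
Hypothesis Hg : forall z, 0 < Cmod z < rho -> holo g z.
Hypothesis Hb : lim0 g b.

(** The integral over the circle of radius [e^u], in logarithmic coordinates, where a circle becomes
    a vertical segment of length [2 PI]. *)
Let ci (u : R) : R := RInt (fun t => Re (g (cexp (u, t)))) 0 (2 * PI).

Lemma holo_g_cexp u t : u < ln rho -> holo (fun w => g (cexp w)) (u, t).
Proof.
intros Hu; apply (holo_comp cexp g); [eexists; apply vder_cexp|].
apply Hg; rewrite Cmod_cexp; simpl; split; [apply exp_pos|].
rewrite <- (exp_ln rho) by exact Hrho; now apply exp_increasing.
Qed.

Lemma ex_RInt_g_cexp u : u < ln rho -> ex_RInt (fun t => Re (g (cexp (u, t)))) 0 (2 * PI).
Proof.
intros Hu; apply (@ex_RInt_continuous R_CompleteNormedModule); intros t _.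
apply (continuous_Re_along (fun w => g (cexp w)) (fun t => (u, t))).
- now apply holo_g_cexp.
- intros s; pose proof (Cmod_vertical u 0 t s); now rewrite !Rplus_0_l in H.
Qed.

(** Goursat's theorem for [- i g(cexp w)] on a square of side [2 PI]: periodicity of [cexp] cancels
    the horizontal sides, and the vertical sides are the two circles. A square as high as the period
    is also as wide, hence the shift by [2 PI]. *)
Lemma ci_shift u : u < ln rho -> ci (u - 2 * PI) = ci u.
Proof.
intros Hu; pose proof PI_RGT_0 as P.
assert (G : square_int (fun w => - Ci * g (cexp w))%C (u - 2 * PI) 0 (2 * PI) = 0).
{ apply goursat_square; [lra|]; intros x y Hx _.
  apply holo_mult; [apply holo_const|apply holo_g_cexp; lra]. }
unfold square_int in G.
pose proof (ex_RInt_g_cexp u Hu) as E1.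
pose proof (ex_RInt_g_cexp (u - 2 * PI) ltac:(lra)) as E2.
apply Rminus_diag_uniq_sym; rewrite <- G.
etransitivity; [symmetry; exact (@RInt_minus R_CompleteNormedModule _ _ _ _ E1 E2)|].
apply RInt_ext; intros t _.
unfold side_sum.
replace (u - 2 * PI + 2 * PI) with u by ring; rewrite !Rplus_0_l.
replace (cexp ((u - 2 * PI + t)%R, 2 * PI)) with (cexp ((u - 2 * PI + t)%R, 0)).
2:{ unfold cexp, polar; simpl; now rewrite cos_2PI, sin_2PI, cos_0, sin_0. }
assert (Q : forall w, (Ci * (- Ci * w))%C = w)
  by (intros w; apply injective_projections; simpl; ring).
rewrite !Q.
match goal with |- @eq _ ?x ?y => change (@eq R x y) end.
match goal with |- ?x = _ => change x with (Re (g (cexp (u, t))) - Re (g (cexp (u - 2 * PI, t)))) end.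
ring.
Qed.

(** Iterating the shift moves the circle as close to the origin as desired, where [g] is uniformly
    close to [b]. *)
Lemma ci_value u : u < ln rho -> ci u = 2 * PI * Re b.
Proof.
intros Hu; pose proof PI_RGT_0 as P.
assert (K : forall e, 0 < e -> Rabs (ci u - 2 * PI * Re b) <= e).
{ intros e He.
  destruct (Hb (e / (2 * PI))) as [r [Hr L]]; [apply Rdiv_lt_0_compat; lra|].
  assert (It : forall n, ci (u - INR n * (2 * PI)) = ci u).
  { induction n as [|n IH]; [f_equal; simpl; ring|].
    rewrite S_INR, <- IH, <- (ci_shift (u - INR n * (2 * PI))).
    - f_equal; ring.
    - pose proof (pos_INR n); nra. }
  destruct (nfloor_ex (Rabs (u - ln r) / (2 * PI))) as [n [_ Hn]].
  { apply Rdiv_le_0_compat; [apply Rabs_pos|lra]. }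
  assert (Hv : u - INR (S n) * (2 * PI) < ln r).
  { rewrite S_INR; apply Rmult_lt_compat_r with (r := 2 * PI) in Hn; [|lra].
    replace (Rabs (u - ln r) / (2 * PI) * (2 * PI)) with (Rabs (u - ln r)) in Hn
      by (field; lra).
    pose proof (Rle_abs (u - ln r)); lra. }
  rewrite <- (It (S n)).
  set (v := u - INR (S n) * (2 * PI)) in *.
  assert (Hv' : v < ln rho).
  { unfold v; pose proof (pos_INR (S n)).
    assert (0 <= INR (S n) * (2 * PI)) by (apply Rmult_le_pos; lra); lra. }
  pose proof (ex_RInt_g_cexp v Hv') as E.
  pose proof (@ex_RInt_const R_NormedModule 0 (2 * PI) (Re b)) as Ec.
  assert (Eq : ci v - 2 * PI * Re b
     = RInt (fun t => Re (g (cexp (v, t))) - Re b) 0 (2 * PI)).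
  { etransitivity; [|exact (eq_sym (@RInt_minus R_CompleteNormedModule _ _ _ _ E Ec))].
    rewrite RInt_const; unfold ci.
    match goal with |- _ = ?x => change x with
      (RInt (fun t => Re (g (cexp (v, t)))) 0 (2 * PI) - (2 * PI - 0) * Re b) end.
    ring. }
  rewrite Eq.
  apply Rle_trans with ((2 * PI - 0) * (e / (2 * PI))); [|right; field; lra].
  apply (@norm_RInt_le_const R_NormedModule (fun t => Re (g (cexp (v, t))) - Re b) 0 (2 * PI));
    [lra| |].
  - intros t _.
    change (Rabs (Re (g (cexp (v, t)) - b)) <= e / (2 * PI)).
    apply Rle_trans with (1 := re_le_Cmod _), Rlt_le, L.
    rewrite Cmod_cexp; simpl; split; [apply exp_pos|].
    rewrite <- (exp_ln r) by exact Hr; now apply exp_increasing.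
  - apply (@RInt_correct R_CompleteNormedModule).
    exact (@ex_RInt_minus R_NormedModule _ _ _ _ E Ec). }
apply Rminus_diag_uniq.
apply Rabs_eq_0, Rle_antisym; [|apply Rabs_pos].
apply Rnot_lt_le; intros L; specialize (K (Rabs (ci u - 2 * PI * Re b) / 2)); lra.
Qed.

(** The value at the origin enters only as a limit, so the mean value property applies directly to
    quotients by powers of [z]. *)
Lemma circle_mean r : 0 < r < rho ->
  ex_RInt (fun t => Re (g (polar r t))) 0 (2 * PI) /\
  RInt (fun t => Re (g (polar r t))) 0 (2 * PI) = 2 * PI * Re b.
Proof.
intros Hr.
assert (L : ln r < ln rho) by (apply ln_increasing; lra).
pose proof (ex_RInt_g_cexp _ L) as E; pose proof (ci_value _ L) as V.
unfold ci, cexp in *; simpl in E, V; rewrite exp_ln in E, V by lra.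
now split.
Qed.

End CircleMean.

Lemma unit_rotation (c : C) : exists k : C, Cmod k = 1 /\ (k * c)%C = RtoC (Cmod c).
Proof.
destruct (Ceq_dec c 0) as [-> | H].
- exists (RtoC 1); split; [apply Cmod_1|rewrite Cmod_0; ring].
- pose proof (proj1 (Cmod_gt_0 _) H) as P.
  assert (Pc : RtoC (Cmod c) <> 0) by (intros E; injection E; lra).
  exists (Cconj c / RtoC (Cmod c))%C; split.
  + rewrite Cmod_div, Cmod_conj, Cmod_R, Rabs_pos_eq by (exact Pc || lra); field; lra.
  + replace (Cconj c / Cmod c * c)%C with ((c * Cconj c) / Cmod c)%C by (field; exact Pc).
    rewrite <- Cmod2_conj, RtoC_pow; simpl; field; exact Pc.
Qed.

(* Mean value of [k (f z - f 0) / z], whose limit at the origin is [k f'(0)]. *)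
Lemma cauchy_estimate (f : C -> C) (d : C) rho M :
  0 < rho -> (forall z, Cmod z < rho -> holo f z) -> @vder C_NormedModule f 0 d ->
  (forall z, Cmod z < rho -> Cmod (f z) <= M) -> Cmod d <= 4 * M / rho.
Proof.
intros Hr Hf Hd HM; pose proof PI_RGT_0 as P.
destruct (unit_rotation d) as [k [K1 K2]].
set (g := fun z => (k * ((f z - f 0) / z))%C).
assert (Hz : forall z, 0 < Cmod z -> z <> 0) by (intros z; apply Cmod_gt_0).
destruct (circle_mean g (RtoC (Cmod d)) rho Hr) with (r := rho / 2) as [E V]; [| |lra|].
- intros z [Z1 Z2]; unfold g; apply holo_mult; [apply holo_const|].
  apply holo_div; [|apply holo_id|now apply Hz].
  apply holo_minus; [now apply Hf|apply holo_const].
- intros e He.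
  destruct (holo_bound _ _ _ Hd (e / 2)) as [r [Hr' L]]; [lra|].
  exists r; split; [exact Hr'|]; intros z [Z1 Z2].
  assert (Hz0 := Hz z Z1).
  unfold g; rewrite <- K2.
  replace (k * ((f z - f 0) / z) - k * d)%C with (k * ((f z - f 0 - (z - 0) * d) / z))%C
    by (field; exact Hz0).
  rewrite Cmod_mult, K1, Cmod_div, Rmult_1_l by exact Hz0.
  specialize (L z); replace (z - 0)%C with z in * by ring; specialize (L Z2).
  apply Rle_lt_trans with (e / 2); [|lra].
  apply Rmult_le_reg_r with (1 := Z1); unfold Rdiv at 1.
  rewrite Rmult_assoc, Rinv_l by lra; lra.
- change (Re (RtoC (Cmod d))) with (Cmod d) in V.
  assert (B : Rabs (RInt (fun t => Re (g (polar (rho / 2) t))) 0 (2 * PI))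
    <= (2 * PI - 0) * (4 * M / rho)).
  { apply (@norm_RInt_le_const R_NormedModule (fun t => Re (g (polar (rho / 2) t))));
      [lra| |now apply (@RInt_correct R_CompleteNormedModule)].
    intros t _; apply Rle_trans with (1 := re_le_Cmod _).
    assert (N : Cmod (polar (rho / 2) t) = rho / 2) by (apply Cmod_polar; lra).
    unfold g; rewrite Cmod_mult, K1, Rmult_1_l, Cmod_div, N by (apply Hz; lra).
    pose proof (Cmod_minus_le (f (polar (rho / 2) t)) (f 0)).
    pose proof (HM (polar (rho / 2) t) ltac:(lra)).
    pose proof (HM 0 ltac:(rewrite Cmod_0; lra)).
    (* The numerator is at most [2 M] on the circle of radius [rho / 2]; this is the origin of the
       constant [4]. *)
    replace (4 * M / rho) with (2 * M / (rho / 2)) by (field; lra).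
    apply Rmult_le_compat_r; [|lra].
    apply Rlt_le, Rinv_0_lt_compat; lra. }
  rewrite V, Rabs_pos_eq in B by (apply Rmult_le_pos; [lra|apply Cmod_ge_0]).
  apply Rmult_le_reg_l with (2 * PI); lra.
Qed.

(** * Coefficients of functions with nonnegative real part *)

Lemma lim0_const c : lim0 (fun _ => c) c.
Proof.
intros e He; exists 1; split; [lra|]; intros z _.
replace (c - c)%C with (RtoC 0) by ring; now rewrite Cmod_0.
Qed.

Lemma lim0_plus f g a b : lim0 f a -> lim0 g b -> lim0 (fun z => f z + g z)%C (a + b)%C.
Proof.
intros H K e He.
destruct (H (e / 2)) as [d1 [P1 H1]]; [lra|]; destruct (K (e / 2)) as [d2 [P2 H2]]; [lra|].
exists (Rmin d1 d2); split; [now apply Rmin_pos|]; intros z [Z1 Z2].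
pose proof (Rmin_l d1 d2); pose proof (Rmin_r d1 d2).
specialize (H1 z ltac:(lra)); specialize (H2 z ltac:(lra)).
replace (f z + g z - (a + b))%C with ((f z - a) + (g z - b))%C by ring.
apply Rle_lt_trans with (1 := Cmod_triangle _ _); lra.
Qed.

Lemma lim0_mult f g a b : lim0 f a -> lim0 g b -> lim0 (fun z => f z * g z)%C (a * b)%C.
Proof.
intros H K e He.
set (A := Cmod a + 1); set (B := Cmod b + 1).
pose proof (Cmod_ge_0 a) as A0; pose proof (Cmod_ge_0 b) as B0.
destruct (H (e / (2 * B))) as [d1 [P1 H1]]; [apply Rdiv_lt_0_compat; unfold B; lra|].
destruct (K (e / (2 * A))) as [d2 [P2 H2]]; [apply Rdiv_lt_0_compat; unfold A; lra|].
destruct (H 1) as [d3 [P3 H3]]; [lra|].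
exists (Rmin d1 (Rmin d2 d3)); split; [repeat apply Rmin_pos; assumption|].
intros z [Z1 Z2].
pose proof (Rmin_l d1 (Rmin d2 d3)); pose proof (Rmin_r d1 (Rmin d2 d3)).
pose proof (Rmin_l d2 d3); pose proof (Rmin_r d2 d3).
specialize (H1 z ltac:(lra)); specialize (H2 z ltac:(lra)); specialize (H3 z ltac:(lra)).
replace (f z * g z - a * b)%C with (f z * (g z - b) + (f z - a) * b)%C by ring.
apply Rle_lt_trans with (1 := Cmod_triangle _ _); rewrite !Cmod_mult.
assert (Cmod (f z) <= A).
{ replace (f z) with (a + (f z - a))%C by ring.
  apply Rle_trans with (1 := Cmod_triangle _ _); unfold A; lra. }
assert (Cmod (f z) * Cmod (g z - b) <= A * (e / (2 * A))).
{ apply Rmult_le_compat; try apply Cmod_ge_0; lra. }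
assert (Cmod (f z - a) * Cmod b <= e / (2 * B) * Cmod b).
{ apply Rmult_le_compat_r; lra. }
assert (e / (2 * B) * Cmod b < e / (2 * B) * B).
{ apply Rmult_lt_compat_l; [apply Rdiv_lt_0_compat|]; unfold B; lra. }
replace (A * (e / (2 * A))) with (e / 2) in * by (field; unfold A; lra).
replace (e / (2 * B) * B) with (e / 2) in * by (field; unfold B; lra).
lra.
Qed.

Lemma lim0_ext (f g : C -> C) b : (forall z : C, z <> 0 -> f z = g z) -> lim0 f b -> lim0 g b.
Proof.
intros E H e He; destruct (H e He) as [r [Hr K]]; exists r; split; [exact Hr|].
intros z Hz; rewrite <- E; [now apply K|apply Cmod_gt_0; lra].
Qed.

Lemma lim0_holo f : holo f 0 -> lim0 f (f 0).
Proof.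
intros H e He; destruct (holo_continuous _ _ H e He) as [r [Hr K]].
exists r; split; [exact Hr|]; intros z Hz; apply K.
replace (z - 0)%C with z by ring; lra.
Qed.

Section Caratheodory.

Variables (p : C -> C) (c1 c2 c3 : C).
Hypothesis Hp : forall z, Cmod z < 1 -> holo p z.
Hypothesis Hre : forall z, Cmod z < 1 -> 0 <= Re (p z).
Hypothesis Hexp : lim0 (fun z => (p z - (1 + c1 * z + c2 * z ^ 2 + c3 * z ^ 3)) / z ^ 3)%C 0.

(* Integrate [Re p] against a nonnegative trigonometric polynomial on a circle of radius [r];
   the principal part at [0] is replaced by its reflection, which has the same real part there. *)
Lemma trig_functional (a0 r : R) (a1 a2 a3 : C) :
  0 < r < 1 ->
  (forall v : C, Cmod v = 1 -> 0 <= a0 + Re (a1 * v + a2 * v ^ 2 + a3 * v ^ 3)) ->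
  0 <= a0 + Re (a1 * (c1 * r) + a2 * (c2 * r ^ 2) + a3 * (c3 * r ^ 3)) / 2.
Proof.
intros Hr Hw; pose proof PI_RGT_0 as P.
assert (R0 : RtoC r <> 0) by (intros E; injection E; lra).
assert (T0 : RtoC 2 <> 0) by (intros E; injection E; lra).
(* [l1], [l2], [l3] are the coefficients of [r / z] and its powers in the principal part of [p]
   times the weight; [b] is the constant term. *)
set (l1 := ((a1 + a2 * r * c1 + a3 * r ^ 2 * c2) / 2)%C).
set (l2 := ((a2 + a3 * r * c1) / 2)%C).
set (l3 := (a3 / 2)%C).
set (g := fun z : C => (p z * (a0 + (a1 * (r / z) + a2 * (r / z) ^ 2 + a3 * (r / z) ^ 3
    + (Cconj a1 * (z / r) + Cconj a2 * (z / r) ^ 2 + Cconj a3 * (z / r) ^ 3)) / 2)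
  - (l1 * (r / z) + l2 * (r / z) ^ 2 + l3 * (r / z) ^ 3)
  + (Cconj l1 * (z / r) + Cconj l2 * (z / r) ^ 2 + Cconj l3 * (z / r) ^ 3))%C).
set (b := (a0 + (a1 * (c1 * r) + a2 * (c2 * r ^ 2) + a3 * (c3 * r ^ 3)) / 2)%C).
destruct (circle_mean g b 1 Rlt_0_1) with (r := r) as [E V]; [| |exact Hr|].
- intros z [Z1 Z2]; assert (Hz : z <> 0) by now apply Cmod_gt_0.
  assert (Pz := Hp z Z2); unfold g; holo_tac.
(* [W] is [z ^ 3] times the weight, a polynomial, so the remainder of [p] contributes nothing in the
   limit. [Q] is the contribution of the Taylor polynomial of [p] after cancellation of the poles,
   and [Q 0 = b]. *)
- set (W := fun z : C => (a0 * z ^ 3 + (a1 * r * z ^ 2 + a2 * r ^ 2 * z + a3 * r ^ 3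
    + (Cconj a1 * z ^ 4 / r + Cconj a2 * z ^ 5 / r ^ 2 + Cconj a3 * z ^ 6 / r ^ 3)) / 2)%C).
  set (Q := fun z : C => ((1 + c1 * z + c2 * z ^ 2 + c3 * z ^ 3) * a0
    + (a1 * r * (c1 + c2 * z + c3 * z ^ 2) + a2 * r ^ 2 * (c2 + c3 * z) + a3 * r ^ 3 * c3) / 2
    + (1 + c1 * z + c2 * z ^ 2 + c3 * z ^ 3)
      * (Cconj a1 * (z / r) + Cconj a2 * (z / r) ^ 2 + Cconj a3 * (z / r) ^ 3) / 2
    + (Cconj l1 * (z / r) + Cconj l2 * (z / r) ^ 2 + Cconj l3 * (z / r) ^ 3))%C).
  apply (lim0_ext (fun z => (p z - (1 + c1 * z + c2 * z ^ 2 + c3 * z ^ 3)) / z ^ 3 * W z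
    + Q z)%C).
  + intros z Hz; unfold W, Q, g, l1, l2, l3; simpl; field; repeat split; assumption.
  + replace b with (0 * W 0 + Q 0)%C
      by (unfold b, W, Q; simpl; field; repeat split; assumption).
    apply lim0_plus; [apply lim0_mult; [exact Hexp|]|]; apply lim0_holo.
    * unfold W; assert (forall n, RtoC r ^ n <> 0)%C by (intros; now apply Cpow_nz).
      holo_tac; auto.
    * unfold Q; holo_tac.
- assert (N : 0 <= RInt (fun t => Re (g (polar r t))) 0 (2 * PI)).
  { apply RInt_ge_0; [lra|exact E|]; intros t _.
    set (z := polar r t) in *; set (v := Cconj (polar 1 t)).
    assert (Nz : Cmod z = r) by (apply Cmod_polar; lra).
    assert (Hz : z <> 0) by (apply Cmod_gt_0; lra).
    assert (Nv : Cmod v = 1) by (unfold v; rewrite Cmod_conj; apply Cmod_polar; lra).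
    assert (Ev : (z / r)%C = Cconj v).
    { unfold v; rewrite Cconj_conj.
      replace z with (r * polar 1 t)%C; [field; exact R0|].
      unfold z, polar; apply injective_projections; simpl; ring. }
    assert (Vv : (v * Cconj v)%C = 1) by (rewrite <- Cmod2_conj, Nv; f_equal; ring).
    assert (Cv : Cconj v <> 0) by (apply Cmod_gt_0; rewrite Cmod_conj; lra).
    assert (Ev' : (r / z)%C = v).
    { replace z with (r * Cconj v)%C by (rewrite <- Ev; field; exact R0).
      replace v with (v * Cconj v / Cconj v)%C at 2 by (field; exact Cv).
      rewrite Vv; field; split; assumption. }
    unfold g; rewrite Ev, Ev'.
    (* On the circle [z / r] is the conjugate of [r / z]: the weight becomes [a0 + Re A], and the
       correction [- L + conj L] is purely imaginary. *)
    set (A := (a1 * v + a2 * v ^ 2 + a3 * v ^ 3)%C).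
    set (L := (l1 * v + l2 * v ^ 2 + l3 * v ^ 3)%C).
    assert (Cj : forall x y w, (Cconj x * Cconj v + Cconj y * Cconj v ^ 2 + Cconj w * Cconj v ^ 3)%C
      = Cconj (x * v + y * v ^ 2 + w * v ^ 3)).
    { intros; rewrite !Cplus_conj, !Cmult_conj, !Cpow_conj; reflexivity. }
    rewrite !Cj; fold A L.
    assert (EA : ((A + Cconj A) / 2)%C = RtoC (Re A)) by (symmetry; apply re_alt).
    rewrite EA, <- RtoC_plus.
    replace (Re _) with (Re (p z) * (a0 + Re A)).
    - apply Rmult_le_pos; [apply Hre; lra|now apply Hw].
    - destruct (p z), L; simpl; ring. }
  rewrite V in N.
  assert (Nb : 0 <= Re b) by (apply Rmult_le_reg_l with (2 * PI); lra).
  replace (a0 + _) with (Re b); [exact Nb|].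
  unfold b, Cdiv; rewrite <- RtoC_inv by lra.
  unfold Rdiv; rewrite <- re_scal_r; reflexivity.
Qed.

Lemma le_of_radial_bound (x : R) :
  0 <= x -> (forall r, 0 < r < 1 -> x * r ^ 3 <= 2) -> x <= 2.
Proof.
intros H0 H; apply Rnot_lt_le; intros C.
(* A concrete radius in place of [r -> 1]: [(1 - d)^3 >= 1 - 3 d], and this [d] gives
   [x (1 - 3 d) = (x + 2) / 2 > 2]. *)
set (d := (x - 2) / (6 * x)).
assert (D : 0 < d) by (apply Rdiv_lt_0_compat; lra).
assert (D1 : x * d = (x - 2) / 6) by (unfold d; field; lra).
assert (D2 : d < 1) by nra.
specialize (H (1 - d) ltac:(lra)).
assert (x * (1 - 3 * d) <= x * (1 - d) ^ 3) by (apply Rmult_le_compat_l; nra).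
lra.
Qed.

Lemma Re_unimodular_ge (v : C) : Cmod v = 1 -> -1 <= Re v.
Proof.
intros H; pose proof (re_le_Cmod v) as K; rewrite H in K.
pose proof (Rle_abs (- Re v)); rewrite Rabs_Ropp in *; lra.
Qed.

Lemma pow_ge_cube r n : 0 < r < 1 -> (n <= 3)%nat -> r ^ 3 <= r ^ n.
Proof.
intros Hr Hn; destruct n as [|[|[|[|n]]]]; simpl; try lia; nra.
Qed.

(** A suitable [k] rotates [d] to its modulus, which turns a bound on [|d|] into the linear
    inequalities that [trig_functional] supplies. *)
Lemma coefficient_bound (d : C) (n : nat) :
  (n <= 3)%nat ->
  (forall (r : R) (k : C), 0 < r < 1 -> Cmod k = 1 -> Re (k * d) * r ^ n <= 2) ->
  Cmod d <= 2.
Proof.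
intros Hn H; apply le_of_radial_bound; [apply Cmod_ge_0|]; intros r Hr.
destruct (unit_rotation d) as [k [K1 K2]].
specialize (H r k Hr K1); rewrite K2 in H; simpl (Re _) in H.
apply Rle_trans with (2 := H), Rmult_le_compat_l; [apply Cmod_ge_0|].
now apply pow_ge_cube.
Qed.

(** The weight [1 - Re (k v ^ n)] is nonnegative on the unit circle and isolates [c_n]; the next two
    lemmas use it with [n = 2] and [n = 3]. *)
Lemma caratheodory_c1 : Cmod c1 <= 2.
Proof.
apply (coefficient_bound c1 1); [lia|]; intros r k Hr Hk.
pose proof (trig_functional 1 r (- k)%C 0 0 Hr) as T.
replace (Re _) with (- (Re (k * c1) * r ^ 1)) in T
  by (destruct k, c1; simpl; ring).
enough (0 <= 1 + - (Re (k * c1) * r ^ 1) / 2) by lra; apply T; intros v Hv.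
replace (Re _) with (Re (- (k * v))) by (f_equal; ring).
assert (Cmod (- (k * v)) = 1) as N by (rewrite Cmod_opp, Cmod_mult, Hk, Hv; ring).
pose proof (Re_unimodular_ge _ N); lra.
Qed.

Lemma caratheodory_c2 : Cmod c2 <= 2.
Proof.
apply (coefficient_bound c2 2); [lia|]; intros r k Hr Hk.
pose proof (trig_functional 1 r 0 (- k)%C 0 Hr) as T.
replace (Re _) with (- (Re (k * c2) * r ^ 2)) in T
  by (destruct k, c2; simpl; ring).
enough (0 <= 1 + - (Re (k * c2) * r ^ 2) / 2) by lra; apply T; intros v Hv.
replace (Re _) with (Re (- (k * v ^ 2))) by (f_equal; ring).
assert (Cmod (- (k * v ^ 2)) = 1) as N
  by (rewrite Cmod_opp, Cmod_mult, Cmod_pow, Hk, Hv; ring).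
pose proof (Re_unimodular_ge _ N); lra.
Qed.

Lemma caratheodory_c3 : Cmod c3 <= 2.
Proof.
apply (coefficient_bound c3 3); [lia|]; intros r k Hr Hk.
pose proof (trig_functional 1 r 0 0 (- k)%C Hr) as T.
replace (Re _) with (- (Re (k * c3) * r ^ 3)) in T
  by (destruct k, c3; simpl; ring).
enough (0 <= 1 + - (Re (k * c3) * r ^ 3) / 2) by lra; apply T; intros v Hv.
replace (Re _) with (Re (- (k * v ^ 3))) by (f_equal; ring).
assert (Cmod (- (k * v ^ 3)) = 1) as N
  by (rewrite Cmod_opp, Cmod_mult, Cmod_pow, Hk, Hv; ring).
pose proof (Re_unimodular_ge _ N); lra.
Qed.

(** The expression is [|1 - u (v - 2 m)|^2]. With [u = k v^j] it is a trigonometric polynomial in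
    [v], of the kind that [trig_functional] accepts. *)
Lemma livingston_weight (u v m : C) :
  Cmod u = 1 -> Cmod v = 1 ->
  0 <= 2 + 4 * Cmod m ^ 2 + Re (- (4 * Cconj m * v) - 2 * (u * v) + 4 * (u * m)).
Proof.
intros Hu Hv.
assert (N : Cmod (u * (v - 2 * m)) = Cmod (v - 2 * m)) by (rewrite Cmod_mult, Hu; ring).
assert (E : Cmod (v - 2 * m) ^ 2 = 1 + 4 * Cmod m ^ 2 - Re (4 * Cconj m * v)).
{ replace 1 with (Cmod v ^ 2) by (rewrite Hv; ring).
  rewrite !Cmod2_alt; destruct v, m; simpl; ring. }
replace (Re _) with (- Re (4 * Cconj m * v) - 2 * Re (u * (v - 2 * m)))
  by (destruct u, v, m; simpl; ring).
pose proof (re_le_Cmod (u * (v - 2 * m))) as B; rewrite N in B.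
pose proof (Rle_abs (Re (u * (v - 2 * m)))).
pose proof (Rle_0_sqr (Cmod (v - 2 * m) - 1)) as S; unfold Rsqr in S.
nra.
Qed.

(** With [m = r c_1 / 2] the term [- 4 conj m v] is evaluated to [- 4 |m|^2] and cancels the
    constant [4 |m|^2]; what remains is [2 - Re (k (c_2 - c_1^2)) r^2]. Here [u = k v]; the next
    lemma takes the same [m] and [u = k v^2]. *)
Lemma livingston_c2 : Cmod (c2 - c1 * c1) <= 2.
Proof.
apply (coefficient_bound _ 2); [lia|]; intros r k Hr Hk.
set (m := (RtoC (r / 2) * c1)%C).
pose proof (trig_functional (2 + 4 * Cmod m ^ 2) r
  (4 * k * m - 4 * Cconj m)%C (- (2 * k))%C 0 Hr) as T.
replace (2 + 4 * Cmod m ^ 2 + _) with (2 - Re (k * (c2 - c1 * c1)) * r ^ 2) in T.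
- enough (0 <= 2 - Re (k * (c2 - c1 * c1)) * r ^ 2) by lra; apply T; intros v Hv.
  pose proof (livingston_weight (k * v) v m) as L.
  rewrite Cmod_mult, Hk, Hv in L; specialize (L ltac:(ring) eq_refl).
  replace (_ + _ + _)%C with (- (4 * Cconj m * v) - 2 * (k * v * v) + 4 * (k * v * m))%C
    by (simpl; ring).
  exact L.
- rewrite Cmod2_alt; unfold m; destruct k, c1, c2; simpl; field.
Qed.

Lemma livingston_c3 : Cmod (c3 - c1 * c2) <= 2.
Proof.
apply (coefficient_bound _ 3); [lia|]; intros r k Hr Hk.
set (m := (RtoC (r / 2) * c1)%C).
pose proof (trig_functional (2 + 4 * Cmod m ^ 2) r
  (- (4 * Cconj m))%C (4 * k * m)%C (- (2 * k))%C Hr) as T.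
replace (2 + 4 * Cmod m ^ 2 + _) with (2 - Re (k * (c3 - c1 * c2)) * r ^ 3) in T.
- enough (0 <= 2 - Re (k * (c3 - c1 * c2)) * r ^ 3) by lra; apply T; intros v Hv.
  pose proof (livingston_weight (k * v ^ 2) v m) as L.
  rewrite Cmod_mult, Cmod_pow, Hk, Hv in L; specialize (L ltac:(ring) eq_refl).
  replace (_ + _ + _)%C with (- (4 * Cconj m * v) - 2 * (k * v ^ 2 * v) + 4 * (k * v ^ 2 * m))%C
    by (simpl; ring).
  exact L.
- rewrite Cmod2_alt; unfold m; destruct k, c1, c2, c3; simpl; field.
Qed.

End Caratheodory.

(** * The theorem of Hahn and Banach *)

Section HahnBanach.

Variables (V : CMod) (x0 : V).

Notation rscal t v := (scal (RtoC t : C) v).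

(* Graphs of real-linear functionals dominated by the norm; the empty set is allowed,
   being the union of the empty chain. *)
Definition dominated_graph (A : V * R -> Prop) : Prop :=
  (forall y b z c, A (y, b) -> A (z, c) -> A (plus y z, b + c)) /\
  (forall t y b, A (y, b) -> A (rscal t y, t * b)) /\
  (forall y b, A (y, b) -> b <= norm y) /\
  (forall y b, A (y, b) -> A (x0, norm x0)).

Lemma norm_rscal t (v : V) : norm (rscal t v) = Rabs t * norm v.
Proof. rewrite norm_scal_C, Cmod_R; reflexivity. Qed.

Lemma maximal_graph : exists A, dominated_graph A /\
  forall B, dominated_graph B -> (forall p, A p -> B p) -> forall p, B p -> A p.
Proof.
destruct (@classical_sets.Zorn_bigcup (V * R) dominated_graph) as [A [PA MA]].
- intros F HF HT; unfold classical_sets.bigcup; split; [|split; [|split]].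
  + intros y b z c [S1 F1 H1] [S2 F2 H2].
    destruct (HT S1 S2 F1 F2) as [I|I].
    * exists S2; [exact F2|]; apply (HF S2 F2); [now apply I|exact H2].
    * exists S1; [exact F1|]; apply (HF S1 F1); [exact H1|now apply I].
  + intros t y b [S1 F1 H1]; exists S1; [exact F1|]; now apply (HF S1 F1).
  + intros y b [S1 F1 H1]; exact (proj1 (proj2 (proj2 (HF S1 F1))) y b H1).
  + intros y b [S1 F1 H1]; exists S1; [exact F1|].
    exact (proj2 (proj2 (proj2 (HF S1 F1))) y b H1).
- exists A; split; [exact PA|]; intros B PB AB.
  destruct (classic (forall p, B p -> A p)) as [C|C]; [exact C|].
  exfalso; apply (MA B); [split; assumption|exact PB].
Qed.

Lemma line_graph :
  dominated_graph (fun p => exists t, p = (rscal t x0, t * norm x0)).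
Proof.
split; [|split; [|split]].
- intros y b z c [t E] [s E']; injection E; intros -> ->; injection E'; intros -> ->.
  exists (t + s); f_equal; [|ring].
  rewrite RtoC_plus; module_ring.
- intros t y b [s E]; injection E; intros -> ->; exists (t * s); f_equal; [|ring].
  rewrite RtoC_mult; module_ring.
- intros y b [t E]; injection E; intros -> ->; rewrite norm_rscal.
  apply Rmult_le_compat_r; [apply norm_ge_0|apply Rle_abs].
- intros _ _ _; exists 1; f_equal; [|ring]; module_ring.
Qed.

(** From [b + c <= |y + z| <= |y - x| + |z + x|] each lower bound is at most each upper bound, so
    the supremum of the lower bounds is admissible. *)
Lemma extension_value (A : V * R -> Prop) (x : V) :
  dominated_graph A -> A (x0, norm x0) ->
  exists a, forall y b, A (y, b) -> b - norm (minus y x) <= a <= norm (plus y x) - b.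
Proof.
intros [S1 [_ [S3 _]]] A0.
assert (K : forall y b z c, A (y, b) -> A (z, c) ->
  b - norm (minus y x) <= norm (plus z x) - c).
{ intros y b z c H1 H2; pose proof (S3 _ _ (S1 _ _ _ _ H1 H2)) as D.
  pose proof (norm_sum_le V (plus y z) (minus y x) (plus z x) ltac:(module_ring)) as T.
  lra. }
destruct (completeness (fun r => exists y b, A (y, b) /\ r = b - norm (minus y x))) as [a [H1 H2]].
- exists (norm (plus x0 x) - norm x0); intros r [y [b [H ->]]]; now apply K.
- exists (norm x0 - norm (minus x0 x)), x0, (norm x0); easy.
- exists a; intros y b H; split.
  + apply H1; now exists y, b.
  + apply H2; intros r [z [c [H' ->]]]; now apply K.
Qed.

Lemma extension_dominated (A : V * R -> Prop) (x : V) (a : R) :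
  dominated_graph A -> A (x0, norm x0) ->
  (forall y b, A (y, b) -> b - norm (minus y x) <= a <= norm (plus y x) - b) ->
  dominated_graph (fun p => exists y b t, A (y, b) /\ p = (plus y (rscal t x), b + t * a)).
Proof.
intros [S1 [S2 [S3 S4]]] A0 Ha; split; [|split; [|split]].
- intros y b z c [y1 [b1 [t [H1 E1]]]] [y2 [b2 [s [H2 E2]]]].
  injection E1; intros -> ->; injection E2; intros -> ->.
  exists (plus y1 y2), (b1 + b2), (t + s); split; [now apply S1|].
  rewrite RtoC_plus; f_equal; [module_ring|ring].
- intros s y b [y1 [b1 [t [H1 E1]]]]; injection E1; intros -> ->.
  exists (rscal s y1), (s * b1), (s * t); split; [now apply S2|].
  rewrite RtoC_mult; f_equal; [module_ring|ring].
- intros y b [y1 [b1 [t [H1 E1]]]]; injection E1; intros -> ->; clear E1.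
  (* Dividing by [|t|] reduces the two signs to the cases [t = -1] and [t = 1], which are the two
     inequalities of [Ha]. *)
  destruct (Rtotal_order t 0) as [Ht|[->|Ht]].
  + destruct (Ha _ _ (S2 (/ - t) _ _ H1)) as [K _].
    assert (T0 : RtoC (- t) <> 0) by (intros E; injection E; lra).
    assert (E : plus y1 (rscal t x) = rscal (- t) (minus (rscal (/ - t) y1) x)).
    { rewrite RtoC_inv by lra; rewrite RtoC_opp in *; module_field; intros E; apply T0; rewrite E; ring. }
    rewrite E, norm_rscal, Rabs_pos_eq by lra.
    match type of K with _ - ?w <= _ =>
      assert (K' : b1 + t * a <= - t * w); [|exact K'];
      apply Rmult_le_compat_l with (r := - t) in K; [|lra];
      rewrite Rmult_minus_distr_l, <- Rmult_assoc, Rinv_r in K by lra; lra end.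
  + replace (plus y1 (rscal 0 x)) with y1 by module_ring.
    rewrite Rmult_0_l, Rplus_0_r; now apply S3.
  + destruct (Ha _ _ (S2 (/ t) _ _ H1)) as [_ K].
    assert (T0 : RtoC t <> 0) by (intros E; injection E; lra).
    assert (E : plus y1 (rscal t x) = rscal t (plus (rscal (/ t) y1) x)).
    { rewrite RtoC_inv by lra; module_field; exact T0. }
    rewrite E, norm_rscal, Rabs_pos_eq by lra.
    match type of K with _ <= ?w - _ =>
      assert (K' : b1 + t * a <= t * w); [|exact K'];
      apply Rmult_le_compat_l with (r := t) in K; [|lra];
      rewrite Rmult_minus_distr_l, <- (Rmult_assoc t (/ t)), Rinv_r in K by lra; lra end.
- intros _ _ _; exists x0, (norm x0), 0; split; [exact A0|].
  f_equal; [module_ring|ring].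
Qed.

Lemma real_functional : exists u : V -> R,
  (forall y z, u (plus y z) = u y + u z) /\ (forall t y, u (rscal t y) = t * u y) /\
  (forall y, u y <= norm y) /\ u x0 = norm x0.
Proof.
destruct maximal_graph as [A [PA MA]].
(* A maximal graph cannot be empty, since the line through [x0] would extend it. *)
assert (A0 : A (x0, norm x0)).
{ destruct (classic (exists p, A p)) as [[[y b] H]|N].
  - exact (proj2 (proj2 (proj2 PA)) y b H).
  - apply (MA _ line_graph).
    + intros p Hp; exfalso; apply N; now exists p.
    + exists 1; f_equal; [module_ring|ring]. }
pose proof PA as [S1 [S2 [S3 _]]].
assert (Tot : forall x, exists a, A (x, a)).
{ intros x; destruct (extension_value A x PA A0) as [a Ha].
  exists a; apply (MA _ (extension_dominated A x a PA A0 Ha)).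
  - intros [y b] H; exists y, b, 0; split; [exact H|f_equal; [module_ring|ring]].
  - exists (rscal 0 x0), (0 * norm x0), 1; split; [now apply S2|].
    f_equal; [module_ring|ring]. }
(* Two values at [x] put [(0, a - b)] in the graph, and domination gives [a - b <= 0]. *)
assert (Un : forall x a b, A (x, a) -> A (x, b) -> a = b).
{ assert (L : forall x a b, A (x, a) -> A (x, b) -> a <= b).
  { intros x a b H1 H2.
    pose proof (S3 _ _ (S1 _ _ _ _ H1 (S2 (-1) _ _ H2))) as K.
    replace (plus x (rscal (-1) x)) with (zero : V) in K by module_ring.
    replace (norm zero) with 0 in K by (symmetry; exact (@norm_zero _ V)); lra. }
  intros x a b H1 H2; apply Rle_antisym; eapply L; eassumption. }
set (u := fun x => epsilon (inhabits 0) (fun a => A (x, a))).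
assert (Hu : forall x, A (x, u x)) by (intros x; apply epsilon_spec, Tot).
exists u; split; [|split; [|split]].
- intros y z; apply (Un (plus y z)); [apply Hu|apply S1; apply Hu].
- intros t y; apply (Un (rscal t y)); [apply Hu|apply S2; apply Hu].
- intros y; apply S3, Hu.
- apply (Un x0); [apply Hu|exact A0].
Qed.

(** The complexification [u(v) - i u(i v)] of the real functional. Rotating [T v] to its modulus
    identifies that modulus with a value of [u], hence the norm bound; at [x0] the real part already
    equals the norm, which forces the imaginary part to vanish. *)
Lemma hahn_banach : exists T : lin V C_NormedModule,
  T x0 = RtoC (norm x0) /\ forall v, Cmod (T v) <= norm v.
Proof.
destruct real_functional as [u [U1 [U2 [U3 U4]]]].
set (T := fun v => (u v, - u (scal Ci v)) : C).
assert (Uc : forall (k : C) v, u (scal k v) = Re k * u v + Im k * u (scal Ci v)).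
{ intros k v; rewrite <- !U2, <- U1; f_equal.
  destruct k as [a b]; simpl; module_prepare.
  cbn [length all_below mcoef Nat.eqb]; split; [|easy].
  apply injective_projections; simpl; ring. }
assert (Ts : forall (k : C) v, T (scal k v) = (k * T v)%C).
{ intros k v; unfold T; rewrite (Uc k v).
  replace (scal Ci (scal k v)) with (scal (Ci * k)%C v) by module_ring.
  rewrite (Uc (Ci * k)%C v); destruct k; apply injective_projections; simpl; ring. }
assert (Tp : forall v w, T (plus v w) = (T v + T w)%C).
{ intros v w; unfold T; rewrite U1.
  replace (scal Ci (plus v w)) with (plus (scal Ci v) (scal Ci w)) by module_ring.
  rewrite U1; apply injective_projections; simpl; ring. }
assert (Tb : forall v, Cmod (T v) <= norm v).
{ intros v; destruct (unit_rotation (T v)) as [k [K1 K2]].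
  rewrite <- Ts in K2.
  apply (f_equal Re) in K2; unfold T at 1 in K2; simpl in K2.
  rewrite <- K2; apply Rle_trans with (1 := U3 _).
  rewrite norm_scal_C, K1; lra. }
assert (HT : @is_linear C_AbsRing V C_NormedModule T).
{ split; [exact Tp|exact Ts|]; exists 1; split; [lra|].
  intros v; rewrite Rmult_1_l; exact (Tb v). }
exists (Lin _ _ T HT); split; [|exact Tb].
pose proof (Tb x0) as B; unfold T in *; simpl.
apply injective_projections; simpl; [exact U4|].
pose proof (norm_ge_0 x0) as N0.
unfold Cmod in B; simpl in B; rewrite U4 in B.
set (w := u (scal Ci x0)) in *.
assert (Q : norm x0 * (norm x0 * 1) + - w * (- w * 1) <= norm x0 * norm x0).
{ apply Rsqr_incr_1 in B; [|apply sqrt_pos|exact N0].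
  rewrite Rsqr_sqrt in B; [exact B|nra]. }
assert (w * w <= 0) by lra.
nra.
Qed.

End HahnBanach.

(** * Cauchy estimates in normed modules *)

Definition fdiff {U V : CMod} (f : U -> V) (x : U) : Prop := exists l, fder f x l.

Lemma frechet_spec (U V : CMod) (f : U -> V) x : fdiff f x -> fder f x (frechet f x).
Proof.
intros [l H]; apply fder_filterdiff; unfold frechet.
apply (epsilon_spec (inhabits (lin_zero U V)) (fun l => filterdiff f (locally x) l)).
exists (Lin U V l (proj1 H)); now apply fder_filterdiff.
Qed.

Lemma frechet_unique (U V : CMod) (f : U -> V) (x : U) l k : fder f x l -> frechet f x k = l k.
Proof.
intros H; apply (fder_unique U V f x); [|exact H].
apply frechet_spec; now exists l.
Qed.

(** This transfers scalar function theory to maps with values in a normed module. *)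
Lemma norm_le_functional (V : CMod) (v : V) M :
  (forall T : lin V C_NormedModule, (forall w, Cmod (T w) <= norm w) -> Cmod (T v) <= M) ->
  norm v <= M.
Proof.
intros H; destruct (hahn_banach V v) as [T [E B]].
specialize (H T B); rewrite E, Cmod_R, Rabs_pos_eq in H by apply norm_ge_0; exact H.
Qed.

Lemma vder_line (U V : CMod) (f : U -> V) (x k : U) (s : C) y l :
  y = plus x (scal s k) -> fder f y l -> vder (fun s : C => f (plus x (scal s k))) s (l k).
Proof.
intros -> H; exact (vder_fder_comp U V (fun s => plus x (scal s k)) f s k l (vder_affine U x k s) H).
Qed.

(** The line [s -> x + s k] stays in the ball for [|s| < rho / |k|], and the scalar Cauchy estimate
    on that disc yields the factor [|k|]. *)
Lemma fder_ball_estimate (U V : CMod) (f : U -> V) (x : U) l rho M :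
  0 < rho -> (forall y : U, norm (minus y x) < rho -> fdiff f y) -> fder f x l ->
  (forall y : U, norm (minus y x) < rho -> norm (f y) <= M) ->
  forall k, norm (l k) <= 4 * M / rho * norm k.
Proof.
intros Hr Hf Hl HM k.
destruct (Rle_lt_or_eq_dec _ _ (norm_ge_0 k)) as [Pk|Ek].
2:{ rewrite <- Ek, Rmult_0_r.
    rewrite (norm_eq_zero k (eq_sym Ek)), (linear_zero _ (proj1 Hl)).
    right; exact (@norm_zero _ V). }
apply norm_le_functional; intros T HT.
assert (Near : forall s : C, Cmod s < rho / norm k -> norm (minus (plus x (scal s k)) x) < rho).
{ intros s Hs; replace (minus (plus x (scal s k)) x) with (scal s k) by module_ring.
  rewrite norm_scal_C; apply Rmult_lt_compat_r with (r := norm k) in Hs; [|exact Pk].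
  replace (rho / norm k * norm k) with rho in Hs by (field; lra); exact Hs. }
replace (4 * M / rho * norm k) with (4 * M / (rho / norm k)) by (field; lra).
apply (cauchy_estimate (fun s => T (f (plus x (scal s k))))).
- now apply Rdiv_lt_0_compat.
- intros s Hs; destruct (Hf _ (Near s Hs)) as [m Hm].
  exists (T (m k)).
  apply (vder_linear V C_NormedModule (fun s => f (plus x (scal s k))) T); [apply lin_linear|].
  eapply vder_line; [reflexivity|exact Hm].
- apply (vder_linear V C_NormedModule (fun s => f (plus x (scal s k))) T); [apply lin_linear|].
  eapply vder_line; [|exact Hl]; module_ring.
- intros s Hs; apply Rle_trans with (1 := HT _), HM, Near, Hs.
Qed.

Lemma vder_real (f : C -> C) (t : R) (d : C) :
  @vder C_NormedModule f (RtoC t) d -> is_derive (fun t : R => Re (f (RtoC t))) t (Re d).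
Proof.
intros H; apply is_derive_Reals; intros e He.
destruct (holo_bound _ _ _ H (e / 2)) as [r [Hr K]]; [lra|].
exists (mkposreal r Hr); intros h Hh Hh'; simpl in Hh'.
specialize (K (RtoC (t + h))).
replace (RtoC (t + h) - RtoC t)%C with (RtoC h) in K
  by (rewrite RtoC_plus; ring).
rewrite Cmod_R in K; specialize (K Hh').
replace ((Re (f (t + h)%R) - Re (f t)) / h - Re d)
  with (Re (f (t + h)%R - f t - h * d)%C / h).
2:{ destruct (f (t + h)%R), (f t), d; simpl; field; exact Hh. }
unfold Rdiv; rewrite Rabs_mult, Rabs_inv.
pose proof (re_le_Cmod (f (t + h)%R - f t - h * d)%C) as Q.
assert (P : 0 < Rabs h) by now apply Rabs_pos_lt.
apply Rmult_lt_reg_r with (1 := P).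
rewrite Rmult_assoc, Rinv_l by lra.
assert (e / 2 * Rabs h < e * Rabs h) by (apply Rmult_lt_compat_r; lra).
lra.
Qed.

(** After composition with a functional and a rotation that makes the increment real and
    nonnegative, the real mean value theorem applies to the real part. *)
Lemma mean_value_inequality (U V : CMod) (f : U -> V) (x k : U) K :
  (forall t, 0 <= t <= 1 -> fdiff f (plus x (scal (RtoC t : C) k)) /\
     norm (frechet f (plus x (scal (RtoC t : C) k)) k) <= K) ->
  norm (minus (f (plus x k)) (f x)) <= K.
Proof.
intros H; apply norm_le_functional; intros T HT.
set (dlt := minus (f (plus x k)) (f x)).
destruct (unit_rotation (T dlt)) as [u [U1 U2]].
set (g := fun s : C => (u * T (f (plus x (scal s k))))%C).
set (dg := fun s : C => (u * T (frechet f (plus x (scal s k)) k))%C).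
assert (Dg : forall t, 0 <= t <= 1 -> @vder C_NormedModule g (RtoC t) (dg (RtoC t))).
{ intros t Ht; destruct (H t Ht) as [F _].
  apply (vder_scal_r C_NormedModule (fun s => T (f (plus x (scal s k)))) (RtoC t) _ u).
  apply (vder_linear V C_NormedModule (fun s => f (plus x (scal s k))) T); [apply lin_linear|].
  eapply vder_line; [reflexivity|apply frechet_spec, F]. }
assert (Dr : forall t, 0 <= t <= 1 -> is_derive (fun t : R => Re (g (RtoC t))) t (Re (dg (RtoC t)))).
{ intros t Ht; apply vder_real, Dg, Ht. }
destruct (MVT_gen (fun t => Re (g (RtoC t))) 0 1 (fun t => Re (dg (RtoC t)))) as [c [Hc E]].
- intros t Ht; rewrite Rmin_left, Rmax_right in Ht by lra; apply Dr; lra.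
- intros t Ht; rewrite Rmin_left, Rmax_right in Ht by lra.
  apply derivable_continuous_pt; eexists; apply is_derive_Reals, Dr; exact Ht.
- rewrite Rmin_left, Rmax_right in Hc by lra.
  assert (E' : Cmod (T dlt) = Re (dg (RtoC c))).
  { transitivity (Re (g (RtoC 1)) - Re (g (RtoC 0))); [|rewrite E; ring].
    change (Cmod (T dlt) = Re (g (RtoC 1) - g (RtoC 0))%C).
    replace (g (RtoC 1) - g (RtoC 0))%C with (u * T dlt)%C; [now rewrite U2|].
    unfold g, dlt; rewrite (is_linear_minus _ _ T) by apply lin_linear.
    replace (plus x (scal (RtoC 1 : C) k)) with (plus x k) by module_ring.
    replace (plus x (scal (RtoC 0 : C) k)) with x by module_ring.
    change (u * (T (f (plus x k)) - T (f x)) = u * T (f (plus x k)) - u * T (f x))%C.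
    ring. }
  rewrite E'; apply Rle_trans with (1 := Rle_abs _).
  apply Rle_trans with (1 := re_le_Cmod _); unfold dg.
  rewrite Cmod_mult, U1, Rmult_1_l.
  apply Rle_trans with (1 := HT _), H, Hc.
Qed.

(** * Uniform Lipschitz and quadratic Taylor estimates *)

Section LocalEstimates.

Variables (U V : CMod) (f : U -> V) (x : U) (r M : R).
Hypothesis Hr : 0 < r.
Hypothesis Hf : forall y : U, norm (minus y x) < 4 * r -> fdiff f y.
Hypothesis HM : forall y : U, norm (minus y x) < 4 * r -> norm (f y) <= M.

(** Each estimate gives up a margin [r] of the ball of radius [4 r]: derivatives are bounded within
    [3 r], increments within [2 r], increments of derivatives within [r]. *)
Lemma local_derivative_bound (y k : U) :
  norm (minus y x) < 3 * r -> norm (frechet f y k) <= 4 * M / r * norm k.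
Proof.
intros Hy.
assert (N : forall z : U, norm (minus z y) < r -> norm (minus z x) < 4 * r).
{ intros z Hz; pose proof (norm_minus_triangle U z y x); lra. }
apply (fder_ball_estimate U V f y (frechet f y) r M Hr).
- intros z Hz; apply Hf, N, Hz.
- apply frechet_spec, Hf; lra.
- intros z Hz; apply HM, N, Hz.
Qed.

Lemma norm_segment (y k : U) t : 0 <= t <= 1 ->
  norm (minus (plus y (scal (RtoC t : C) k)) x) <= norm (minus y x) + norm k.
Proof.
intros Ht.
pose proof (norm_sum_le U (minus (plus y (scal (RtoC t : C) k)) x) (minus y x)
  (scal (RtoC t : C) k) ltac:(module_ring)) as T.
rewrite norm_scal_C, Cmod_R, Rabs_pos_eq in T by lra.
pose proof (norm_ge_0 k); apply Rle_trans with (1 := T).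
apply Rplus_le_compat_l; nra.
Qed.

Lemma local_lipschitz (y k : U) :
  norm (minus y x) < 2 * r -> norm k < r ->
  norm (minus (f (plus y k)) (f y)) <= 4 * M / r * norm k.
Proof.
intros Hy Hk; apply mean_value_inequality; intros t Ht.
pose proof (norm_segment y k t Ht); split; [apply Hf; lra|].
apply local_derivative_bound; lra.
Qed.

Lemma fder_shift (k y : U) :
  fdiff f (plus y k) -> fder (fun z => f (plus z k)) y (frechet f (plus y k)).
Proof.
intros H.
assert (S : fder (fun z : U => plus z k) y (fun h => h)).
{ pose proof (fder_plus U U (fun z => z) (fun _ => k) y _ _
    (fder_linear U U (fun z => z) y is_linear_id) (fder_const U U k y)) as P.
  revert P; apply fder_ext; [reflexivity|intros h; module_ring]. }
exact (fder_comp U U V _ f y _ _ S (frechet_spec _ _ _ _ H)).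
Qed.

Lemma fder_increment (k y : U) :
  fdiff f (plus y k) -> fdiff f y ->
  fder (fun z => minus (f (plus z k)) (f z)) y
    (fun h => minus (frechet f (plus y k) h) (frechet f y h)).
Proof.
intros H H'.
assert (O : fder (fun z => opp (f z)) y (fun h => opp (frechet f y h))).
{ apply (fder_comp U V V f opp y _ _ (frechet_spec _ _ _ _ H')).
  apply fder_linear, is_linear_opp. }
exact (fder_plus U V _ _ y _ _ (fder_shift k y H) O).
Qed.

Lemma norm_shift (y k : U) : norm (minus (plus y k) x) <= norm (minus y x) + norm k.
Proof. apply norm_sum_le; module_ring. Qed.

(** The Cauchy estimate applied to [z -> f(z + k) - f z], which [local_lipschitz] bounds by a
    multiple of [|k|]; the two factors [4 / r] multiply to [16 / r^2]. *)
Lemma local_derivative_lipschitz (y k v : U) :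
  norm (minus y x) < r -> norm k < r ->
  norm (minus (frechet f (plus y k) v) (frechet f y v)) <= 16 * M / (r * r) * norm k * norm v.
Proof.
intros Hy Hk.
assert (N : forall z : U, norm (minus z y) < r -> norm (minus z x) < 2 * r).
{ intros z Hz; pose proof (norm_minus_triangle U z y x); lra. }
assert (F : forall z : U, norm (minus z y) < r -> fdiff f (plus z k) /\ fdiff f z).
{ intros z Hz; specialize (N z Hz); pose proof (norm_shift z k).
  split; apply Hf; lra. }
replace (16 * M / (r * r) * norm k * norm v) with (4 * (4 * M / r * norm k) / r * norm v)
  by (field; lra).
destruct (F y) as [F1 F2]; [rewrite norm_minus_self; exact Hr|].
apply (fder_ball_estimate U V (fun z => minus (f (plus z k)) (f z)) y
  (fun h => minus (frechet f (plus y k) h) (frechet f y h)) r (4 * M / r * norm k) Hr).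
- intros z Hz; destruct (F z Hz) as [G1 G2].
  eexists; now apply fder_increment.
- now apply fder_increment.
- intros z Hz; apply local_lipschitz; [now apply N|exact Hk].
Qed.

(** Mean value inequality for [f] minus its linear part at [y], whose derivative along the segment
    is small by the preceding lemma. *)
Lemma local_quadratic (y k : U) :
  norm (minus y x) < r -> norm k < r ->
  norm (minus (minus (f (plus y k)) (f y)) (frechet f y k)) <= 16 * M / (r * r) * norm k * norm k.
Proof.
intros Hy Hk.
set (h := fun z => minus (f z) (frechet f y z)).
assert (Dh : forall z : U, fdiff f z -> fder h z (fun v => minus (frechet f z v) (frechet f y v))).
{ intros z Hz; apply (fder_plus U V f (fun z => opp (frechet f y z)) z);
    [now apply frechet_spec|].
  apply (fder_comp U V V (frechet f y) opp z (frechet f y)).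
  - apply fder_linear, lin_linear.
  - apply fder_linear, is_linear_opp. }
replace (minus (minus (f (plus y k)) (f y)) (frechet f y k))
  with (minus (h (plus y k)) (h y)).
2:{ unfold h; rewrite (linear_plus _ (lin_linear (frechet f y))); module_ring. }
apply mean_value_inequality; intros t Ht.
assert (Nt : norm (scal (RtoC t : C) k) <= norm k).
{ rewrite norm_scal_C, Cmod_R, Rabs_pos_eq by lra; pose proof (norm_ge_0 k); nra. }
assert (Ft : fdiff f (plus y (scal (RtoC t : C) k))).
{ pose proof (norm_segment y k t Ht); apply Hf; lra. }
split; [eexists; now apply Dh|].
rewrite (frechet_unique _ _ _ _ _ k (Dh _ Ft)).
apply Rle_trans with (16 * M / (r * r) * norm (scal (RtoC t : C) k) * norm k).
- apply local_derivative_lipschitz; [exact Hy|lra].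
- assert (0 <= M).
  { apply Rle_trans with (norm (f x)); [apply norm_ge_0|].
    apply HM; rewrite norm_minus_self; lra. }
  apply Rmult_le_compat_r; [apply norm_ge_0|]; apply Rmult_le_compat_l; [|exact Nt].
  apply Rdiv_le_0_compat; [lra|]; now apply Rmult_lt_0_compat.
Qed.

End LocalEstimates.

(** * Holomorphic maps are infinitely differentiable *)

Definition seq_lim {V : CMod} (u : nat -> V) (l : V) : Prop :=
  forall e, 0 < e -> exists N, forall n, (N <= n)%nat -> norm (minus (u n) l) < e.

Definition seq_cauchy {V : CMod} (u : nat -> V) : Prop :=
  forall e, 0 < e -> exists N, forall n m, (N <= n)%nat -> (N <= m)%nat ->
    norm (minus (u n) (u m)) < e.

(** A predicate on normed modules rather than a structure, so that completeness passes by induction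
    to the iterated spaces [multilin n U V]. *)
Definition seq_complete (V : CMod) : Prop :=
  forall u : nat -> V, seq_cauchy u -> exists l, seq_lim u l.

Lemma seq_lim_le (V : CMod) (u : nat -> V) (l a : V) K N :
  seq_lim u l -> (forall n, (N <= n)%nat -> norm (minus (u n) a) <= K) -> norm (minus l a) <= K.
Proof.
intros H B; apply Rnot_lt_le; intros C.
destruct (H (norm (minus l a) - K)) as [N' HN]; [lra|].
specialize (HN (max N N') (Nat.le_max_r _ _)); specialize (B (max N N') (Nat.le_max_l _ _)).
pose proof (norm_minus_triangle V l (u (max N N')) a) as T.
rewrite (norm_minus_sym V l (u (max N N'))) in T; lra.
Qed.

Lemma seq_lim_unique (V : CMod) (u : nat -> V) (l m : V) : seq_lim u l -> seq_lim u m -> l = m.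
Proof.
intros H K.
assert (E : norm (minus l m) <= 0).
{ apply le_epsilon; intros e He; rewrite Rplus_0_l.
  destruct (K e He) as [N HN].
  apply (seq_lim_le V u l m e N H); intros n Hn; now apply Rlt_le, HN. }
assert (Z : minus l m = zero) by (apply norm_eq_zero, Rle_antisym; [exact E|apply norm_ge_0]).
transitivity (plus (minus l m) m); [module_ring|rewrite Z; module_ring].
Qed.

Lemma seq_lim_linear (U V : CMod) (L : U -> V) (u : nat -> U) (l : U) :
  is_linear L -> seq_lim u l -> seq_lim (fun n => L (u n)) (L l).
Proof.
intros HL H e He; destruct (linear_bound _ _ _ HL) as [M [HM B]].
destruct (H (e / M)) as [N HN]; [now apply Rdiv_lt_0_compat|].
exists N; intros n Hn; rewrite <- (is_linear_minus U V L) by exact HL.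
apply Rle_lt_trans with (1 := B _).
specialize (HN n Hn); apply Rmult_lt_compat_l with (r := M) in HN; [|exact HM].
replace (M * (e / M)) with e in HN by (field; lra); exact HN.
Qed.

Lemma seq_lim_plus (V : CMod) (u v : nat -> V) (l m : V) :
  seq_lim u l -> seq_lim v m -> seq_lim (fun n => plus (u n) (v n)) (plus l m).
Proof.
intros H K e He.
destruct (H (e / 2)) as [N1 H1]; [lra|]; destruct (K (e / 2)) as [N2 H2]; [lra|].
exists (max N1 N2); intros n Hn.
specialize (H1 n ltac:(lia)); specialize (H2 n ltac:(lia)).
pose proof (norm_sum_le V (minus (plus (u n) (v n)) (plus l m)) (minus (u n) l) (minus (v n) m)
  ltac:(module_ring)) as T; lra.
Qed.

Lemma complete_seq_complete (X : CompleteNormedModule C_AbsRing) : seq_complete X.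
Proof.
intros u Hu.
set (F := filtermap u eventually).
assert (PF : ProperFilter F) by (apply filtermap_proper_filter, eventually_filter).
assert (CF : cauchy F).
{ intros [e He]; destruct (Hu e He) as [N HN].
  exists (u N); exists N; intros n Hn; simpl.
  apply (norm_compat1 (u N) (u n)); now apply HN. }
exists (lim F); intros e He.
pose proof (norm_factor_gt_0 (V := X)) as Q.
destruct (complete_cauchy F PF CF (mkposreal (e / @norm_factor _ X) (Rdiv_lt_0_compat _ _ He Q)))
  as [N HN].
exists N; intros n Hn; specialize (HN n Hn).
apply (@norm_compat2 C_AbsRing X (lim F) (u n)) in HN; simpl in HN.
replace (norm_factor * (e / norm_factor)) with e in HN by (field; lra); exact HN.
Qed.

Lemma lin_seq_complete (U V : CMod) : seq_complete V -> seq_complete (lin_NormedModule U V).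
Proof.
intros HV u Hu.
assert (Cau : forall (x : U), seq_cauchy (fun n => lin_fun (u n) x)).
{ intros x e He; pose proof (norm_ge_0 x).
  destruct (Hu (e / (norm x + 1))) as [N HN]; [apply Rdiv_lt_0_compat; lra|].
  exists N; intros n m Hn Hm; specialize (HN n m Hn Hm).
  apply Rle_lt_trans with (1 := op_norm_apply U V (minus (u n) (u m)) x).
  apply Rle_lt_trans with (e / (norm x + 1) * norm x).
  - apply Rmult_le_compat_r; [lra|now apply Rlt_le].
  - apply Rlt_le_trans with (e / (norm x + 1) * (norm x + 1)); [|right; field; lra].
    apply Rmult_lt_compat_l; [apply Rdiv_lt_0_compat|]; lra. }
set (l := fun x => epsilon (inhabits (zero : V)) (seq_lim (fun n => lin_fun (u n) x))).
assert (Hl : forall x, seq_lim (fun n => lin_fun (u n) x) (l x))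
  by (intros x; apply epsilon_spec, HV, Cau).
assert (Ap : forall (x y : U), l (plus x y) = plus (l x) (l y)).
{ intros x y; apply (seq_lim_unique V (fun n => lin_fun (u n) (plus x y))); [apply Hl|].
  intros e He; destruct (seq_lim_plus V _ _ _ _ (Hl x) (Hl y) e He) as [N HN].
  exists N; intros n Hn; rewrite (linear_plus _ (lin_linear (u n))); now apply HN. }
assert (As : forall (k : C) (x : U), l (scal k x) = scal k (l x)).
{ intros k x; apply (seq_lim_unique V (fun n => lin_fun (u n) (scal k x))); [apply Hl|].
  assert (L : is_linear (fun v : V => scal k v)) by (apply (is_linear_scal_r k); exact Cmult_comm).
  intros e He; destruct (seq_lim_linear V V _ _ _ L (Hl x) e He) as [N HN].
  exists N; intros n Hn; rewrite (linear_scal _ (lin_linear (u n))); now apply HN. }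
(* Letting [m] tend to infinity in the Cauchy condition upgrades pointwise convergence to a bound
   uniform in the direction. *)
assert (Close : forall e, 0 < e -> exists N, forall n, (N <= n)%nat -> forall x : U,
  norm (minus (l x) (lin_fun (u n) x)) <= e * norm x).
{ intros e He; destruct (Hu e He) as [N HN]; exists N; intros n Hn x.
  apply (seq_lim_le V (fun m => lin_fun (u m) x) _ _ _ N (Hl x)); intros m Hm.
  apply Rle_trans with (1 := op_norm_apply U V (minus (u m) (u n)) x).
  apply Rmult_le_compat_r; [apply norm_ge_0|]; apply Rlt_le, (HN m n Hm Hn). }
assert (Lin_l : is_linear l).
{ split; [exact Ap|exact As|].
  destruct (Close 1) as [N HN]; [lra|]; specialize (HN N (Nat.le_refl N)).
  exists (1 + op_norm (u N)); split; [pose proof (op_norm_ge_0 _ _ (u N)); lra|].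
  intros x; specialize (HN x); pose proof (op_norm_apply U V (u N) x).
  pose proof (norm_le_minus V (l x) (lin_fun (u N) x)); lra. }
exists (Lin U V l Lin_l); intros e He.
destruct (Close (e / 2)) as [N HN]; [lra|]; exists N; intros n Hn.
apply Rle_lt_trans with (e / 2); [|lra].
apply op_norm_le; intros x Hx; specialize (HN n Hn x).
change (norm (minus (lin_fun (u n) x) (l x)) <= e / 2).
rewrite norm_minus_sym; apply Rle_trans with (1 := HN).
rewrite <- (Rmult_1_r (e / 2)) at 2; apply Rmult_le_compat_l; lra.
Qed.

Definition hol_at {U V : CMod} (f : U -> V) (x : U) : Prop :=
  exists r, 0 < r /\ forall y : U, norm (minus y x) < r -> fdiff f y.

Lemma inv_nat_small e : 0 < e -> exists N, forall n, (N <= n)%nat -> / (INR n + 1) < e.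
Proof.
intros He; destruct (nfloor_ex (/ e)) as [N [_ HN]]; [now apply Rlt_le, Rinv_0_lt_compat|].
exists N; intros n Hn; apply le_INR in Hn.
rewrite <- (Rinv_inv e); apply Rinv_lt_contravar; [|lra].
pose proof (pos_INR n); apply Rmult_lt_0_compat; [now apply Rinv_0_lt_compat|lra].
Qed.

(** * Differentiability of the derivative *)

Section SecondDerivative.

Variables (U V : CMod) (f : U -> V) (x : U) (r M : R).
Hypothesis HV : seq_complete V.
Hypothesis Hr : 0 < r.
Hypothesis Hf : forall y : U, norm (minus y x) < 4 * r -> fdiff f y.
Hypothesis HM : forall y : U, norm (minus y x) < 4 * r -> norm (f y) <= M.

Let L : R := 16 * M / (r * r).

Let step (n : nat) : R := / (INR n + 1).

(** Unlike [y -> frechet f y v], which they approximate uniformly near [x], these quotients are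
    known to be differentiable; the second derivative is the limit of their derivatives
    [quot_der]. *)
Definition quot (n : nat) (v y : U) : V :=
  scal (RtoC (/ step n) : C) (minus (f (plus y (scal (RtoC (step n) : C) v))) (f y)).

Definition quot_der (n : nat) (v y h : U) : V :=
  scal (RtoC (/ step n) : C)
    (minus (frechet f (plus y (scal (RtoC (step n) : C) v)) h) (frechet f y h)).

Lemma step_pos n : 0 < step n.
Proof. unfold step; pose proof (pos_INR n); apply Rinv_0_lt_compat; lra. Qed.

Lemma bound_nonneg : 0 <= M.
Proof.
apply Rle_trans with (norm (f x)); [apply norm_ge_0|].
apply HM; rewrite norm_minus_self; lra.
Qed.

Lemma L_nonneg : 0 <= L.
Proof.
pose proof bound_nonneg; apply Rdiv_le_0_compat; [lra|]; now apply Rmult_lt_0_compat.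
Qed.

Lemma norm_step n (v : U) : norm (scal (RtoC (step n) : C) v) = step n * norm v.
Proof. pose proof (step_pos n); rewrite norm_scal_C, Cmod_R, Rabs_pos_eq; lra. Qed.

Lemma norm_inv_step n (w : V) : norm (scal (RtoC (/ step n) : C) w) = / step n * norm w.
Proof.
pose proof (Rinv_0_lt_compat _ (step_pos n)); rewrite norm_scal_C, Cmod_R, Rabs_pos_eq; lra.
Qed.

Lemma eventually_small (v : U) :
  exists N, forall n, (N <= n)%nat -> norm (scal (RtoC (step n) : C) v) < r.
Proof.
pose proof (norm_ge_0 v) as P.
destruct (inv_nat_small (r / (norm v + 1))) as [N HN]; [apply Rdiv_lt_0_compat; lra|].
exists N; intros n Hn; rewrite norm_step; specialize (HN n Hn); fold (step n) in HN.
apply Rmult_lt_compat_r with (r := norm v + 1) in HN; [|lra].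
replace (r / (norm v + 1) * (norm v + 1)) with r in HN by (field; lra).
pose proof (step_pos n); nra.
Qed.

Lemma quot_bound n v (y : U) :
  norm (scal (RtoC (step n) : C) v) < r -> norm (minus y x) < r ->
  norm (quot n v y) <= 4 * M / r * norm v.
Proof.
intros Hv Hy; unfold quot; rewrite norm_inv_step.
pose proof (local_lipschitz U V f x r M Hr Hf HM y _ ltac:(lra) Hv) as B.
rewrite norm_step in B; pose proof (step_pos n) as P.
apply Rmult_le_compat_l with (r := / step n) in B;
  [|now apply Rlt_le, Rinv_0_lt_compat].
replace (/ step n * (4 * M / r * (step n * norm v))) with (4 * M / r * norm v) in B
  by (field; lra); exact B.
Qed.

Lemma quot_approx n v (y : U) :
  norm (scal (RtoC (step n) : C) v) < r -> norm (minus y x) < r ->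
  norm (minus (quot n v y) (frechet f y v)) <= L * step n * (norm v * norm v).
Proof.
intros Hv Hy; pose proof (step_pos n) as P.
pose proof (local_quadratic U V f x r M Hr Hf HM y _ Hy Hv) as B.
rewrite norm_step in B; fold L in B.
assert (S0 : RtoC (step n) <> 0) by (intros E; injection E; lra).
replace (minus (quot n v y) (frechet f y v)) with
  (scal (RtoC (/ step n) : C) (minus (minus (f (plus y (scal (RtoC (step n) : C) v))) (f y))
    (frechet f y (scal (RtoC (step n) : C) v)))).
2:{ unfold quot; rewrite (linear_scal _ (lin_linear (frechet f y))), RtoC_inv by lra.
    module_field; exact S0. }
rewrite norm_inv_step.
apply Rmult_le_compat_l with (r := / step n) in B;
  [|now apply Rlt_le, Rinv_0_lt_compat].
replace (/ step n * (L * (step n * norm v) * (step n * norm v)))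
  with (L * step n * (norm v * norm v)) in B by (field; lra); exact B.
Qed.

Lemma quot_fder n v (y : U) :
  norm (scal (RtoC (step n) : C) v) < r -> norm (minus y x) < r ->
  fder (quot n v) y (quot_der n v y).
Proof.
intros Hv Hy.
pose proof (norm_shift U x y (scal (RtoC (step n) : C) v)) as S.
assert (I : fder (fun z => minus (f (plus z (scal (RtoC (step n) : C) v))) (f z)) y
  (fun h => minus (frechet f (plus y (scal (RtoC (step n) : C) v)) h) (frechet f y h))).
{ apply fder_increment; apply Hf; lra. }
refine (fder_comp U V V _ (fun w => scal (RtoC (/ step n) : C) w) y _ _ I _).
apply fder_linear, (is_linear_scal_r (RtoC (/ step n))); exact Cmult_comm.
Qed.

Lemma quot_der_bound n v h :
  norm (scal (RtoC (step n) : C) v) < r ->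
  norm (quot_der n v x h) <= L * norm v * norm h.
Proof.
intros Hv; unfold quot_der; rewrite norm_inv_step; pose proof (step_pos n) as P.
pose proof (local_derivative_lipschitz U V f x r M Hr Hf HM x (scal (RtoC (step n) : C) v) h
  ltac:(rewrite norm_minus_self; exact Hr) Hv) as B.
rewrite norm_step in B; fold L in B.
apply Rmult_le_compat_l with (r := / step n) in B;
  [|now apply Rlt_le, Rinv_0_lt_compat].
replace (/ step n * (L * (step n * norm v) * norm h))
  with (L * norm v * norm h) in B by (field; lra); exact B.
Qed.

(** Both quotients are uniformly close to [frechet f y v] on a ball, so their difference is
    uniformly small there; the Cauchy estimate passes this to the derivatives at [x]. *)
Lemma quot_der_diff n m v h :
  norm (scal (RtoC (step n) : C) v) < r -> norm (scal (RtoC (step m) : C) v) < r ->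
  norm (minus (quot_der n v x h) (quot_der m v x h)) <=
    4 * (L * (step n + step m) * (norm v * norm v)) / r * norm h.
Proof.
intros Hn Hm.
assert (D : forall y : U, norm (minus y x) < r -> fder (fun z => minus (quot n v z) (quot m v z)) y
  (fun h => minus (quot_der n v y h) (quot_der m v y h))).
{ intros y Hy; apply (fder_plus U V _ (fun z => opp (quot m v z)) y); [now apply quot_fder|].
  apply (fder_comp U V V (quot m v) opp y (quot_der m v y)); [now apply quot_fder|].
  apply fder_linear, is_linear_opp. }
apply (fder_ball_estimate U V (fun z => minus (quot n v z) (quot m v z)) x
  (fun h => minus (quot_der n v x h) (quot_der m v x h)) r _ Hr).
- intros y Hy; eexists; now apply D.
- apply D; rewrite norm_minus_self; exact Hr.
- intros y Hy.
  pose proof (quot_approx n v y Hn Hy); pose proof (quot_approx m v y Hm Hy).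
  pose proof (norm_minus_triangle V (quot n v y) (frechet f y v) (quot m v y)) as T.
  rewrite (norm_minus_sym V (frechet f y v) (quot m v y)) in T; lra.
Qed.

Lemma second_derivative_limit (v h : U) : exists l, seq_lim (fun n => quot_der n v x h) l.
Proof.
apply HV; intros e He.
pose proof (norm_ge_0 v) as Nv; pose proof (norm_ge_0 h) as Nh; pose proof L_nonneg as HL.
set (K := 4 * (L * (norm v * norm v)) / r * norm h).
assert (K0 : 0 <= K).
{ apply Rmult_le_pos; [|lra]; apply Rdiv_le_0_compat; [|lra].
  apply Rmult_le_pos; [lra|]; apply Rmult_le_pos; [lra|]; now apply Rmult_le_pos. }
destruct (eventually_small v) as [N1 H1].
destruct (inv_nat_small (e / (2 * (K + 1)))) as [N2 H2]; [apply Rdiv_lt_0_compat; lra|].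
exists (max N1 N2); intros n m Hn Hm.
pose proof (quot_der_diff n m v h (H1 n ltac:(lia)) (H1 m ltac:(lia))) as B.
apply Rle_lt_trans with (1 := B).
replace (4 * (L * (step n + step m) * (norm v * norm v)) / r * norm h)
  with (K * (step n + step m)) by (unfold K; field; lra).
pose proof (H2 n ltac:(lia)) as A1; pose proof (H2 m ltac:(lia)) as A2.
fold (step n) in A1; fold (step m) in A2.
apply Rle_lt_trans with (K * (e / (2 * (K + 1)) + e / (2 * (K + 1)))).
- apply Rmult_le_compat_l; lra.
- apply Rlt_le_trans with ((K + 1) * (e / (2 * (K + 1)) + e / (2 * (K + 1)))).
  + apply Rmult_lt_compat_r; [|lra].
    assert (0 < e / (2 * (K + 1))) by (apply Rdiv_lt_0_compat; lra); lra.
  + right; field; lra.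
Qed.

(** The derivative at [x] of [y -> frechet f y v] in the direction [h]: the direction of the second
    differentiation comes last. *)
Definition sder (v h : U) : V :=
  epsilon (inhabits (zero : V)) (seq_lim (fun n => quot_der n v x h)).

Lemma sder_lim v h : seq_lim (fun n => quot_der n v x h) (sder v h).
Proof. unfold sder; apply epsilon_spec, second_derivative_limit. Qed.

Lemma sder_bound v h : norm (sder v h) <= L * norm v * norm h.
Proof.
destruct (eventually_small v) as [N HN].
pose proof (seq_lim_le V _ _ zero (L * norm v * norm h) N (sder_lim v h)) as B.
rewrite norm_minus_zero in B; apply B; intros n Hn; rewrite norm_minus_zero.
apply quot_der_bound, HN, Hn.
Qed.

Lemma sder_linear_h v : is_linear (sder v).
Proof.
assert (Q : forall n, is_linear (quot_der n v x)).
{ intros n; unfold quot_der.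
  pose proof (lin_linear (minus (frechet f (plus x (scal (RtoC (step n) : C) v))) (frechet f x))) as I.
  apply (is_linear_comp _ (fun w : V => scal (RtoC (/ step n) : C) w) I).
  apply (is_linear_scal_r (RtoC (/ step n))); exact Cmult_comm. }
split.
- intros h k; apply (seq_lim_unique V (fun n => quot_der n v x (plus h k))); [apply sder_lim|].
  intros e He; destruct (seq_lim_plus V _ _ _ _ (sder_lim v h) (sder_lim v k) e He) as [N HN].
  exists N; intros n Hn; rewrite (linear_plus _ (Q n)); now apply HN.
- intros c h; apply (seq_lim_unique V (fun n => quot_der n v x (scal c h))); [apply sder_lim|].
  assert (I : is_linear (fun w : V => scal c w)) by (apply (is_linear_scal_r c); exact Cmult_comm).
  intros e He; destruct (seq_lim_linear V V _ _ _ I (sder_lim v h) e He) as [N HN].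
  exists N; intros n Hn; rewrite (linear_scal _ (Q n)); now apply HN.
- exists (L * norm v + 1); pose proof L_nonneg; pose proof (norm_ge_0 v).
  assert (0 <= L * norm v) by now apply Rmult_le_pos.
  split; [lra|]; intros h; pose proof (sder_bound v h); pose proof (norm_ge_0 h); nra.
Qed.

(** [local_quadratic] for [quot n v] on balls of radius [r / 4] has a constant independent of [n],
    and the estimate survives the limit. The constant combines the [16] of that lemma, the bound
    [4 M / r] of the quotients and [(r / 4)^2] in the denominator. *)
Lemma sder_quadratic v (k : U) :
  norm k < r / 4 ->
  norm (minus (minus (frechet f (plus x k) v) (frechet f x v)) (sder v k)) <=
    1024 * M / (r * r * r) * norm v * norm k * norm k.
Proof.
intros Hk.
assert (X0 : norm (minus x x) < r) by (rewrite norm_minus_self; exact Hr).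
assert (Xk : norm (minus (plus x k) x) < r).
{ rewrite norm_plus_minus; lra. }
destruct (eventually_small v) as [N HN].
rewrite norm_minus_sym.
apply le_epsilon; intros e He.
assert (HL := L_nonneg); pose proof (norm_ge_0 v) as Nv.
assert (K0 : 0 <= L * (norm v * norm v)) by (apply Rmult_le_pos; [lra|]; now apply Rmult_le_pos).
destruct (inv_nat_small (e / (2 * (L * (norm v * norm v) + 1)))) as [N2 HN2];
  [apply Rdiv_lt_0_compat; lra|].
apply (seq_lim_le V _ _ _ _ (max N N2) (sder_lim v k)); intros n Hn.
specialize (HN n ltac:(lia)); specialize (HN2 n ltac:(lia)); fold (step n) in HN2.
pose proof (quot_approx n v _ HN X0) as A0; pose proof (quot_approx n v _ HN Xk) as A1.
assert (Q : norm (minus (minus (quot n v (plus x k)) (quot n v x)) (frechet (quot n v) x k)) <=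
  16 * (4 * M / r * norm v) / (r / 4 * (r / 4)) * norm k * norm k).
{ apply (local_quadratic U V (quot n v) x (r / 4)); try lra.
  - intros y Hy; eexists; apply quot_fder; [exact HN|lra].
  - intros y Hy; apply quot_bound; [exact HN|lra].
  - rewrite norm_minus_self; lra. }
rewrite (frechet_unique _ _ _ _ _ k (quot_fder n v x HN X0)) in Q.
replace (16 * (4 * M / r * norm v) / (r / 4 * (r / 4)) * norm k * norm k)
  with (1024 * M / (r * r * r) * norm v * norm k * norm k) in Q by (field; lra).
pose proof (norm_sum_le V (minus (quot_der n v x k) (minus (frechet f (plus x k) v) (frechet f x v)))
  (minus (quot_der n v x k) (minus (quot n v (plus x k)) (quot n v x)))
  (minus (minus (quot n v (plus x k)) (frechet f (plus x k) v)) (minus (quot n v x) (frechet f x v)))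
  ltac:(module_ring)) as T1.
pose proof (norm_minus_le V (minus (quot n v (plus x k)) (frechet f (plus x k) v))
  (minus (quot n v x) (frechet f x v))) as T2.
rewrite (norm_minus_sym V (quot_der n v x k) (minus (quot n v (plus x k)) (quot n v x))) in T1.
assert (E : L * step n * (norm v * norm v) <= e / 2).
{ replace (L * step n * (norm v * norm v)) with (step n * (L * (norm v * norm v))) by ring.
  apply Rle_trans with (e / (2 * (L * (norm v * norm v) + 1)) * (L * (norm v * norm v) + 1)).
  - apply Rmult_le_compat; pose proof (step_pos n); lra.
  - right; field; lra. }
lra.
Qed.

Lemma sder_fder v : fder (fun y => frechet f y v) x (sder v).
Proof.
split; [apply sder_linear_h|]; intros e He.
set (K := 1024 * M / (r * r * r) * norm v).
assert (K0 : 0 <= K).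
{ apply Rmult_le_pos; [|apply norm_ge_0]; pose proof bound_nonneg.
  apply Rdiv_le_0_compat; [lra|]; repeat apply Rmult_lt_0_compat; exact Hr. }
exists (Rmin (r / 4) (e / (K + 1))); split.
{ apply Rmin_pos; [lra|apply Rdiv_lt_0_compat; lra]. }
intros y Hy.
pose proof (Rlt_le_trans _ _ _ Hy (Rmin_l _ _)) as Y1.
pose proof (Rlt_le_trans _ _ _ Hy (Rmin_r _ _)) as Y2.
pose proof (sder_quadratic v (minus y x) Y1) as B; fold K in B.
replace (plus x (minus y x)) with y in B by module_ring.
apply Rle_trans with (1 := B); pose proof (norm_ge_0 (minus y x)) as P.
apply Rmult_le_compat_r; [exact P|].
apply Rle_trans with ((K + 1) * (e / (K + 1))); [|right; field; lra].
apply Rmult_le_compat; lra.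
Qed.

(** The difference quotients are not linear in [v]; linearity comes from that of [frechet f y] and
    the uniqueness of derivatives. *)
Lemma sder_linear_v h : is_linear (fun v => sder v h).
Proof.
split.
- intros v w.
  pose proof (fder_plus U V _ _ x _ _ (sder_fder v) (sder_fder w)) as P.
  apply (fder_unique U V (fun y => frechet f y (plus v w)) x (sder (plus v w))
    (fun h => plus (sder v h) (sder w h))); [apply sder_fder|].
  revert P; apply fder_ext; [|reflexivity].
  intros y; symmetry; apply (linear_plus _ (lin_linear (frechet f y))).
- intros c v.
  assert (I : is_linear (fun w : V => scal c w)) by (apply (is_linear_scal_r c); exact Cmult_comm).
  pose proof (fder_comp U V V _ (fun w => scal c w) x _ _ (sder_fder v)
    (fder_linear V V _ (frechet f x v) I)) as P.
  apply (fder_unique U V (fun y => frechet f y (scal c v)) x (sder (scal c v))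
    (fun h => scal c (sder v h))); [apply sder_fder|].
  revert P; apply fder_ext; [|reflexivity].
  intros y; symmetry; apply (linear_scal _ (lin_linear (frechet f y))).
- exists (L * norm h + 1); pose proof L_nonneg; pose proof (norm_ge_0 h).
  assert (0 <= L * norm h) by now apply Rmult_le_pos.
  split; [lra|]; intros v; pose proof (sder_bound v h); pose proof (norm_ge_0 v); nra.
Qed.

(** The error in [sder_quadratic] is linear in [|v|], hence uniform over the unit ball, so
    differentiability for each [v] becomes differentiability in operator norm. *)
Lemma frechet_fder : fdiff (frechet f) x.
Proof.
set (l := fun h : U => Lin U V (fun v => sder v h) (sder_linear_v h)).
exists l; split.
- split.
  + intros h k; apply lin_ext; intros v; apply (linear_plus _ (sder_linear_h v)).
  + intros c h; apply lin_ext; intros v; apply (linear_scal _ (sder_linear_h v)).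
  + exists (L + 1); pose proof L_nonneg; split; [lra|]; intros h.
    apply Rle_trans with (L * norm h); [|pose proof (norm_ge_0 h); nra].
    apply op_norm_le; intros v Hv; simpl.
    apply Rle_trans with (1 := sder_bound v h).
    rewrite (Rmult_assoc L); apply Rmult_le_compat_l; [lra|].
    pose proof (norm_ge_0 h); nra.
- intros e He.
  set (K := 1024 * M / (r * r * r)).
  assert (K0 : 0 <= K).
  { pose proof bound_nonneg.
    apply Rdiv_le_0_compat; [lra|]; repeat apply Rmult_lt_0_compat; exact Hr. }
  exists (Rmin (r / 4) (e / (K + 1))); split.
  { apply Rmin_pos; [lra|apply Rdiv_lt_0_compat; lra]. }
  intros y Hy.
  pose proof (Rlt_le_trans _ _ _ Hy (Rmin_l _ _)) as Y1.
  pose proof (Rlt_le_trans _ _ _ Hy (Rmin_r _ _)) as Y2.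
  apply op_norm_le; intros v Hv.
  pose proof (sder_quadratic v (minus y x) Y1) as B; fold K in B.
  replace (plus x (minus y x)) with y in B by module_ring.
  apply Rle_trans with (1 := B); pose proof (norm_ge_0 (minus y x)) as P.
  apply Rmult_le_compat_r; [exact P|].
  apply Rle_trans with ((K + 1) * (e / (K + 1))); [|right; field; lra].
  apply Rmult_le_compat; try lra; pose proof (norm_ge_0 v); nra.
Qed.

End SecondDerivative.

Lemma hol_at_near (U V : CMod) (f : U -> V) (x : U) :
  hol_at f x -> exists r, 0 < r /\ forall y : U, norm (minus y x) < r -> hol_at f y.
Proof.
intros [r [Hr H]]; exists (r / 2); split; [lra|]; intros y Hy.
exists (r / 2); split; [lra|]; intros z Hz; apply H.
pose proof (norm_minus_triangle U z y x); lra.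
Qed.

Lemma hol_at_fdiff (U V : CMod) (f : U -> V) (x : U) : hol_at f x -> fdiff f x.
Proof. intros [r [Hr H]]; apply H; rewrite norm_minus_self; exact Hr. Qed.

Lemma hol_at_frechet_fdiff (U V : CMod) (f : U -> V) (x : U) :
  seq_complete V -> hol_at f x -> fdiff (frechet f) x.
Proof.
intros HV [r [Hr H]].
destruct (H x) as [l Hl]; [rewrite norm_minus_self; exact Hr|].
(* Continuity at [x] supplies the local bound [|f x| + 1] that the estimates take as [M]. *)
destruct (fder_continuous U V f x l 1 Hl Rlt_0_1) as [d [Hd K]].
assert (Rm : 0 < Rmin r d) by now apply Rmin_pos.
apply (frechet_fder U V f x (Rmin r d / 4) (norm (f x) + 1) HV); [lra| |].
- intros y Hy; apply H; apply Rlt_le_trans with (2 := Rmin_l r d); lra.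
- intros y Hy; pose proof (Rmin_r r d); specialize (K y ltac:(lra)).
  pose proof (norm_le_minus V (f y) (f x)); lra.
Qed.

Lemma hol_at_frechet (U V : CMod) (f : U -> V) (x : U) :
  seq_complete V -> hol_at f x -> hol_at (frechet f) x.
Proof.
intros HV H; destruct (hol_at_near U V f x H) as [r [Hr K]].
exists r; split; [exact Hr|]; intros y Hy; now apply hol_at_frechet_fdiff, K.
Qed.

Lemma multilin_seq_complete (U V : CMod) n : seq_complete V -> seq_complete (multilin n U V).
Proof. intros HV; induction n as [|n IH]; [exact HV|now apply lin_seq_complete]. Qed.

Lemma hol_at_frechet_n (U V : CMod) (f : U -> V) (x : U) n :
  seq_complete V -> hol_at f x -> hol_at (frechet_n n f) x.
Proof.
intros HV H; induction n as [|n IH]; [exact H|].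
apply (hol_at_frechet U (multilin n U V)); [now apply multilin_seq_complete|exact IH].
Qed.

(** * Restriction to a complex line *)

Section Inverse.

Variables (X : CMod) (A B : C -> lin X X) (z : C) (A' : lin X X) (r : R).
Hypothesis Hr : 0 < r.
Hypothesis HA : @vder (lin_NormedModule X X) A z A'.
Hypothesis HB : forall w, Cmod (w - z) < r -> is_inverse (A w) (B w).

(** The resolvent identity [B_w - B_z = - B_w (A_w - A_z) B_z]. *)
Lemma inverse_difference w v : Cmod (w - z) < r ->
  minus (B w v) (B z v) = opp (B w (minus (A w) (A z) (B z v))).
Proof.
intros Hw; destruct (HB w Hw) as [H1 H2].
destruct (HB z) as [K1 K2]; [replace (z - z)%C with (RtoC 0) by ring; rewrite Cmod_0; exact Hr|].
change (minus (A w) (A z) (B z v)) with (minus (A w (B z v)) (A z (B z v))).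
rewrite (is_linear_minus X X (B w)) by apply lin_linear.
rewrite H2, K1; module_ring.
Qed.

(** For [A_w] close to [A_z] the resolvent identity gives [|B_w| <= |B_z| + |B_w| / 2]; as [|B_w|]
    is finite, its half can be absorbed. *)
Lemma inverse_bounded : exists K d, 0 < K /\ 0 < d /\ d <= r /\
  forall w v, Cmod (w - z) < d -> norm (B w v) <= K * norm v.
Proof.
pose proof (op_norm_ge_0 X X (B z)) as Nz.
destruct (fder_continuous C_NormedModule (lin_NormedModule X X) A z _
  (/ (2 * (op_norm (B z) + 1))) HA) as [d [Hd K]]; [apply Rinv_0_lt_compat; lra|].
exists (2 * (op_norm (B z) + 1)), (Rmin d r); split; [lra|]; split; [now apply Rmin_pos|].
split; [apply Rmin_r|]; intros w v Hw.
assert (W1 : Cmod (w - z) < d) by (apply Rlt_le_trans with (1 := Hw), Rmin_l).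
assert (W2 : Cmod (w - z) < r) by (apply Rlt_le_trans with (1 := Hw), Rmin_r).
specialize (K w W1); change (op_norm (minus (A w) (A z)) < / (2 * (op_norm (B z) + 1))) in K.
assert (N : op_norm (B w) <= 2 * op_norm (B z)).
{ assert (N1 : op_norm (B w) <= op_norm (B z) + op_norm (B w) / 2).
  { apply op_norm_le; intros y Hy.
    pose proof (op_norm_ge_0 X X (B w)) as Nw.
    pose proof (norm_le_minus X (B w y) (B z y)) as T.
    rewrite (inverse_difference w y W2) in T.
    pose proof (op_norm_apply X X (B w) (minus (A w) (A z) (B z y))) as T1.
    pose proof (op_norm_apply X X (minus (A w) (A z)) (B z y)) as T2.
    pose proof (op_norm_ub X X (B z) y Hy) as T3.
    pose proof (op_norm_ge_0 X X (minus (A w) (A z))).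
    assert (T4 : norm (minus (A w) (A z) (B z y)) <= / 2).
    { apply Rle_trans with (1 := T2).
      apply Rle_trans with (/ (2 * (op_norm (B z) + 1)) * (op_norm (B z) + 1));
        [|right; field; lra].
      apply Rmult_le_compat; try lra; apply norm_ge_0. }
    assert (T5 : op_norm (B w) * norm (minus (A w) (A z) (B z y)) <= op_norm (B w) * / 2)
      by now apply Rmult_le_compat_l.
    match type of T with _ <= ?q + _ =>
      assert (T6 : q <= op_norm (B w) * norm (minus (A w) (A z) (B z y))) end.
    { eapply Rle_trans; [right; exact (norm_opp (B w (minus (A w) (A z) (B z y))))|exact T1]. }
    lra. }
  lra. }
apply Rle_trans with (1 := op_norm_apply X X (B w) v).
apply Rmult_le_compat_r; [apply norm_ge_0|lra].
Qed.

(** Freezing [u = B_z (y z)], the increment is [B_w (y w - A_w u)], where the argument vanishes at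
    [w = z]. Its derivative involves only [y] and [A], and [B] enters through boundedness and
    continuity on the fixed vector [v]. *)
Lemma vder_inverse_apply (y : C -> X) (y' : X) :
  vder y z y' -> vder (fun w => B w (y w)) z (B z (minus y' (A' (B z (y z))))).
Proof.
intros Hy.
destruct inverse_bounded as [K [d [HK [Hd [Hdr BK]]]]].
set (u := B z (y z)); set (v := minus y' (A' u)).
assert (Hu : A z u = y z).
{ apply HB; replace (z - z)%C with (RtoC 0) by ring; rewrite Cmod_0; exact Hr. }
assert (Hs : vder (fun w => minus (y w) (A w u)) z v).
{ apply vder_minus; [exact Hy|].
  exact (vder_linear (lin_NormedModule X X) X A (fun L : lin X X => L u) z A'
    (is_linear_apply X X u) HA). }
apply vder_intro; intros e He.
destruct (vder_bound _ _ _ _ Hs (e / (2 * K))) as [d1 [P1 H1]]; [apply Rdiv_lt_0_compat; lra|].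
pose proof (norm_ge_0 (B z v)) as Nv; pose proof (norm_ge_0 v) as Nv'.
assert (Q : 0 < K * (norm (B z v) + 1)) by (apply Rmult_lt_0_compat; lra).
destruct (fder_continuous C_NormedModule (lin_NormedModule X X) A z _
  (e / (2 * (K * (norm (B z v) + 1)))) HA) as [d2 [P2 H2]]; [apply Rdiv_lt_0_compat; lra|].
exists (Rmin d (Rmin d1 d2)); split; [repeat apply Rmin_pos; lra|]; intros w Hw.
assert (W0 : Cmod (w - z) < d) by (apply Rlt_le_trans with (1 := Hw), Rmin_l).
assert (W1 : Cmod (w - z) < d1) by below_min Hw.
assert (W2 : Cmod (w - z) < d2) by below_min Hw.
specialize (H1 w W1); specialize (H2 w W2).
change (op_norm (minus (A w) (A z)) < e / (2 * (K * (norm (B z v) + 1)))) in H2.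
assert (Wr : Cmod (w - z) < r) by lra.
assert (E : minus (minus (B w (y w)) (B z (y z))) (scal (w - z)%C (B z v)) =
  plus (B w (minus (minus (minus (y w) (A w u)) (minus (y z) (A z u))) (scal (w - z)%C v)))
    (scal (w - z)%C (minus (B w v) (B z v)))).
{ fold u; rewrite !(is_linear_minus X X (B w)), (linear_scal _ (lin_linear (B w)))
    by apply lin_linear.
  rewrite Hu, (proj2 (HB w Wr) u); module_ring. }
rewrite E; clear E.
eapply Rle_trans; [exact (norm_plus_le X _ _)|].
rewrite (inverse_difference w v Wr), norm_scal_C.
pose proof (Cmod_ge_0 (w - z)) as Cz.
match goal with |- ?a + _ * ?b <= _ =>
  assert (E1 : a <= e / 2 * Cmod (w - z)); [|assert (E2 : b <= e / 2)] end.
- eapply Rle_trans; [exact (BK w _ W0)|].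
  eapply Rle_trans; [apply Rmult_le_compat_l; [lra|exact H1]|]; right; field; lra.
- eapply Rle_trans; [right; exact (norm_opp (B w (minus (A w) (A z) (B z v))))|].
  eapply Rle_trans; [exact (BK w _ W0)|].
  eapply Rle_trans; [apply Rmult_le_compat_l; [lra|exact (op_norm_apply X X (minus (A w) (A z)) (B z v))]|].
  apply Rle_trans with (K * (e / (2 * (K * (norm (B z v) + 1))) * (norm (B z v) + 1)));
    [|right; field; split; lra].
  apply Rmult_le_compat_l; [lra|]; apply Rmult_le_compat; try lra; apply op_norm_ge_0.
- assert (Cmod (w - z) * (e / 2) = e / 2 * Cmod (w - z)) as E3 by ring.
  pose proof (Rmult_le_compat_l _ _ _ Cz E2); lra.
Qed.

End Inverse.

Definition little_o {V : CMod} (n : nat) (f : C -> V) : Prop :=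
  forall e, 0 < e -> exists d, 0 < d /\ forall z, Cmod z < d -> norm (f z) <= e * Cmod z ^ n.

Lemma little_o_integrate (V : CMod) (n : nat) (f f' : C -> V) rho :
  0 < rho -> (forall z, Cmod z < rho -> vder f z (f' z)) -> f 0 = zero ->
  little_o n f' -> little_o (S n) f.
Proof.
intros Hr Hf H0 Ho e He; destruct (Ho e He) as [d [Hd K]].
exists (Rmin d rho); split; [now apply Rmin_pos|]; intros z Hz.
pose proof (Rmin_l d rho); pose proof (Rmin_r d rho).
pose proof (mean_value_inequality C_NormedModule V f (RtoC 0) z (e * Cmod z ^ S n)) as MV.
assert (E : norm (minus (f (@plus C_NormedModule (RtoC 0) z)) (f 0)) = norm (f z)).
{ rewrite H0, norm_minus_zero; f_equal; f_equal; exact (Cplus_0_l z). }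
rewrite <- E; apply MV; intros t Ht.
set (w := @plus C_NormedModule (RtoC 0) (@scal C_Ring C_NormedModule (RtoC t) z)).
assert (Ew : w = (RtoC t * z)%C) by exact (Cplus_0_l _).
assert (Nw : Cmod w <= Cmod z).
{ rewrite Ew, Cmod_mult, Cmod_R, Rabs_pos_eq by lra; pose proof (Cmod_ge_0 z); nra. }
assert (D : fder (U := C_NormedModule) f w (fun s => scal (s : C) (f' w))) by (apply Hf; lra).
split; [eexists; exact D|].
rewrite (frechet_unique C_NormedModule V f w _ z D), norm_scal_C.
simpl pow; rewrite <- Rmult_assoc, (Rmult_comm e), Rmult_assoc.
apply Rmult_le_compat_l; [apply Cmod_ge_0|].
apply Rle_trans with (e * Cmod w ^ n); [apply K; lra|].
apply Rmult_le_compat_l; [lra|]; apply pow_incr; split; [apply Cmod_ge_0|exact Nw].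
Qed.

Lemma little_o_vder (V : CMod) (f : C -> V) a :
  vder f 0 a -> little_o 1 (fun z => minus (f z) (plus (f 0) (scal z a))).
Proof.
intros H e He; destruct (vder_bound _ _ _ _ H e He) as [d [Hd K]].
exists d; split; [exact Hd|]; intros z Hz; specialize (K z).
replace (z - 0)%C with z in K by ring; rewrite pow_1.
eapply Rle_trans; [|exact (K Hz)]; right; f_equal; module_ring.
Qed.

Lemma is_linear_diag (X V : CMod) n (x : X) : is_linear (fun A : multilin n X V => diag n x A).
Proof.
induction n as [|n IH]; [apply is_linear_id|].
apply (is_linear_comp (fun A : lin X (multilin n X V) => A x) (fun B => diag n x B)
  (is_linear_apply X (multilin n X V) x) IH).
Qed.

(** * Iterated derivatives along the line *)

Section Slice.

Variables (X : CompleteNormedModule C_AbsRing) (F : X -> X) (x0 : X).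
Hypothesis HF : holomorphic_on_ball F.

Lemma hol_at_ball (x : X) : norm x < 1 -> hol_at F x.
Proof.
intros Hx; exists (1 - norm x); split; [lra|]; intros y Hy.
destruct (HF y) as [l Hl].
- pose proof (norm_le_minus X y x); lra.
- exists l; now apply fder_filterdiff.
Qed.

Lemma norm_slice (z : C) : norm x0 = 1 -> norm (scal z x0) = Cmod z.
Proof. intros H; rewrite norm_scal_C, H; ring. Qed.

Lemma frechet_n_slice n (z : C) : norm (scal z x0 : X) < 1 ->
  @vder (multilin n X X) (fun s => frechet_n n F (scal s x0)) z
    (lin_fun (frechet_n (S n) F (scal z x0)) x0).
Proof.
intros Hz.
assert (Hd : fdiff (frechet_n n F) (scal z x0 : X)).
{ apply hol_at_fdiff, hol_at_frechet_n; [apply complete_seq_complete|].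
  exact (hol_at_ball _ Hz). }
pose proof (vder_line X (multilin n X X) (frechet_n n F) zero x0 z (scal z x0) _
  ltac:(module_ring) (frechet_spec _ _ _ _ Hd)) as V.
revert V; apply vder_ext; [|reflexivity].
intros s; f_equal; module_ring.
Qed.

(** The direction of differentiation fills the outermost slot of the next derivative, and as it is
    [x0] again the result stays on the diagonal. *)
Lemma Dn_diag_slice n (z : C) : norm (scal z x0 : X) < 1 ->
  vder (fun s => Dn_diag n F (scal s x0) x0) z (Dn_diag (S n) F (scal z x0) x0).
Proof.
intros Hz.
exact (vder_linear (multilin n X X) X _ (fun A => diag n x0 A) z _
  (is_linear_diag X X n x0) (frechet_n_slice n z Hz)).
Qed.

End Slice.

(** * The function of Caratheodory attached to a support functional *)

(* [ring] does not recognize [C] behind the canonical structures built on it. *)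
Ltac Cring := match goal with |- @eq _ ?x ?y => change (@eq C x y) end; ring.

Lemma vder_Cpow n (z : C) :
  @vder C_NormedModule (fun w => w ^ S n)%C z (RtoC (INR (S n)) * z ^ n)%C.
Proof.
induction n as [|n IH].
- apply (vder_ext C_NormedModule (fun w => w) _ z (RtoC 1)).
  + intros w; simpl; ring.
  + simpl; Cring.
  + apply vder_id.
- pose proof (vder_Cmult (fun w => w) (fun w => w ^ S n)%C z _ _ (vder_id z) IH) as V.
  revert V; apply vder_ext; [reflexivity|].
  rewrite (S_INR (S n)), RtoC_plus; simpl Cpow; Cring.
Qed.

Lemma vder_monomial (V : CMod) (c d : C) (v : V) n (z : C) :
  (c * RtoC (INR (S n)))%C = d ->
  vder (fun w => scal (c * w ^ S n)%C v) z (scal (d * z ^ n)%C v).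
Proof.
intros <-.
pose proof (vder_scal_r C_NormedModule (fun w => w ^ S n)%C z _ c (vder_Cpow n z)) as W.
pose proof (vder_scal V _ (fun _ => v) z _ _ W (vder_const V v z)) as Q.
revert Q; apply vder_ext; [reflexivity|].
change (plus (scal (c * (RtoC (INR (S n)) * z ^ n))%C v) (scal (c * z ^ S n)%C zero)
  = scal (c * RtoC (INR (S n)) * z ^ n)%C v).
module_ring.
Qed.

Lemma little_o_dominated (U V : CMod) n (f : C -> U) (g : C -> V) K d :
  0 < K -> 0 < d -> (forall z, Cmod z < d -> norm (g z) <= K * norm (f z)) ->
  little_o n f -> little_o n g.
Proof.
intros HK Hd H Hf e He.
destruct (Hf (e / K)) as [r [Hr B]]; [now apply Rdiv_lt_0_compat|].
exists (Rmin d r); split; [now apply Rmin_pos|]; intros z Hz.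
pose proof (Rmin_l d r); pose proof (Rmin_r d r).
apply Rle_trans with (1 := H z ltac:(lra)).
replace (e * Cmod z ^ n) with (K * (e / K * Cmod z ^ n)) by (field; lra).
apply Rmult_le_compat_l; [lra|apply B; lra].
Qed.

Lemma little_o_lim0 (f : C -> C) n :
  @little_o C_NormedModule n f -> lim0 (fun z => f z / z ^ n)%C 0.
Proof.
intros H e He; destruct (H (e / 2)) as [d [Hd K]]; [lra|].
exists d; split; [exact Hd|]; intros z [Z1 Z2]; specialize (K z Z2).
change (Cmod (f z) <= e / 2 * Cmod z ^ n) in K.
assert (Hz : (z ^ n)%C <> 0) by (apply Cpow_nz, Cmod_gt_0; lra).
assert (P : 0 < Cmod z ^ n) by now apply pow_lt.
replace (f z / z ^ n - 0)%C with (f z / z ^ n)%C by ring.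
rewrite Cmod_div, Cmod_pow by exact Hz.
apply Rmult_lt_reg_r with (1 := P); unfold Rdiv at 1.
rewrite Rmult_assoc, Rinv_l by lra.
assert (e / 2 * Cmod z ^ n < e * Cmod z ^ n) by (apply Rmult_lt_compat_r; lra).
lra.
Qed.

Section Slice.

Variables (X : CompleteNormedModule C_AbsRing) (F : X -> X) (x0 : X)
  (T : lin X C_NormedModule) (lambda : R).
Hypothesis Hlambda : 1 / 2 <= lambda <= 1.
Hypothesis HF : class_F lambda F.
Hypothesis Hx0 : norm x0 = 1.
Hypothesis HT : support_functional x0 T.

Let g (n : nat) (z : C) : X := Dn_diag n F (scal z x0) x0.
Let u (n : nat) : X := Dn_diag n F zero x0.
Let A (z : C) : lin X X := D F (scal z x0).
Let B (z : C) : lin X X := inverse (A z).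
(** The quantity of [class_F] at [z x0], with the common factor [z] removed: it cancels against
    [1 / |z|] and the rotation of the functional in [slice_re]. This leaves a function defined and
    holomorphic at [0] as well. *)
Let p (z : C) : C := T (B z (plus (scal z (g 2 z)) (g 1 z))).

Lemma slice_holomorphic : holomorphic_on_ball F.
Proof. apply HF. Qed.

Lemma slice_inverse z : Cmod z < 1 -> is_inverse (A z) (B z).
Proof.
intros Hz; unfold B, inverse; apply epsilon_spec.
destruct HF as [_ [[_ H] _]]; apply H.
rewrite (norm_slice X x0 z Hx0); exact Hz.
Qed.

Lemma T_x0 : T x0 = RtoC 1.
Proof. destruct HT as [H _]; now rewrite H, Hx0. Qed.

Lemma T_bound v : Cmod (T v) <= norm v.
Proof.
destruct HT as [_ H]; pose proof (op_norm_apply X C_NormedModule T v) as Q.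
rewrite H, Rmult_1_l in Q; exact Q.
Qed.

Lemma slice_g_0 n : g n 0 = u n.
Proof. unfold g, u; f_equal; module_ring. Qed.

Lemma slice_vder n z : Cmod z < 1 -> vder (g n) z (g (S n) z).
Proof.
intros Hz; apply (Dn_diag_slice X F x0 slice_holomorphic).
rewrite (norm_slice X x0 z Hx0); exact Hz.
Qed.

Lemma slice_A_x0 z : A z x0 = g 1 z.
Proof. reflexivity. Qed.

Lemma slice_A_vder z : Cmod z < 1 -> exists A', @vder (lin_NormedModule X X) A z A'.
Proof.
intros Hz; eexists; apply (frechet_n_slice X F x0 slice_holomorphic 1 z).
rewrite (norm_slice X x0 z Hx0); exact Hz.
Qed.

Lemma slice_holo z : Cmod z < 1 -> holo p z.
Proof.
intros Hz; destruct (slice_A_vder z Hz) as [A' HA].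
assert (HB : forall w, Cmod (w - z) < 1 - Cmod z -> is_inverse (A w) (B w)).
{ intros w Hw; apply slice_inverse.
  pose proof (Cmod_triangle (w - z) z) as Q; replace (w - z + z)%C with w in Q by ring; lra. }
assert (Hy : vder (fun w => plus (scal w (g 2 w)) (g 1 w)) z
  (plus (plus (scal (RtoC 1) (g 2 z)) (scal z (g 3 z))) (g 2 z))).
{ apply vder_plus; [|now apply slice_vder].
  apply (vder_scal X (fun w => w)); [apply vder_id|now apply slice_vder]. }
pose proof (vder_inverse_apply X A B z A' (1 - Cmod z) ltac:(lra) HA HB _ _ Hy) as V.
eexists; exact (vder_linear X C_NormedModule _ T z _ (lin_linear T) V).
Qed.

Lemma slice_p_0 : p 0 = RtoC 1.
Proof.
destruct HF as [[_ H] _].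
assert (A0 : forall v, A 0 v = v).
{ intros v; unfold A; replace (scal (RtoC 0) x0) with (zero : X) by module_ring; apply H. }
unfold p; rewrite <- T_x0; f_equal.
destruct (slice_inverse 0) as [_ K]; [rewrite Cmod_0; lra|].
replace (plus (scal (RtoC 0) (g 2 0)) (g 1 0)) with (g 1 0) by module_ring.
rewrite <- slice_A_x0; apply K.
Qed.

(* [conj z / |z| T] is a support functional at [z x0]. *)
Lemma slice_re z : Cmod z < 1 -> 1 / 2 - lambda <= Re (p z).
Proof.
intros Hz; destruct (Ceq_dec z 0) as [-> | Hz0].
{ rewrite slice_p_0; simpl; lra. }
pose proof (proj1 (Cmod_gt_0 _) Hz0) as P.
assert (Pc : RtoC (Cmod z) <> 0) by (intros E; injection E; lra).
destruct HF as [_ [_ H]].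
set (x := scal z x0) in *.
assert (Nx : norm x = Cmod z) by now apply (norm_slice X x0 z Hx0).
set (k := (Cconj z / RtoC (Cmod z))%C).
assert (Kk : Cmod k = 1).
{ unfold k; rewrite Cmod_div, Cmod_conj, Cmod_R, Rabs_pos_eq by (exact Pc || lra); field; lra. }
assert (Ekz : (k * z)%C = RtoC (Cmod z)).
{ unfold k; replace (Cconj z / Cmod z * z)%C with ((z * Cconj z) / Cmod z)%C
    by (field; exact Pc).
  rewrite <- Cmod2_conj, RtoC_pow; simpl; field; exact Pc. }
set (T' := lin_scal X C_NormedModule k T).
assert (ST : support_functional x T').
{ split.
  - change (T' x) with (k * T x)%C; unfold x; rewrite (linear_scal _ (lin_linear T)).
    rewrite norm_slice by exact Hx0.
    change (scal z (T x0)) with (z * T x0)%C; rewrite T_x0, <- Ekz; Cring.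
  - destruct HT as [_ NT]; apply Rle_antisym.
    + apply op_norm_le; intros v Hv; change (Cmod (k * T v) <= 1).
      rewrite Cmod_mult, Kk; pose proof (T_bound v); lra.
    + apply Rle_trans with (norm (T' x0)); [|apply op_norm_ub; lra].
      change (1 <= Cmod (k * T x0)); rewrite T_x0, Cmod_mult, Kk, Cmod_1; lra. }
assert (Hx : x <> zero).
{ intros E; assert (N0 : norm x = 0) by (rewrite E; exact (@norm_zero _ X)); lra. }
specialize (H x Hx ltac:(lra) T' ST).
rewrite Nx in H.
replace (T' _) with (p z) in H; [lra|].
assert (E2 : Dn_diag 2 F x x = scal z (scal z (g 2 z))).
{ pose (J := frechet_n 2 F x : lin X (lin_NormedModule X X)).
  etransitivity; [exact (f_equal (fun N : lin X X => N x) (linear_scal _ (lin_linear J) z x0))|].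
  exact (f_equal (fun v : X => scal z v) (linear_scal _ (lin_linear (lin_fun J x0)) z x0)). }
assert (E1 : D F x x = scal z (g 1 z)) by exact (linear_scal _ (lin_linear (A z)) z x0).
assert (E : inverse (D F x) (plus (Dn_diag 2 F x x) (D F x x))
  = scal z (B z (plus (scal z (g 2 z)) (g 1 z)))).
{ rewrite E2, E1, <- (linear_scal _ (lin_linear (B z))).
  change (inverse (D F x)) with (B z); f_equal; module_ring. }
rewrite E, (linear_scal _ (lin_linear T')), (linear_scal _ (lin_linear T')).
change (p z = (RtoC (/ Cmod z) * (z * (k * p z)))%C).
replace (z * (k * p z))%C with (k * z * p z)%C by ring.
rewrite Ekz, RtoC_inv by lra; field; exact Pc.
Qed.

(** * Expansion of the slice function at the origin *)

Variables a2 a3 a4 : C.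
Hypothesis U2 : u 2 = scal (2 * a2)%C x0.
Hypothesis U3 : u 3 = scal (6 * a3)%C x0.
Hypothesis U4 : u 4 = scal (24 * a4)%C x0.

Lemma slice_u1 : u 1 = x0.
Proof. destruct HF as [[_ H] _]; apply H. Qed.

Let half : C := RtoC (/ 2).
Let sixth : C := RtoC (/ 6).

Lemma half_2 : (half * RtoC 2)%C = RtoC 1.
Proof. unfold half; rewrite <- RtoC_mult; f_equal; field. Qed.

Lemma sixth_3 : (sixth * RtoC 3)%C = half.
Proof. unfold half, sixth; rewrite <- RtoC_mult; f_equal; field. Qed.

(** Differentiability of [g 3] at [0] is the only local input; integrating the remainder twice gives
    the expansions of [g 2] and [g 1], each one order better. *)
Lemma slice_expansion_3 : little_o 1 (fun z => minus (g 3 z) (plus (u 3) (scal z (u 4)))).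
Proof.
pose proof (little_o_vder X (g 3) (g 4 0) (slice_vder 3 0 ltac:(rewrite Cmod_0; lra))) as L.
rewrite !slice_g_0 in L; exact L.
Qed.

Lemma slice_expansion_2 : little_o 2
  (fun z => minus (g 2 z) (plus (u 2) (plus (scal (1 * z ^ 1)%C (u 3)) (scal (half * z ^ 2)%C (u 4))))).
Proof.
apply (little_o_integrate X 1 _ (fun z => minus (g 3 z) (plus (u 3) (scal z (u 4)))) 1); [lra| | |].
- intros z Hz; apply vder_minus; [now apply slice_vder|].
  eapply vder_ext; [reflexivity| |apply vder_plus; [apply vder_const|apply vder_plus]].
  2: apply (vder_monomial X 1 1); simpl; ring.
  2: apply (vder_monomial X half 1); exact half_2.
  module_ring.
- rewrite slice_g_0; module_ring.
- exact slice_expansion_3.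
Qed.

Lemma slice_expansion_1 : little_o 3
  (fun z => minus (g 1 z) (plus (u 1) (plus (scal (1 * z ^ 1)%C (u 2))
    (plus (scal (half * z ^ 2)%C (u 3)) (scal (sixth * z ^ 3)%C (u 4)))))).
Proof.
apply (little_o_integrate X 2 _ (fun z => minus (g 2 z)
  (plus (u 2) (plus (scal (1 * z ^ 1)%C (u 3)) (scal (half * z ^ 2)%C (u 4))))) 1); [lra| | |].
- intros z Hz; apply vder_minus; [now apply slice_vder|].
  eapply vder_ext; [reflexivity| |apply vder_plus; [apply vder_const|apply vder_plus;
    [|apply vder_plus]]].
  2: apply (vder_monomial X 1 1); simpl; ring.
  2: apply (vder_monomial X half 1); exact half_2.
  2: apply (vder_monomial X sixth half); rewrite <- sixth_3; f_equal; simpl; f_equal; ring.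
  module_ring.
- rewrite slice_g_0; module_ring.
- exact slice_expansion_2.
Qed.

(** [s] is the derivative of [z + a2 z^2 + a3 z^3 + a4 z^4] and [sigma] is the derivative of [z s],
    so [p] is to be compared with [sigma / s]. *)
Let s (z : C) : C := (1 + 2 * a2 * z + 3 * a3 * z ^ 2 + 4 * a4 * z ^ 3)%C.
Let sigma (z : C) : C := (1 + 4 * a2 * z + 9 * a3 * z ^ 2 + 16 * a4 * z ^ 3)%C.

Let e1 (z : C) : X := minus (g 1 z) (scal (s z) x0).
Let e2 (z : C) : X := minus (plus (scal z (g 2 z)) (g 1 z)) (scal (sigma z) x0).

Lemma e1_little_o : little_o 3 e1.
Proof.
pose proof slice_expansion_1 as L.
rewrite slice_u1, U2, U3, U4 in L.
intros e He; destruct (L e He) as [d [Hd K]]; exists d; split; [exact Hd|].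
intros z Hz; eapply Rle_trans; [|exact (K z Hz)]; right; f_equal.
assert (E6 : (6 * half)%C = RtoC 3) by (unfold half; rewrite <- RtoC_mult; f_equal; field).
assert (E24 : (24 * sixth)%C = RtoC 4) by (unfold sixth; rewrite <- RtoC_mult; f_equal; field).
unfold e1, s; module_prepare; cbn [length all_below mcoef Nat.eqb]; repeat split; try ring.
rewrite <- E6, <- E24; ring.
Qed.

Lemma e2_little_o : little_o 3 e2.
Proof.
pose proof slice_expansion_2 as L2; rewrite U2, U3, U4 in L2.
pose proof e1_little_o as L1.
intros e He.
destruct (L1 (e / 2)) as [d1 [P1 K1]]; [lra|].
destruct (L2 (e / 2)) as [d2 [P2 K2]]; [lra|].
exists (Rmin d1 d2); split; [now apply Rmin_pos|]; intros z Hz.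
pose proof (Rmin_l d1 d2); pose proof (Rmin_r d1 d2).
specialize (K1 z ltac:(lra)); specialize (K2 z ltac:(lra)).
match type of K2 with norm ?w <= _ => set (w2 := w) in K2 end.
pose proof (norm_sum_le X (e2 z) (scal z w2) (e1 z)) as Q.
assert (E12 : (24 * half)%C = RtoC 12) by (unfold half; rewrite <- RtoC_mult; f_equal; field).
(* The factor [z] raises the remainder of [g 2] from order two to order three. *)
assert (E : e2 z = plus (scal z w2) (e1 z)).
{ unfold e2, e1, w2, s, sigma; module_prepare; cbn [length all_below mcoef Nat.eqb].
  repeat split; try ring.
  replace (16 * a4 * z ^ 3)%C with (RtoC 12 * a4 * z ^ 3 + 4 * a4 * z ^ 3)%C by ring.
  rewrite <- E12; ring. }
specialize (Q E); rewrite norm_scal_C in Q.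
assert (Cmod z * norm w2 <= Cmod z * (e / 2 * Cmod z ^ 2))
  by (apply Rmult_le_compat_l; [apply Cmod_ge_0|exact K2]).
replace (e * Cmod z ^ 3) with (Cmod z * (e / 2 * Cmod z ^ 2) + e / 2 * Cmod z ^ 3)
  by (simpl; field).
lra.
Qed.

(** Near [0] the operators [B z] are uniformly bounded, so applying [T] after [B z] preserves the
    order of an error. *)
Lemma TB_little_o e : little_o 3 e -> lim0 (fun z => T (B z (e z)) / z ^ 3)%C 0.
Proof.
intros H; destruct (slice_A_vder 0) as [A' HA]; [rewrite Cmod_0; lra|].
destruct (inverse_bounded X A B 0 A' 1 ltac:(lra) HA) as [K [d [HK [Hd [_ BK]]]]].
{ intros w Hw; apply slice_inverse; replace w with (w - 0)%C by ring; exact Hw. }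
apply little_o_lim0; revert H.
apply (little_o_dominated X C_NormedModule 3 e _ K d HK Hd); intros z Hz.
apply Rle_trans with (1 := T_bound _), BK; replace (z - 0)%C with z by ring; exact Hz.
Qed.

(** Applying [T] after [B z] to [e1] and [e2] gives two relations containing the unknown
    [T (B z x0)], which is eliminated between them. *)
Lemma slice_s_p z : Cmod z < 1 ->
  (s z * p z = sigma z - sigma z * T (B z (e1 z)) + s z * T (B z (e2 z)))%C.
Proof.
intros Hz; destruct (slice_inverse z Hz) as [_ K].
assert (E1 : T (B z (e1 z)) = (1 - s z * T (B z x0))%C).
{ unfold e1; rewrite (is_linear_minus X X (B z)) by apply lin_linear.
  rewrite <- slice_A_x0, K, (linear_scal _ (lin_linear (B z))).
  rewrite (is_linear_minus X C_NormedModule T), (linear_scal _ (lin_linear T)), T_x0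
    by apply lin_linear.
  reflexivity. }
assert (E2 : T (B z (e2 z)) = (p z - sigma z * T (B z x0))%C).
{ unfold e2; rewrite (is_linear_minus X X (B z)) by apply lin_linear.
  rewrite (linear_scal _ (lin_linear (B z))).
  rewrite (is_linear_minus X C_NormedModule T), (linear_scal _ (lin_linear T))
    by apply lin_linear.
  reflexivity. }
rewrite E1, E2; ring.
Qed.

(** [b1], [b2], [b3] are the Taylor coefficients of [sigma / s]. *)
Let b1 : C := (2 * a2)%C.
Let b2 : C := (6 * a3 - 4 * a2 ^ 2)%C.
Let b3 : C := (12 * a4 - 18 * a2 * a3 + 8 * a2 ^ 3)%C.

Lemma slice_p_expansion :
  lim0 (fun z => (p z - (1 + b1 * z + b2 * z ^ 2 + b3 * z ^ 3)) / z ^ 3)%C 0.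
Proof.
assert (Hs : holo s 0) by (unfold s; holo_tac).
assert (Hsig : holo sigma 0) by (unfold sigma; holo_tac).
assert (S0 : s 0 = RtoC 1) by (unfold s; simpl; ring).
assert (S1 : RtoC 1 <> 0) by (intros E; injection E; lra).
(* [- z ^ 4 * w z] is what remains of [sigma - s (1 + b1 z + b2 z^2 + b3 z^3)] once the terms up to
   degree three cancel. *)
set (w := fun z : C => ((2 * a2 * b3 + 3 * a3 * b2 + 4 * a4 * b1)
  + (3 * a3 * b3 + 4 * a4 * b2) * z + 4 * a4 * b3 * z ^ 2)%C).
set (h := fun z : C => ((-1 * (sigma z * (T (B z (e1 z)) / z ^ 3))
  + s z * (T (B z (e2 z)) / z ^ 3) + -1 * (z * w z)) * / s z)%C).
assert (L : lim0 h 0).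
{ replace (RtoC 0) with ((-1 * (sigma 0 * 0) + s 0 * 0 + -1 * (0 * w 0)) * / s 0)%C
    by (rewrite S0; field; exact S1).
  apply lim0_mult.
  - apply lim0_plus; [apply lim0_plus|].
    + apply lim0_mult; [apply lim0_const|]; apply lim0_mult; [now apply lim0_holo|].
      apply TB_little_o, e1_little_o.
    + apply lim0_mult; [now apply lim0_holo|]; apply TB_little_o, e2_little_o.
    + apply lim0_mult; [apply lim0_const|].
      apply (lim0_holo (fun z => z * w z)%C); unfold w; holo_tac.
  - apply (lim0_holo (fun z => / s z)%C); apply holo_inv; [exact Hs|now rewrite S0]. }
intros e He.
destruct (L e He) as [d1 [P1 K1]].
destruct (holo_continuous s 0 Hs 1) as [d2 [P2 K2]]; [lra|].
exists (Rmin 1 (Rmin d1 d2)); split; [repeat apply Rmin_pos; lra|]; intros z [Z1 Z2].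
pose proof (Rmin_l 1 (Rmin d1 d2)); pose proof (Rmin_r 1 (Rmin d1 d2)).
pose proof (Rmin_l d1 d2); pose proof (Rmin_r d1 d2).
specialize (K1 z ltac:(lra)); specialize (K2 z).
replace (z - 0)%C with z in K2 by ring; specialize (K2 ltac:(lra)); rewrite S0 in K2.
assert (Hz : z <> 0) by (apply Cmod_gt_0; lra).
assert (Sz : s z <> 0).
{ intros E; rewrite E in K2; replace (0 - 1)%C with (- (1))%C in K2 by ring.
  rewrite Cmod_m1 in K2; lra. }
pose proof (slice_s_p z ltac:(lra)) as SP.
replace ((p z - (1 + b1 * z + b2 * z ^ 2 + b3 * z ^ 3)) / z ^ 3)%C with (h z); [exact K1|].
replace (p z) with ((sigma z - sigma z * T (B z (e1 z)) + s z * T (B z (e2 z))) / s z)%C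
  by (rewrite <- SP; field; exact Sz).
unfold h, w; generalize (T (B z (e1 z))) (T (B z (e2 z))); intros t1 t2.
transitivity (((sigma z - s z * (1 + b1 * z + b2 * z ^ 2 + b3 * z ^ 3))
  - sigma z * t1 + s z * t2) / s z / z ^ 3)%C.
- replace (sigma z - s z * (1 + b1 * z + b2 * z ^ 2 + b3 * z ^ 3))%C
    with (- (z ^ 4 * ((2 * a2 * b3 + 3 * a3 * b2 + 4 * a4 * b1)
      + (3 * a3 * b3 + 4 * a4 * b2) * z + 4 * a4 * b3 * z ^ 2)))%C
    by (unfold sigma, s, b1, b2, b3; ring).
  field; split; assumption.
- field; split; assumption.
Qed.

Let c : R := 1 / 2 + lambda.

Lemma slice_caratheodory :
  let c1 := (b1 / c)%C in let c2 := (b2 / c)%C in let c3 := (b3 / c)%C in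
  Cmod c1 <= 2 /\ Cmod c2 <= 2 /\ Cmod c3 <= 2 /\
  Cmod (c2 - c1 * c1) <= 2 /\ Cmod (c3 - c1 * c2) <= 2.
Proof.
intros c1 c2 c3.
assert (C0 : RtoC c <> 0) by (intros E; injection E; unfold c; lra).
set (q := fun z => ((p z - RtoC (1 / 2 - lambda)) / c)%C).
assert (Q1 : forall z, Cmod z < 1 -> holo q z).
{ intros z Hz; pose proof (slice_holo z Hz); unfold q; holo_tac; exact C0. }
assert (Q2 : forall z, Cmod z < 1 -> 0 <= Re (q z)).
{ intros z Hz; pose proof (slice_re z Hz) as Q; unfold q, Cdiv.
  rewrite <- RtoC_inv, re_scal_r by (unfold c; lra).
  apply Rmult_le_pos; [|apply Rlt_le, Rinv_0_lt_compat; unfold c; lra].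
  change (0 <= Re (p z) - (1 / 2 - lambda)); lra. }
assert (Q3 : lim0 (fun z => (q z - (1 + c1 * z + c2 * z ^ 2 + c3 * z ^ 3)) / z ^ 3)%C 0).
{ apply (lim0_ext (fun z => (p z - (1 + b1 * z + b2 * z ^ 2 + b3 * z ^ 3)) / z ^ 3 * / c)%C).
  - intros z Hz; unfold q, c1, c2, c3.
    replace (RtoC (1 / 2 - lambda)) with (1 - c)%C
      by (unfold c; rewrite <- RtoC_minus; f_equal; field).
    field; split; assumption.
  - replace (RtoC 0) with (0 * / c)%C by ring.
    apply lim0_mult; [apply slice_p_expansion|apply lim0_const]. }
repeat split.
- exact (caratheodory_c1 q c1 c2 c3 Q1 Q2 Q3).
- exact (caratheodory_c2 q c1 c2 c3 Q1 Q2 Q3).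
- exact (caratheodory_c3 q c1 c2 c3 Q1 Q2 Q3).
- exact (livingston_c2 q c1 c2 c3 Q1 Q2 Q3).
- exact (livingston_c3 q c1 c2 c3 Q1 Q2 Q3).
Qed.

End Slice.

(** * Bounds for the Toeplitz determinants *)

Lemma Cmod_mult_le a b x y : Cmod a <= x -> Cmod b <= y -> Cmod (a * b) <= x * y.
Proof. intros H K; rewrite Cmod_mult; apply Rmult_le_compat; auto using Cmod_ge_0. Qed.

Lemma Cmod_plus_le a b x y : Cmod a <= x -> Cmod b <= y -> Cmod (a + b) <= x + y.
Proof. intros H K; apply Rle_trans with (1 := Cmod_triangle a b); lra. Qed.

Lemma Cmod_sub_le a b x y : Cmod a <= x -> Cmod b <= y -> Cmod (a - b) <= x + y.
Proof. intros H K; apply Rle_trans with (1 := Cmod_minus_le a b); lra. Qed.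

Lemma Cmod_RtoC_le (r : R) : 0 <= r -> Cmod r <= r.
Proof. intros H; rewrite Cmod_R, Rabs_pos_eq; lra. Qed.

Section Coefficients.

Variables (c : R) (c1 c2 c3 : C).
Hypothesis Hc : 1 <= c <= 3 / 2.
Hypothesis H1 : Cmod c1 <= 2.
Hypothesis H2 : Cmod c2 <= 2.
Hypothesis H3 : Cmod c3 <= 2.
Hypothesis L2 : Cmod (c2 - c1 * c1) <= 2.
Hypothesis L3 : Cmod (c3 - c1 * c2) <= 2.

(** These formulas solve [b_n = c c_n] for the coefficients of [F]. *)
Let a2 : C := (RtoC (c / 2) * c1)%C.
Let a3 : C := (RtoC (c / 6) * (c2 + RtoC c * (c1 * c1)))%C.
Let a4 : C := (RtoC (c / 12) *
  (c3 + RtoC (3 * c / 2) * (c1 * c2) + RtoC (c * c / 2) * (c1 * (c1 * c1))))%C.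

Lemma a2_bound : Cmod a2 <= c.
Proof.
apply Rle_trans with (c / 2 * 2); [|right; field].
apply Cmod_mult_le; [apply Cmod_RtoC_le; lra|exact H1].
Qed.

Lemma a3_bound : Cmod a3 <= c * (1 + 2 * c) / 3.
Proof.
replace (c * (1 + 2 * c) / 3) with (c / 6 * (2 + c * (2 * 2))) by field.
apply Cmod_mult_le; [apply Cmod_RtoC_le; lra|].
apply Cmod_plus_le; [exact H2|].
apply Cmod_mult_le; [apply Cmod_RtoC_le; lra|now apply Cmod_mult_le].
Qed.

Lemma a4_bound : Cmod a4 <= c * (1 + c) * (1 + 2 * c) / 6.
Proof.
replace (c * (1 + c) * (1 + 2 * c) / 6)
  with (c / 12 * (2 + 3 * c / 2 * (2 * 2) + c * c / 2 * (2 * (2 * 2)))) by field.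
apply Cmod_mult_le; [apply Cmod_RtoC_le; lra|].
apply Cmod_plus_le; [apply Cmod_plus_le; [exact H3|]|].
- apply Cmod_mult_le; [apply Cmod_RtoC_le; lra|now apply Cmod_mult_le].
- apply Cmod_mult_le; [apply Cmod_RtoC_le; nra|].
  apply Cmod_mult_le; [exact H1|now apply Cmod_mult_le].
Qed.

(** Up to [c / 6] this is [c_2 - 2 c c_1^2]. Moving one [c_1^2] next to [c_2] leaves two terms that
    for [c_n = 2 i^n] equal [2] and [4 (2 c - 1)], both positive, so the triangle inequality loses
    nothing there. *)
Lemma fekete_szego_bound : Cmod (a3 - 2 * (a2 * a2)) <= c * (4 * c - 1) / 3.
Proof.
replace (a3 - 2 * (a2 * a2))%C
  with (RtoC (c / 6) * ((c2 - c1 * c1) - RtoC (2 * c - 1) * (c1 * c1)))%C.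
- replace (c * (4 * c - 1) / 3) with (c / 6 * (2 + (2 * c - 1) * (2 * 2))) by field.
  apply Cmod_mult_le; [apply Cmod_RtoC_le; lra|].
  apply Cmod_sub_le; [exact L2|].
  apply Cmod_mult_le; [apply Cmod_RtoC_le; lra|now apply Cmod_mult_le].
- unfold a2, a3; destruct c1, c2; apply injective_projections; simpl; field.
Qed.

(* Writing [c3 = c1 c2 + (c3 - c1 c2)] makes all the terms extremal simultaneously. *)
Lemma hankel_type_bound :
  Cmod (2 * (a3 * a3) - a2 * a4) <= c * c * (1 + 2 * c) * (1 + 5 * c) / 18.
Proof.
replace (2 * (a3 * a3) - a2 * a4)%C with (RtoC (c * c / 72) *
  (4 * (c2 * c2) + RtoC (7 * c / 2 - 3) * (c1 * c1 * c2)
   + RtoC (5 * c * c / 2) * (c1 * c1 * (c1 * c1)) - 3 * (c1 * (c3 - c1 * c2))))%C.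
- replace (c * c * (1 + 2 * c) * (1 + 5 * c) / 18) with (c * c / 72 *
    (4 * (2 * 2) + (7 * c / 2 - 3) * (2 * 2 * 2) + 5 * c * c / 2 * (2 * 2 * (2 * 2))
     + 3 * (2 * 2))) by field.
  assert (K : Cmod (c1 * c1) <= 2 * 2) by now apply Cmod_mult_le.
  apply Cmod_mult_le; [apply Cmod_RtoC_le; nra|].
  (* The coefficient [7 c / 2 - 3] is positive because [c >= 1]. *)
  apply Cmod_sub_le; [apply Cmod_plus_le; [apply Cmod_plus_le|]|];
    (apply Cmod_mult_le; [apply Cmod_RtoC_le; nra|]); now apply Cmod_mult_le.
- unfold a2, a3, a4; destruct c1, c2, c3; apply injective_projections; simpl; field.
Qed.

Lemma toeplitz3_1_bound :
  Cmod ((1 - a3) * (1 + (a3 - 2 * (a2 * a2)))) <=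
    (1 + c * (1 + 2 * c) / 3) * (1 + c * (4 * c - 1) / 3).
Proof.
apply Cmod_mult_le.
- apply Cmod_sub_le; [apply Cmod_RtoC_le; lra|exact a3_bound].
- apply Cmod_plus_le; [apply Cmod_RtoC_le; lra|exact fekete_szego_bound].
Qed.

Lemma toeplitz3_2_bound :
  Cmod ((a2 - a4) * (a2 * a2 - (2 * (a3 * a3) - a2 * a4))) <=
    (c + c * (1 + c) * (1 + 2 * c) / 6) * (c * c + c * c * (1 + 2 * c) * (1 + 5 * c) / 18).
Proof.
pose proof a2_bound.
apply Cmod_mult_le; [apply Cmod_sub_le; [assumption|exact a4_bound]|].
apply Cmod_sub_le; [now apply Cmod_mult_le|exact hankel_type_bound].
Qed.

End Coefficients.

Lemma scalar_coefficient (X : CompleteNormedModule C_AbsRing) (F : X -> X) (x0 : X)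
    (T : lin X C_NormedModule) (n : nat) (a : C) :
  T x0 = RtoC 1 ->
  scal (RtoC (/ INR (fact n))) (Dn_diag n F zero x0) = scal a x0 ->
  coeff F x0 T n = a /\ Dn_diag n F zero x0 = scal (RtoC (INR (fact n)) * a)%C x0.
Proof.
intros HT E; split.
- apply (f_equal (fun v => T v)) in E.
  rewrite !(linear_scal _ (lin_linear T)), HT in E.
  transitivity (a * RtoC 1)%C; [exact E|ring].
- transitivity (scal (RtoC (INR (fact n))) (scal a x0)); [|module_ring].
  rewrite <- E.
  assert (N : RtoC (INR (fact n)) <> 0).
  { intros H; injection H; apply INR_fact_neq_0. }
  rewrite RtoC_inv by apply INR_fact_neq_0; module_field; exact N.
Qed.

Lemma toeplitz_upper_bounds (X : CompleteNormedModule C_AbsRing) (lambda : R) (F : X -> X)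
    (x0 : X) (T : lin X C_NormedModule) :
  1 / 2 <= lambda <= 1 -> scalar_type_coefficients F -> class_F lambda F ->
  norm x0 = 1 -> support_functional x0 T ->
  Cmod (toeplitz3_1 F x0 T) <=
    (4 + 3 * lambda + 2 * lambda ^ 2) * (7 + 6 * lambda + 8 * lambda ^ 2) / 18 /\
  Cmod (toeplitz3_2 F x0 T) <=
    1 / 864 * (1 + 2 * lambda) ^ 3 * (9 + 5 * lambda + 2 * lambda ^ 2)
      * (25 + 17 * lambda + 10 * lambda ^ 2).
Proof.
intros Hl HS HF Hx HT.
pose proof (T_x0 X x0 T Hx HT) as T1.
destruct (HS 1%nat ltac:(lia)) as [h2 [_ E2]]; destruct (HS 2%nat ltac:(lia)) as [h3 [_ E3]];
  destruct (HS 3%nat ltac:(lia)) as [h4 [_ E4]].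
destruct (scalar_coefficient X F x0 T 2 (h2 x0) T1 (E2 x0)) as [A2 U2].
destruct (scalar_coefficient X F x0 T 3 (h3 x0) T1 (E3 x0)) as [A3 U3].
destruct (scalar_coefficient X F x0 T 4 (h4 x0) T1 (E4 x0)) as [A4 U4].
set (a2 := h2 x0) in *; set (a3 := h3 x0) in *; set (a4 := h4 x0) in *.
replace (INR (fact 2)) with 2 in U2 by (simpl; ring).
replace (INR (fact 3)) with 6 in U3 by (simpl; ring).
replace (INR (fact 4)) with 24 in U4 by (simpl; ring).
set (c := 1 / 2 + lambda).
assert (C0 : c <> 0) by (unfold c; lra).
destruct (slice_caratheodory X F x0 T lambda Hl HF Hx HT a2 a3 a4 U2 U3 U4)
  as [B1 [B2 [B3 [B4 B5]]]].
fold c in B1, B2, B3, B4, B5.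
set (c1 := (2 * a2 / c)%C) in *; set (c2 := ((6 * a3 - 4 * a2 ^ 2) / c)%C) in *.
set (c3 := ((12 * a4 - 18 * a2 * a3 + 8 * a2 ^ 3) / c)%C) in *.
assert (Hc : 1 <= c <= 3 / 2) by (unfold c; lra).
assert (N0 : RtoC c <> 0) by (intros E; injection E; lra).
assert (V2 : (RtoC (c / 2) * c1)%C = a2).
{ unfold c1; rewrite RtoC_div by lra; field; exact N0. }
assert (V3 : (RtoC (c / 6) * (c2 + RtoC c * (c1 * c1)))%C = a3).
{ unfold c1, c2; rewrite RtoC_div by lra; simpl; field; exact N0. }
assert (V4 : (RtoC (c / 12) * (c3 + RtoC (3 * c / 2) * (c1 * c2)
  + RtoC (c * c / 2) * (c1 * (c1 * c1))))%C = a4).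
{ unfold c1, c2, c3; rewrite !RtoC_div, !RtoC_mult by lra; simpl; field; exact N0. }
pose proof (toeplitz3_1_bound c c1 c2 c3 Hc B1 B2 B4 B5) as D1.
pose proof (toeplitz3_2_bound c c1 c2 c3 Hc B1 B2 B3 B4 B5) as D2.
rewrite V2, V3 in D1; rewrite V2, V3, V4 in D2.
unfold toeplitz3_1, toeplitz3_2, det3; rewrite A2, A3, A4.
split.
- replace ((4 + 3 * lambda + 2 * lambda ^ 2) * (7 + 6 * lambda + 8 * lambda ^ 2) / 18)
    with ((1 + c * (1 + 2 * c) / 3) * (1 + c * (4 * c - 1) / 3)) by (unfold c; field).
  eapply Rle_trans; [right|exact D1]; f_equal; ring.
- replace (1 / 864 * (1 + 2 * lambda) ^ 3 * (9 + 5 * lambda + 2 * lambda ^ 2)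
      * (25 + 17 * lambda + 10 * lambda ^ 2))
    with ((c + c * (1 + c) * (1 + 2 * c) / 6)
      * (c * c + c * c * (1 + 2 * c) * (1 + 5 * c) / 18)) by (unfold c; field).
  eapply Rle_trans; [right|exact D2]; f_equal; ring.
Qed.

(** * Complex powers of [1 - z] *)

(** The principal logarithm on the right half-plane, where the arctangent is the argument; [1 - z]
    lies there for [|z| < 1]. *)
Definition clog (w : C) : C := (ln (Cmod w), atan (Im w / Re w)).

Lemma Cmod_polar_form (x y : R) : 0 < x -> Cmod (x, y) = x * sqrt (1 + (y / x) ^ 2).
Proof.
intros Hx; unfold Cmod; simpl fst; simpl snd.
replace (x ^ 2 + y ^ 2) with (x ^ 2 * (1 + (y / x) ^ 2)) by (field; lra).
rewrite sqrt_mult_alt by nra; f_equal; apply sqrt_pow2; lra.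
Qed.

Lemma cexp_clog (w : C) : 0 < Re w -> cexp (clog w) = w.
Proof.
destruct w as [x y]; simpl; intros Hx.
assert (P : 0 < Cmod (x, y)).
{ apply Cmod_gt_0; intros E; injection E; lra. }
unfold cexp, clog, polar; simpl Re; simpl Im.
rewrite exp_ln, cos_atan, sin_atan, Cmod_polar_form by assumption.
assert (S : 0 < sqrt (1 + (y / x) ^ 2)) by (apply sqrt_lt_R0; nra).
replace (1 + (y / x)²) with (1 + (y / x) ^ 2) by (unfold Rsqr; ring).
generalize dependent (sqrt (1 + (y / x) ^ 2)); intros q Hq.
apply injective_projections; simpl; field; lra.
Qed.

Lemma clog_continuous (w : C) e : 0 < Re w -> 0 < e ->
  exists d, 0 < d /\ forall v, Cmod (v - w) < d -> Cmod (clog v - clog w) < e.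
Proof.
intros Hw He.
assert (C2 : continuous (fun v : R * R => atan (snd v / fst v)) w).
{ apply (continuous_comp (fun v : R * R => snd v / fst v) atan).
  - apply (continuous_mult (fun v : R * R => snd v) (fun v : R * R => / fst v)).
    + apply continuous_snd.
    + apply (continuous_comp (fun v : R * R => fst v) Rinv); [apply continuous_fst|].
      apply continuous_Rinv; change (Re w <> 0); lra.
  - apply continuous_atan. }
destruct (C2 _ (locally_ball (atan (snd w / fst w)) (mkposreal (e / 2) ltac:(lra)))) as [d2 K2].
assert (P : 0 < Cmod w) by (pose proof (re_le_Cmod w); pose proof (Rle_abs (Re w)); lra).
destruct (ln_continue _ P (e / 2)) as [d1 [P1 K1]]; [lra|].
exists (Rmin (Rmin d1 d2) (Cmod w)); split.
{ repeat apply Rmin_pos; try apply cond_pos; assumption. }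
intros v Hv.
pose proof (Rmin_l (Rmin d1 d2) (Cmod w)); pose proof (Rmin_r (Rmin d1 d2) (Cmod w)).
pose proof (Rmin_l d1 d2); pose proof (Rmin_r d1 d2).
apply Rle_lt_trans with (1 := Cmod_le_Re_Im _).
assert (T1 : Rabs (Cmod v - Cmod w) <= Cmod (v - w)).
{ apply Rabs_le; split.
  - pose proof (Cmod_triangle v (w - v)) as T; replace (v + (w - v))%C with w in T by ring.
    rewrite (Cmod_minus_sym w v) in T; lra.
  - pose proof (Cmod_triangle w (v - w)) as T; replace (w + (v - w))%C with v in T by ring.
    lra. }
assert (Pv : 0 < Cmod v).
{ pose proof (Rle_abs (- (Cmod v - Cmod w))) as Q; rewrite Rabs_Ropp in Q; lra. }
assert (A1 : Rabs (Re (clog v - clog w)) < e / 2).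
{ destruct (Req_dec (Cmod v) (Cmod w)) as [E|E].
  - change (Rabs (ln (Cmod v) - ln (Cmod w)) < e / 2).
    rewrite E, Rminus_diag, Rabs_R0; lra.
  - apply (K1 (Cmod v)); split; [split; [exact Pv|intros E'; now apply E]|].
    change (Rabs (Cmod v - Cmod w) < d1); lra. }
assert (A2 : Rabs (Im (clog v - clog w)) < e / 2).
{ apply (K2 v); split.
  - change (Rabs (Re (v - w)) < d2); pose proof (re_le_Cmod (v - w)); lra.
  - change (Rabs (Im (v - w)) < d2); pose proof (im_le_Cmod (v - w)); lra. }
lra.
Qed.

Lemma Re_pos_near (w : C) v : 0 < Re w -> Cmod (v - w) < Re w -> 0 < Re v.
Proof.
intros Hw H; pose proof (re_le_Cmod (v - w)) as Q.
pose proof (Rle_abs (- Re (v - w))) as Q'; rewrite Rabs_Ropp in Q'.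
assert (E : Re (v - w) = Re v - Re w) by reflexivity; lra.
Qed.

(* Inverse function argument: [v - w = w (exp h - 1)] with [h = log v - log w]. *)
Lemma vder_clog (w : C) : 0 < Re w -> @vder C_NormedModule clog w (/ w)%C.
Proof.
intros Hw; apply holo_intro; intros e He.
assert (Hw0 : w <> 0) by (intros E; rewrite E in Hw; simpl in Hw; lra).
pose proof (proj1 (Cmod_gt_0 _) Hw0) as P.
set (eta := Rmin (/ 2) (e * Cmod w / 2)).
assert (Eta : 0 < eta).
{ apply Rmin_pos; [lra|]; apply Rdiv_lt_0_compat; [now apply Rmult_lt_0_compat|lra]. }
pose proof (Rmin_l (/ 2) (e * Cmod w / 2)) as Em1; fold eta in Em1.
pose proof (Rmin_r (/ 2) (e * Cmod w / 2)) as Em2; fold eta in Em2.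
destruct (cexp_near_0 eta Eta) as [r [Hr K]].
destruct (clog_continuous w r Hw Hr) as [d [Hd L]].
exists (Rmin d (Re w)); split; [now apply Rmin_pos|]; intros v Hv.
pose proof (Rmin_l d (Re w)); pose proof (Rmin_r d (Re w)).
assert (Hv0 : 0 < Re v) by (apply (Re_pos_near w); lra).
specialize (L v ltac:(lra)); set (h := (clog v - clog w)%C) in *.
specialize (K h L).
assert (Ev : (v - w)%C = (w * (cexp h - 1))%C).
{ rewrite <- (cexp_clog v Hv0) at 1.
  replace (clog v) with (clog w + h)%C by (unfold h; ring).
  rewrite cexp_plus, cexp_clog by exact Hw; ring. }
assert (Ew : ((v - w) * / w)%C = (h + (cexp h - 1 - h))%C)
  by (rewrite Ev; field; exact Hw0).
rewrite Ew.
replace (h - (h + (cexp h - 1 - h)))%C with (- (cexp h - 1 - h))%C by ring.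
rewrite Cmod_opp.
assert (Q : Cmod ((v - w) * / w) = Cmod (v - w) / Cmod w)
  by (rewrite Cmod_mult, Cmod_inv by exact Hw0; reflexivity).
pose proof (Cmod_ge_0 h) as Hh.
assert (Q1 : Cmod h / 2 <= Cmod (v - w) / Cmod w).
{ rewrite <- Q, Ew.
  pose proof (Cmod_triangle (h + (cexp h - 1 - h)) (- (cexp h - 1 - h))) as T.
  replace (h + (cexp h - 1 - h) + - (cexp h - 1 - h))%C with h in T by ring.
  rewrite Cmod_opp in T.
  assert (eta * Cmod h <= / 2 * Cmod h) by (apply Rmult_le_compat_r; lra); lra. }
apply Rle_trans with (1 := K).
apply Rle_trans with (e * Cmod w / 2 * Cmod h); [apply Rmult_le_compat_r; lra|].
replace (e * Cmod (v - w)) with (e * Cmod w * (Cmod (v - w) / Cmod w)) by (field; lra).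
replace (e * Cmod w / 2 * Cmod h) with (e * Cmod w * (Cmod h / 2)) by field.
apply Rmult_le_compat_l; [|exact Q1]; apply Rmult_le_pos; lra.
Qed.

(** The principal branch of [(1 - z)^(-beta)]. *)
Definition neg_power (beta : R) (z : C) : C := cexp (RtoC (- beta) * clog (1 - z)).

Lemma Re_one_minus_pos z : Cmod z < 1 -> 0 < Re (1 - z).
Proof.
intros H; pose proof (re_le_Cmod z); pose proof (Rle_abs (Re z)).
change (0 < 1 - Re z); lra.
Qed.

Lemma one_minus_nz z : Cmod z < 1 -> (1 - z)%C <> 0.
Proof. intros H E; pose proof (Re_one_minus_pos z H) as Q; rewrite E in Q; simpl in Q; lra. Qed.

Lemma neg_power_shift beta z : Cmod z < 1 ->
  neg_power beta z = (neg_power (beta + 1) z * (1 - z))%C.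
Proof.
intros H; unfold neg_power.
rewrite <- (cexp_clog (1 - z)) at 3 by now apply Re_one_minus_pos.
rewrite <- cexp_plus; f_equal; rewrite !RtoC_opp, RtoC_plus; ring.
Qed.

Lemma neg_power_vder beta z : Cmod z < 1 ->
  @vder C_NormedModule (neg_power beta) z (RtoC beta * neg_power (beta + 1) z)%C.
Proof.
intros Hz; pose proof (Re_one_minus_pos z Hz) as P; pose proof (one_minus_nz z Hz) as N.
assert (D1 : @vder C_NormedModule (fun z => 1 - z)%C z (- (1))%C).
{ pose proof (vder_minus C_NormedModule _ _ z _ _ (vder_const C_NormedModule (RtoC 1) z) (vder_id z)) as V.
  revert V; apply vder_ext; [reflexivity|]; change (0 - 1 = - (1))%C; ring. }
pose proof (vder_comp C_NormedModule _ clog z _ _ D1 (vder_clog _ P)) as D2.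
pose proof (vder_scal_r C_NormedModule _ z _ (RtoC (- beta)) D2) as D3.
pose proof (vder_comp C_NormedModule _ cexp z _ _ D3 (vder_cexp _)) as D4.
revert D4; apply vder_ext; [reflexivity|].
change (RtoC (- beta) * (- (1) * / (1 - z)) * neg_power beta z
  = RtoC beta * neg_power (beta + 1) z)%C.
rewrite (neg_power_shift beta z Hz), RtoC_opp; field; exact N.
Qed.

Lemma neg_power_0 beta : neg_power beta 0 = RtoC 1.
Proof.
unfold neg_power, clog; replace (1 - 0)%C with (RtoC 1) by ring.
rewrite Cmod_1, ln_1; simpl.
replace (0 / 1) with 0 by field; rewrite atan_0.
replace (RtoC (- beta) * (0, 0))%C with (RtoC 0) by (apply injective_projections; simpl; ring).
unfold cexp, polar; simpl; rewrite exp_0, cos_0, sin_0.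
apply injective_projections; simpl; ring.
Qed.

Lemma neg_power_nz beta z : neg_power beta z <> 0.
Proof. apply Cmod_gt_0; unfold neg_power; rewrite Cmod_cexp; apply exp_pos. Qed.

Lemma cos_lt_1 t : t <> 0 -> - PI < t < PI -> cos t < 1.
Proof.
intros T0 Ht; rewrite <- cos_0.
destruct (Rle_lt_dec 0 t) as [L|L].
- apply cos_decreasing_1; lra.
- rewrite <- (cos_neg t); apply cos_decreasing_1; lra.
Qed.

(** Since [|arg (1 - z)| < PI / 2] and [beta <= 2], the angle of the power stays in [(- PI, PI)];
    the value [1] therefore forces the logarithm to vanish. *)
Lemma neg_power_eq_1 beta z : 0 < beta <= 2 -> Cmod z < 1 -> neg_power beta z = RtoC 1 -> z = 0.
Proof.
intros Hb Hz E; pose proof (Re_one_minus_pos z Hz) as P.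
set (L := clog (1 - z)).
assert (B : - PI / 2 < Im L < PI / 2) by apply atan_bound.
assert (E1 : exp (- beta * Re L) = 1).
{ rewrite <- Cmod_1, <- E; unfold neg_power; rewrite Cmod_cexp; fold L.
  now rewrite re_scal_l. }
assert (R0 : Re L = 0).
{ rewrite <- exp_0 in E1; apply exp_inv in E1; nra. }
assert (E2 : cos (- beta * Im L) = 1).
{ assert (E3 : exp (Re (RtoC (- beta) * L)) * cos (Im (RtoC (- beta) * L)) = 1)
    by exact (f_equal Re E).
  rewrite re_scal_l, im_scal_l, R0, Rmult_0_r, exp_0, Rmult_1_l in E3; exact E3. }
assert (I0 : Im L = 0).
{ destruct (Req_dec (Im L) 0) as [H|H]; [exact H|exfalso].
  assert (N : - beta * Im L <> 0) by (apply Rmult_integral_contrapositive; lra).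
  pose proof (cos_lt_1 _ N); assert (- PI < - beta * Im L < PI) by nra; lra. }
assert (L0 : L = RtoC 0) by (apply injective_projections; simpl; assumption).
pose proof (cexp_clog _ P) as Q; fold L in Q; rewrite L0 in Q.
assert (C0 : cexp 0 = RtoC 1).
{ unfold cexp, polar; simpl; rewrite exp_0, cos_0, sin_0.
  apply injective_projections; simpl; ring. }
replace z with (1 - (1 - z))%C by ring; rewrite <- Q, C0; ring.
Qed.

(** * The scalar factor of the extremal map *)

Section Extremal.

Variable alpha : R.
Hypothesis Ha : 2 <= alpha <= 3.

Definition primitive (z : C) : C := (RtoC (/ (alpha - 1)) * (neg_power (alpha - 1) z - 1))%C.

(** The removable singularity at [0] is filled with the derivative of [primitive] there. *)
Definition quotient (z : C) : C :=
  if Ceq_dec z 0 then RtoC 1 else (primitive z / z)%C.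

Lemma primitive_vder z : Cmod z < 1 -> @vder C_NormedModule primitive z (neg_power alpha z).
Proof.
intros Hz; pose proof (neg_power_vder (alpha - 1) z Hz) as D.
pose proof (vder_minus C_NormedModule _ _ z _ _ D (vder_const C_NormedModule (RtoC 1) z)) as D1.
pose proof (vder_scal_r C_NormedModule _ z _ (RtoC (/ (alpha - 1))) D1) as D2.
revert D2; apply vder_ext; [reflexivity|].
change (RtoC (/ (alpha - 1)) * (RtoC (alpha - 1) * neg_power (alpha - 1 + 1) z - 0)
  = neg_power alpha z)%C.
replace (alpha - 1 + 1) with alpha by ring.
rewrite RtoC_inv by lra; field; intros E; injection E; lra.
Qed.

Lemma primitive_0 : primitive 0 = RtoC 0.
Proof. unfold primitive; rewrite neg_power_0; ring. Qed.

Lemma quotient_mult z : (z * quotient z)%C = primitive z.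
Proof.
unfold quotient; destruct (Ceq_dec z 0) as [-> |H].
- rewrite primitive_0; ring.
- field; exact H.
Qed.

Lemma quotient_0 : quotient 0 = RtoC 1.
Proof. unfold quotient; destruct (Ceq_dec 0 0); [reflexivity|contradiction]. Qed.

(** A zero would be a nonzero solution of [(1 - z)^(1 - alpha) = 1], which [0 < alpha - 1 <= 2]
    excludes. The extremal map divides by this factor when its derivative is inverted. *)
Lemma quotient_nz z : Cmod z < 1 -> quotient z <> 0.
Proof.
intros Hz E; unfold quotient in E; destruct (Ceq_dec z 0) as [H|H]; [injection E; lra|].
apply H, (neg_power_eq_1 (alpha - 1)); [lra|exact Hz|].
assert (Ep : primitive z = RtoC 0).
{ replace (primitive z) with (primitive z / z * z)%C by (field; exact H); rewrite E; ring. }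
unfold primitive in Ep.
assert (N : RtoC (/ (alpha - 1)) <> 0).
{ intros Q; injection Q; intros Q'; apply (Rinv_neq_0_compat (alpha - 1)); lra. }
replace (neg_power (alpha - 1) z)
  with (/ RtoC (/ (alpha - 1)) * (RtoC (/ (alpha - 1)) * (neg_power (alpha - 1) z - 1)) + 1)%C
  by (field; exact N).
rewrite Ep; ring.
Qed.

(** The derivative at [0] is the second Taylor coefficient [alpha / 2] of [primitive], read off from
    its second order expansion divided by [z]. *)
Lemma quotient_vder_0 : holo quotient 0.
Proof.
set (b := RtoC (alpha / 2)).
assert (L1 : @little_o C_NormedModule 1 (fun z => (neg_power alpha z - (1 + z * RtoC alpha))%C)).
{ pose proof (little_o_vder C_NormedModule _ _ (neg_power_vder alpha 0 ltac:(rewrite Cmod_0; lra))) as L.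
  rewrite !neg_power_0 in L.
  intros e He; destruct (L e He) as [d [Hd K]]; exists d; split; [exact Hd|].
  intros z Hz; eapply Rle_trans; [right|exact (K z Hz)].
  f_equal; change (neg_power alpha z - (1 + z * alpha)
    = neg_power alpha z - (1 + z * (alpha * 1)))%C; ring. }
assert (L2 : @little_o C_NormedModule 2 (fun z => (primitive z - (1 * z ^ 1 + b * z ^ 2))%C)).
{ apply (little_o_integrate C_NormedModule 1 _
    (fun z => (neg_power alpha z - (1 + z * RtoC alpha))%C) 1); [lra| | |exact L1].
  - intros z Hz.
    pose proof (vder_monomial C_NormedModule 1 1 (RtoC 1) 0 z ltac:(simpl; ring)) as M1.
    pose proof (vder_monomial C_NormedModule b alpha (RtoC 1) 1 z
      ltac:(unfold b; rewrite <- RtoC_mult; f_equal; simpl; field)) as M2.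
    pose proof (vder_minus C_NormedModule _ _ z _ _ (primitive_vder z Hz)
      (vder_plus C_NormedModule _ _ z _ _ M1 M2)) as M.
    revert M; apply vder_ext.
    + intros w; change (primitive w - (1 * w ^ 1 * 1 + b * w ^ 2 * 1)
        = primitive w - (1 * w ^ 1 + b * w ^ 2))%C; ring.
    + change (neg_power alpha z - (1 * z ^ 0 * 1 + alpha * z ^ 1 * 1)
        = neg_power alpha z - (1 + z * alpha))%C; simpl; ring.
  - rewrite primitive_0; change (0 - (1 * 0 ^ 1 + b * 0 ^ 2) = 0)%C; simpl; ring. }
exists b; apply holo_intro; intros e He.
destruct (L2 e He) as [d [Hd K]]; exists d; split; [exact Hd|]; intros z Hz.
replace (z - 0)%C with z in * by ring; specialize (K z Hz).
change (Cmod (primitive z - (1 * z ^ 1 + b * z ^ 2)) <= e * Cmod z ^ 2) in K.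
destruct (Ceq_dec z 0) as [-> |H].
{ replace (quotient 0 - quotient 0 - 0 * b)%C with (RtoC 0) by ring; rewrite Cmod_0; lra. }
pose proof (proj1 (Cmod_gt_0 _) H) as P.
apply Rmult_le_reg_l with (1 := P); rewrite <- Cmod_mult, quotient_0.
replace (z * (quotient z - 1 - z * b))%C with (z * quotient z - (1 * z ^ 1 + b * z ^ 2))%C
  by (simpl; ring).
rewrite quotient_mult; apply Rle_trans with (1 := K); right; ring.
Qed.

Lemma quotient_holo z : Cmod z < 1 -> holo quotient z.
Proof.
intros Hz; destruct (Ceq_dec z 0) as [-> |H]; [exact quotient_vder_0|].
assert (D : holo (fun w => primitive w / w)%C z).
{ apply holo_div; [eexists; now apply primitive_vder|apply holo_id|exact H]. }
destruct D as [d D]; exists d.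
apply (fder_ext_loc C_NormedModule C_NormedModule (fun w => primitive w / w)%C quotient z _ (Cmod z)).
- now apply Cmod_gt_0.
- intros w Hw; change (Cmod (w - z) < Cmod z) in Hw.
  unfold quotient; destruct (Ceq_dec w 0) as [-> |W]; [|reflexivity].
  exfalso; replace (0 - z)%C with (- z)%C in Hw by ring; rewrite Cmod_opp in Hw; lra.
- exact D.
Qed.

Lemma quotient_derivative z d : Cmod z < 1 ->
  @vder C_NormedModule quotient z d -> (quotient z + z * d)%C = neg_power alpha z.
Proof.
intros Hz D; apply (vder_unique C_NormedModule primitive z); [|now apply primitive_vder].
pose proof (vder_Cmult (fun w => w) quotient z _ _ (vder_id z) D) as V.
revert V; apply vder_ext; [exact quotient_mult|].
change (1 * quotient z + z * d = quotient z + z * d)%C; ring.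
Qed.

End Extremal.

(** * Extremal mappings *)

Lemma norming_functional (V : CMod) (x0 : V) : norm x0 = 1 ->
  exists T : lin V C_NormedModule, support_functional x0 T.
Proof.
intros H; destruct (hahn_banach V x0) as [T [E B]].
exists T; split; [exact E|]; apply Rle_antisym.
- apply op_norm_le; intros v Hv; apply Rle_trans with (1 := B v), Hv.
- apply Rle_trans with (norm (T x0)); [|apply op_norm_ub; lra].
  change (1 <= Cmod (T x0)); rewrite E, H, Cmod_1; lra.
Qed.

Definition rank_one {X : CMod} (L : lin X C_NormedModule) (a : X) : lin X X :=
  Lin X X (fun v => scal (L v : C) a)
    (is_linear_comp L (fun s : C_NormedModule => scal (s : C) a) (lin_linear L)
       (is_linear_scal_const X a)).

Definition lin_id (X : CMod) : lin X X := Lin X X (fun v => v) is_linear_id.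

Fixpoint power_form {X : CMod} (L : lin X C_NormedModule) (k : nat) (a : C) :
    multilin k X C_NormedModule :=
  match k with
  | O => a
  | S m => Lin X (multilin m X C_NormedModule) (fun v => scal (L v : C) (power_form L m a))
      (is_linear_comp L (fun s : C_NormedModule => scal (s : C) (power_form L m a)) (lin_linear L)
         (is_linear_scal_const (multilin m X C_NormedModule) (power_form L m a)))
  end.

Lemma diag_power_form (X : CMod) (L : lin X C_NormedModule) k a x :
  diag k x (power_form L k a) = (a * L x ^ k)%C.
Proof.
induction k as [|k IH]; simpl; [ring|].
etransitivity; [exact (linear_scal _ (is_linear_diag X C_NormedModule k x) (L x) (power_form L k a))|].
etransitivity; [exact (f_equal (fun w : C => L x * w)%C IH)|]; ring.
Qed.

(** The Pochhammer symbol, produced by differentiating [(1 - z)^(-alpha)] [k] times. *)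
Fixpoint rising (alpha : R) (k : nat) : R :=
  match k with
  | O => 1
  | S m => rising alpha m * (alpha + INR m)
  end.

Section ExtremalMap.

Variables (X : CompleteNormedModule C_AbsRing) (L : lin X C_NormedModule) (alpha : R).
Hypothesis Ha : 2 <= alpha <= 3.
Hypothesis HL : forall v, Cmod (L v) <= norm v.

Definition extremal_map (x : X) : X := scal (quotient alpha (L x)) x.

Let F := extremal_map.

(** [d] is the derivative of [quotient] at [L x]; the first identity is the product rule for
    [z * quotient z = primitive z]. *)
Lemma extremal_fder (x : X) : norm x < 1 -> exists d : C,
  (quotient alpha (L x) + L x * d)%C = neg_power alpha (L x) /\
  fder F x (fun v => plus (scal (L v * d)%C x) (scal (quotient alpha (L x)) v)).
Proof.
intros Hx.
assert (Hz : Cmod (L x) < 1) by (apply Rle_lt_trans with (1 := HL x), Hx).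
destruct (quotient_holo alpha Ha (L x) Hz) as [d D]; exists d; split.
- now apply quotient_derivative.
- pose proof (fder_comp X C_NormedModule C_NormedModule L (quotient alpha) x L _
    (fder_linear X C_NormedModule L x (lin_linear L)) D) as Q.
  pose proof (fder_bilinear X C_NormedModule X X _ _ (fun y => y) x _ _ (bilinear_scal X) Q
    (fder_linear X X (fun y => y) x is_linear_id)) as P.
  exact P.
Qed.

Lemma extremal_holomorphic : holomorphic_on_ball F.
Proof.
intros x Hx; destruct (extremal_fder x Hx) as [d [_ D]].
eexists; apply fder_filterdiff, D.
Qed.

Lemma extremal_D (x : X) : norm x < 1 -> exists d : C,
  (quotient alpha (L x) + L x * d)%C = neg_power alpha (L x) /\
  forall v, D F x v = plus (scal (L v * d)%C x) (scal (quotient alpha (L x)) v).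
Proof.
intros Hx; destruct (extremal_fder x Hx) as [d [E H]]; exists d; split; [exact E|].
intros w; exact (frechet_unique X X F x _ w H).
Qed.

(** The derivative is [G] times the identity plus a rank-one map, so the Sherman-Morrison formula
    gives its inverse. Its denominators are [G] and [G + d L x = N], a power of [1 - L x], and
    neither vanishes. *)
Lemma extremal_invertible (x : X) : norm x < 1 -> exists B : lin X X, is_inverse (D F x) B.
Proof.
intros Hx.
assert (Hz : Cmod (L x) < 1) by (apply Rle_lt_trans with (1 := HL x), Hx).
destruct (extremal_D x Hx) as [d [E HD]].
set (G := quotient alpha (L x)) in *; set (N := neg_power alpha (L x)) in *.
assert (G0 : G <> 0) by now apply quotient_nz.
assert (N0 : N <> 0) by apply neg_power_nz.
exists (lin_scal X X (/ G)%C (lin_plus X X (lin_id X) (lin_scal X X (- (d / N))%C (rank_one L x)))).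
split; intros v.
- set (w := plus v (scal (- (d / N))%C (scal (L v : C) x)) : X).
  assert (Lw : L (scal (/ G)%C w) = (L v / N)%C).
  { unfold w; rewrite (linear_scal _ (lin_linear L)), (linear_plus _ (lin_linear L)),
      (linear_scal _ (lin_linear L)), (linear_scal _ (lin_linear L)).
    change (/ G * (L v + - (d / N) * (L v * L x)) = L v / N)%C.
    replace (L v + - (d / N) * (L v * L x))%C with (L v * (N - L x * d) / N)%C
      by (field; exact N0).
    rewrite <- E; field; rewrite E; split; assumption. }
  etransitivity; [exact (HD (scal (/ G)%C w))|].
  rewrite Lw; unfold w; module_field; split; assumption.
- transitivity (scal (/ G)%C (plus (D F x v) (scal (- (d / N))%C (scal (L (D F x v) : C) x))));
    [reflexivity|rewrite HD].
  assert (Lw : L (plus (scal (L v * d)%C x) (scal G v)) = (N * L v)%C).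
  { rewrite (linear_plus _ (lin_linear L)), !(linear_scal _ (lin_linear L)).
    change (L v * d * L x + G * L v = N * L v)%C; rewrite <- E; ring. }
  rewrite Lw; module_field; split; assumption.
Qed.

Lemma extremal_locally_biholomorphic : locally_biholomorphic F.
Proof. split; [exact extremal_holomorphic|exact extremal_invertible]. Qed.

Lemma extremal_normalized : normalized F.
Proof.
split; [unfold F, extremal_map; module_ring|]; intros v.
assert (N0 : norm (zero : X) = 0) by exact (@norm_zero _ X).
destruct (extremal_D zero) as [d [_ H]]; [lra|].
assert (Q : quotient alpha (L zero) = RtoC 1).
{ transitivity (quotient alpha 0); [f_equal; exact (linear_zero _ (lin_linear L))|].
  apply quotient_0. }
transitivity (plus (scal (L v * d)%C zero) (scal (RtoC 1) v)); [|module_ring].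
rewrite <- Q; exact (H v).
Qed.

Lemma extremal_slice_open (x : X) (s : C) : norm (scal s x) < 1 ->
  exists r, 0 < r /\ forall w, Cmod (w - s) < r -> norm (scal w x) < 1.
Proof.
intros Hs; pose proof (norm_ge_0 x) as Nx.
exists ((1 - norm (scal s x)) / (norm x + 1)); split; [apply Rdiv_lt_0_compat; lra|].
intros w Hw.
pose proof (norm_sum_le X (scal w x) (scal s x) (scal (w - s)%C x) ltac:(module_ring)) as T.
rewrite (norm_scal_C X (w - s)%C) in T.
assert (Cmod (w - s) * norm x <= Cmod (w - s) * (norm x + 1))
  by (apply Rmult_le_compat_l; [apply Cmod_ge_0|lra]).
apply Rmult_lt_compat_r with (r := norm x + 1) in Hw; [|lra].
replace ((1 - norm (scal s x)) / (norm x + 1) * (norm x + 1)) with (1 - norm (scal s x)) in Hw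
  by (field; lra).
lra.
Qed.

(** In the radial direction the rank-one part is again a multiple of [x], so
    [DF(s x) x = (1 - s L x)^(-alpha) x]; the higher derivatives are those of this scalar function
    of [s]. *)
Lemma extremal_Dn_slice (x : X) n (s : C) : norm (scal s x) < 1 ->
  Dn_diag (S n) F (scal s x) x =
    scal (RtoC (rising alpha n) * (L x ^ n * neg_power (alpha + INR n) (s * L x)))%C x.
Proof.
revert s; induction n as [|n IH]; intros s Hs.
- destruct (extremal_D (scal s x) Hs) as [d [E H]].
  change (Dn_diag 1 F (scal s x) x) with (D F (scal s x) x); rewrite H.
  assert (Es : L (scal s x) = (s * L x)%C) by exact (linear_scal _ (lin_linear L) s x).
  rewrite Es in *; simpl INR; rewrite Rplus_0_r, <- E; simpl rising; module_ring.
- destruct (extremal_slice_open x s Hs) as [r [Hr Hopen]].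
  apply (vder_unique X (fun w => Dn_diag (S n) F (scal w x) x) s).
  { exact (Dn_diag_slice X F x extremal_holomorphic (S n) s Hs). }
  assert (Hz : Cmod (s * L x) < 1).
  { apply Rle_lt_trans with (norm (scal s x)); [|exact Hs].
    rewrite norm_scal_C, Cmod_mult; apply Rmult_le_compat_l; [apply Cmod_ge_0|apply HL]. }
  assert (D1 : @vder C_NormedModule (fun w => w * L x)%C s (L x)).
  { pose proof (vder_Cmult (fun w => w) (fun _ => L x) s _ _ (vder_id s)
      (vder_const C_NormedModule (L x) s)) as V.
    revert V; apply vder_ext; [reflexivity|].
    change (1 * L x + s * 0 = L x)%C; ring. }
  pose proof (vder_comp C_NormedModule _ _ s _ _ D1 (neg_power_vder (alpha + INR n) _ Hz)) as D2.
  pose proof (vder_scal_r C_NormedModule _ s _ (RtoC (rising alpha n) * L x ^ n)%C D2) as D3.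
  pose proof (vder_scal X _ (fun _ => x) s _ _ D3 (vder_const X x s)) as D4.
  (* The induction hypothesis holds only while [w x] lies in the ball, hence the local form of
     extensionality. *)
  refine (fder_ext_loc C_NormedModule X _ (fun w => Dn_diag (S n) F (scal w x) x) s _ r Hr _ _).
  2: refine (vder_ext X _ _ s _ _ (fun w => eq_refl) _ D4).
  + intros w Hw; symmetry; etransitivity; [apply IH, Hopen, Hw|].
    change (scal (RtoC (rising alpha n) * (L x ^ n * neg_power (alpha + INR n) (w * L x)))%C x
      = scal (RtoC (rising alpha n) * L x ^ n * neg_power (alpha + INR n) (w * L x))%C x).
    module_ring.
  + rewrite S_INR; simpl rising; rewrite RtoC_mult, <- Rplus_assoc.
    change (plus (scal (RtoC (rising alpha n) * L x ^ n *
        (L x * (RtoC (alpha + INR n) * neg_power (alpha + INR n + 1) (s * L x))))%C x)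
      (scal (RtoC (rising alpha n) * L x ^ n * neg_power (alpha + INR n) (s * L x))%C zero)
      = scal (RtoC (rising alpha n) * RtoC (alpha + INR n) *
          (L x * L x ^ n * neg_power (alpha + INR n + 1) (s * L x)))%C x).
    module_ring.
Qed.

Lemma extremal_Dn_0 (x : X) n :
  Dn_diag (S n) F zero x = scal (RtoC (rising alpha n) * L x ^ n)%C x.
Proof.
assert (N0 : norm (scal (RtoC 0) x) < 1).
{ rewrite norm_scal_C, Cmod_0; lra. }
transitivity (Dn_diag (S n) F (scal (RtoC 0) x) x); [f_equal; module_ring|].
etransitivity; [exact (extremal_Dn_slice x n (RtoC 0) N0)|].
replace (0 * L x)%C with (RtoC 0) by ring; rewrite neg_power_0; module_ring.
Qed.

Lemma extremal_Dn_radial (x : X) n : norm x < 1 ->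
  Dn_diag (S n) F x x =
    scal (RtoC (rising alpha n) * (L x ^ n * neg_power (alpha + INR n) (L x)))%C x.
Proof.
intros Hx.
assert (N1 : norm (scal (RtoC 1) x) < 1).
{ rewrite norm_scal_C, Cmod_1; lra. }
transitivity (Dn_diag (S n) F (scal (RtoC 1) x) x); [f_equal; module_ring|].
etransitivity; [exact (extremal_Dn_slice x n (RtoC 1) N1)|].
now rewrite Cmult_1_l.
Qed.

Lemma extremal_scalar_type : scalar_type_coefficients F.
Proof.
intros k _.
set (a := (RtoC (/ INR (fact (k + 1))) * RtoC (rising alpha k))%C).
exists (fun x => (a * L x ^ k)%C); split.
- exists (power_form L k a); intros x; symmetry; apply diag_power_form.
- intros x; rewrite Nat.add_1_r in *; rewrite extremal_Dn_0; unfold a.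
  rewrite Nat.add_1_r; module_ring.
Qed.

(** [z / (1 - z)] sends the disc into [Re > - 1 / 2]. For [alpha = 1 + 2 lambda] the bound is
    [1 / 2 - lambda]. *)
Lemma Re_half_plane z : Cmod z < 1 -> 1 - alpha / 2 <= Re (1 + RtoC alpha * (z / (1 - z))).
Proof.
intros Hz; pose proof (one_minus_nz z Hz) as N.
assert (K : - / 2 <= Re (z / (1 - z))).
{ destruct z as [x y].
  assert (Q : x ^ 2 + y ^ 2 < 1).
  { pose proof (Cmod2_alt (x, y)) as E; simpl Re in E; simpl Im in E; rewrite <- E.
    pose proof (Cmod_ge_0 (x, y)); nra. }
  assert (Dn : 0 < (1 - x) ^ 2 + y ^ 2) by nra.
  replace (Re ((x, y) / (1 - (x, y)))) with ((x - (x ^ 2 + y ^ 2)) / ((1 - x) ^ 2 + y ^ 2))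
    by (simpl; field; nra).
  apply Rmult_le_reg_r with (1 := Dn); unfold Rdiv.
  rewrite Rmult_assoc, Rinv_l by lra; nra. }
replace (Re (1 + RtoC alpha * (z / (1 - z)))) with (1 + alpha * Re (z / (1 - z))).
- nra.
- rewrite <- re_scal_l; reflexivity.
Qed.

Lemma extremal_class lambda : alpha = 1 + 2 * lambda -> class_F lambda F.
Proof.
intros El; split; [exact extremal_normalized|]; split; [exact extremal_locally_biholomorphic|].
intros x Hx0 Hx T [HT _].
assert (Hz : Cmod (L x) < 1) by (apply Rle_lt_trans with (1 := HL x), Hx).
pose proof (extremal_Dn_radial x 0 Hx) as D1; pose proof (extremal_Dn_radial x 1 Hx) as D2.
simpl INR in D1, D2; rewrite Rplus_0_r in D1.
replace (rising alpha 1) with alpha in D2 by (simpl; ring).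
change (rising alpha 0) with 1 in D1.
pose proof (neg_power_shift alpha (L x) Hz) as Sh.
pose proof (one_minus_nz (L x) Hz) as Nz.
set (k := (1 + RtoC alpha * (L x / (1 - L x)))%C).
(* Both radial derivatives are multiples of [x], so the inverse returns [k x] and every support
   functional at [x] gives the same value [k]. *)
assert (E : plus (Dn_diag 2 F x x) (D F x x) = D F x (scal k x)).
{ rewrite (linear_scal _ (lin_linear (D F x))).
  change (D F x x) with (Dn_diag 1 F x x); rewrite D1, D2, Sh; unfold k.
  module_field; exact Nz. }
rewrite E.
assert (I : is_inverse (D F x) (inverse (D F x))).
{ unfold inverse; apply epsilon_spec; now apply extremal_invertible. }
rewrite (proj2 I), (linear_scal _ (lin_linear T)), (linear_scal _ (lin_linear T)), HT.
assert (P : 0 < norm x).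
{ destruct (Rle_lt_or_eq_dec _ _ (norm_ge_0 x)) as [H|H]; [exact H|].
  exfalso; apply Hx0, norm_eq_zero; now symmetry. }
assert (Nx : RtoC (norm x) <> 0) by (intros H; injection H; lra).
match goal with |- Re ?w >= _ => replace w with k end.
- apply Rle_ge; pose proof (Re_half_plane (L x) Hz); fold k in H; lra.
- change (k = RtoC (/ norm x) * (k * RtoC (norm x)))%C.
  rewrite RtoC_inv by lra; field; exact Nx.
Qed.

End ExtremalMap.

Lemma unit_vector (X : CMod) : (exists x : X, x <> zero) -> exists x0 : X, norm x0 = 1.
Proof.
intros [x Hx].
assert (P : 0 < norm x).
{ destruct (Rle_lt_or_eq_dec _ _ (norm_ge_0 x)) as [H|H]; [exact H|].
  exfalso; apply Hx, norm_eq_zero; now symmetry. }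
exists (scal (RtoC (/ norm x)) x).
rewrite norm_scal_C, Cmod_R, Rabs_pos_eq by now apply Rlt_le, Rinv_0_lt_compat.
field; lra.
Qed.

(* The rotation by [i] makes [A_2], [A_4] imaginary and [A_3] negative. *)
Lemma toeplitz_sharp (X : CompleteNormedModule C_AbsRing) (lambda : R) :
  (exists x : X, x <> zero) -> 1 / 2 <= lambda <= 1 ->
  exists (F : X -> X) (x0 : X) (T : lin X C_NormedModule),
    locally_biholomorphic F /\ scalar_type_coefficients F /\ class_F lambda F /\
    norm x0 = 1 /\ support_functional x0 T /\
    Cmod (toeplitz3_1 F x0 T) =
      (4 + 3 * lambda + 2 * lambda ^ 2) * (7 + 6 * lambda + 8 * lambda ^ 2) / 18 /\
    Cmod (toeplitz3_2 F x0 T) =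
      1 / 864 * (1 + 2 * lambda) ^ 3 * (9 + 5 * lambda + 2 * lambda ^ 2)
        * (25 + 17 * lambda + 10 * lambda ^ 2).
Proof.
intros HX Hl; destruct (unit_vector X HX) as [x0 Hx0].
destruct (norming_functional X x0 Hx0) as [T HT].
set (L := lin_scal X C_NormedModule Ci T).
assert (HL : forall v, Cmod (L v) <= norm v).
{ intros v; change (Cmod (Ci * T v) <= norm v); rewrite Cmod_mult, Cmod_Ci.
  pose proof (T_bound X x0 T HT v); lra. }
pose (alpha := 1 + 2 * lambda); assert (Ha : 2 <= alpha <= 3) by (unfold alpha; lra).
exists (extremal_map X L alpha), x0, T.
split; [now apply extremal_locally_biholomorphic|].
split; [now apply extremal_scalar_type|].
split; [now apply extremal_class|].
split; [exact Hx0|]; split; [exact HT|].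
pose proof (T_x0 X x0 T Hx0 HT) as T1.
assert (L1 : L x0 = Ci) by (change (Ci * T x0 = Ci)%C; rewrite T1; ring).
assert (A : forall n, coeff (extremal_map X L alpha) x0 T (S n)
  = (RtoC (/ INR (fact (S n))) * (RtoC (rising alpha n) * Ci ^ n))%C).
{ intros n; unfold coeff; rewrite (extremal_Dn_0 X L alpha Ha HL), L1.
  rewrite (linear_scal _ (lin_linear T)), T1.
  change (RtoC (/ INR (fact (S n))) * (RtoC (rising alpha n) * Ci ^ n * 1)
    = RtoC (/ INR (fact (S n))) * (RtoC (rising alpha n) * Ci ^ n))%C; ring. }
set (c := 1 / 2 + lambda).
assert (A2 : coeff (extremal_map X L alpha) x0 T 2 = (0, c)).
{ rewrite A; unfold alpha, c; simpl; apply injective_projections; simpl; field. }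
assert (A3 : coeff (extremal_map X L alpha) x0 T 3 = RtoC (- (c * (1 + 2 * c) / 3))).
{ rewrite A; unfold alpha, c; simpl; apply injective_projections; simpl; field. }
assert (A4 : coeff (extremal_map X L alpha) x0 T 4 = (0, - (c * (1 + c) * (1 + 2 * c) / 6))).
{ rewrite A; unfold alpha, c; simpl; apply injective_projections; simpl; field. }
unfold toeplitz3_1, toeplitz3_2, det3; rewrite A2, A3, A4.
split.
- replace ((4 + 3 * lambda + 2 * lambda ^ 2) * (7 + 6 * lambda + 8 * lambda ^ 2) / 18)
    with ((1 + c * (1 + 2 * c) / 3) * (1 + c * (4 * c - 1) / 3)) by (unfold c; field).
  assert (C1 : 1 <= c) by (unfold c; lra).
  transitivity (Cmod (RtoC ((1 + c * (1 + 2 * c) / 3) * (1 + c * (4 * c - 1) / 3)))).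
  + f_equal; apply injective_projections; simpl; field.
  + rewrite Cmod_R; apply Rabs_pos_eq; apply Rmult_le_pos; nra.
- replace (1 / 864 * (1 + 2 * lambda) ^ 3 * (9 + 5 * lambda + 2 * lambda ^ 2)
      * (25 + 17 * lambda + 10 * lambda ^ 2))
    with ((c + c * (1 + c) * (1 + 2 * c) / 6)
      * (c * c + c * c * (1 + 2 * c) * (1 + 5 * c) / 18)) by (unfold c; field).
  assert (C1 : 1 <= c) by (unfold c; lra).
  (* [A_2 - A_4] is [i] times a positive number and the other factor of the determinant is negative,
     hence the phase [- i]. *)
  transitivity (Cmod (- Ci * RtoC ((c + c * (1 + c) * (1 + 2 * c) / 6)
      * (c * c + c * c * (1 + 2 * c) * (1 + 5 * c) / 18)))%C).
  + f_equal; apply injective_projections; simpl; field.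
  + rewrite Cmod_mult, Cmod_opp, Cmod_Ci, Cmod_R, Rmult_1_l; apply Rabs_pos_eq.
    assert (0 <= c * (1 + c) * (1 + 2 * c)) by (repeat apply Rmult_le_pos; lra).
    assert (0 <= c * c * (1 + 2 * c) * (1 + 5 * c)) by (repeat apply Rmult_le_pos; lra).
    apply Rmult_le_pos; nra.
Qed.

Theorem theorem4p2 (X : CompleteNormedModule C_AbsRing)
    (hX : exists x : X, x <> zero)
    (lambda : R) (hlambda : 1 / 2 <= lambda <= 1) :
  (forall F : X -> X,
     locally_biholomorphic F ->
     scalar_type_coefficients F ->
     class_F lambda F ->
     forall (x0 : X) (T : lin X C_NormedModule),
       norm x0 = 1 -> support_functional x0 T ->
       Cmod (toeplitz3_1 F x0 T) <=
         (4 + 3 * lambda + 2 * lambda ^ 2) * (7 + 6 * lambda + 8 * lambda ^ 2) / 18 /\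
       Cmod (toeplitz3_2 F x0 T) <=
         1 / 864 * (1 + 2 * lambda) ^ 3 * (9 + 5 * lambda + 2 * lambda ^ 2)
           * (25 + 17 * lambda + 10 * lambda ^ 2)) /\
  (exists (F : X -> X) (x0 : X) (T : lin X C_NormedModule),
     locally_biholomorphic F /\ scalar_type_coefficients F /\ class_F lambda F /\
     norm x0 = 1 /\ support_functional x0 T /\
     Cmod (toeplitz3_1 F x0 T) =
       (4 + 3 * lambda + 2 * lambda ^ 2) * (7 + 6 * lambda + 8 * lambda ^ 2) / 18) /\
  (exists (F : X -> X) (x0 : X) (T : lin X C_NormedModule),
     locally_biholomorphic F /\ scalar_type_coefficients F /\ class_F lambda F /\
     norm x0 = 1 /\ support_functional x0 T /\
     Cmod (toeplitz3_2 F x0 T) =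
       1 / 864 * (1 + 2 * lambda) ^ 3 * (9 + 5 * lambda + 2 * lambda ^ 2)
           * (25 + 17 * lambda + 10 * lambda ^ 2)).
Proof.
(* One map attains both bounds at the same unit vector. *)
destruct (toeplitz_sharp X lambda hX hlambda)
  as [F [x0 [T [H1 [H2 [H3 [H4 [H5 [H6 H7]]]]]]]]].
split; [|split].
- intros G _ HS HG y0 S Hy HSy; now apply toeplitz_upper_bounds.
- exists F, x0, T; tauto.
- exists F, x0, T; tauto.
Qed.
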